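(* Let $M$ be an oriented one-cusped hyperbolic 3-manifold with trace field $F$, $\mathcal T$ an ideal triangulation of $M$ supporting the geometric representation, $\alpha:\pi_1(M)\to\mathbb Z$ an epimorphism and $\mu$ a peripheral curve with $\alpha(\mu)=1$. Let $\lambda$ be the peripheral curve satisfying $\alpha(\lambda)=0$. Then the twisted 1-loop invariant $\tau^{\mathrm{CS}}(\mathcal T,t)$ and the 1-loop invariant $\tau^{\mathrm{CS}}_\lambda(\mathcal T)$ satisfy $$\tau^{\mathrm{CS}}(\mathcal T,1)=0\qquad\text{and}\qquad \left.\frac{d}{dt}\right|_{t=1}\tau^{\mathrm{CS}}(\mathcal T,t)=\tau^{\mathrm{CS}}_\lambda(\mathcal T)\in F/(\pm1).$$
   Context: $M$ is an oriented (complete, finite volume) hyperbolic 3-manifold with one torus cusp. An ideal triangulation $\mathcal T$ of $M$ with $N$ tetrahedra $\Delta_1,\dots,\Delta_N$ has exactly $N$ edges $e_1,\dots,e_N$. A quad type of a tetrahedron is a pair of opposite edges. Fixing a quad type of each oriented tetrahedron $\Delta_j$, the pairs of opposite edges of $\Delta_j$ are labelled by shape parameters $z_j,\ z_j'=\frac1{1-z_j},\ z_j''=1-\frac1{z_j}$ with $z_j\in\mathbb C\setminus\{0,1\}$ (the chosen quad type gets $z_j$; seen from each ideal vertex the labels occur in the counterclockwise cyclic order $z_j,z'_j,z''_j$). The symbol $\square$ stands for no prime, one prime or two primes. $\mathbf G^\square$ is the $N\times N$ matrix whose $(i,j)$-entry is the number of edges of $\Delta_j$ labelled $z_j^\square$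 incident (identified) to $e_i$. A peripheral curve is an oriented homotopically non-trivial simple closed curve in the peripheral torus. For a peripheral curve $\gamma$, in normal position with respect to the triangulation of the peripheral torus induced by $\mathcal T$, $\mathbf C_\gamma^\square\in\mathbb Z^N$ is the row vector whose $j$-th entry is the signed number of triangle corners labelled $z_j^\square$ cut off by $\gamma$ (sign $+$ or $-$ according to whether the corner lies to the left or right of $\gamma$). $\mathcal T$ supports the geometric representation if there are shapes $z_j$ satisfying the gluing equations $\prod_j\prod_\square (z_j^{\square})^{\mathbf G^\square_{ij}}=1$ for all $i$ (logarithmically, $\sum_j\sum_\square \mathbf G^\square_{ij}\log z_j^\square=2\pi\sqrt{-1}$) and the completeness equations ($\sum_j\sum_\square \mathbf C^\square_{\gamma j}\log z^\square_j=0$), whose holonomy is the geometric (discrete faithful) representation of $\pi_1(M)$; these shapes are used below. Put $\zeta_j=\frac1{z_j}$, $\zeta_j'=\frac1{1-z_j}$, $\zeta_j''=\frac1{z_j(z_j-1)}$, and $\mathrm{diag}(\zeta^\square)=\mathrm{diag}(\zeta_1^\square,\dots,\zeta_N^\square)$. A combinatorial flattening of $\mathcal T$ is a triple $(f,f',f'')$ of column vectors in $\mathbb Z^N$ with $\mathbf Gf+\mathbf G'f'+\mathbf G''f''=(2,\dots,2)^T$, $f+f'+f''=(1,\dots,1)^T$, and $\mathbf C_\gamma f+\mathbf C'_\gamma f'+\mathbf C''_\gamma f''=0$ for every peripheral curve $\gamma$; these always exist. 1-loop invariant: for a peripheral curve $\gamma$, let $\widehat{\mathbf G}^\square$ be $\mathbf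 G^\square$ with its last row replaced by $\mathbf C_\gamma^\square$; then $$\tau^{\mathrm{CS}}_\gamma(\mathcal T)=\frac{\det\big(\widehat{\mathbf G}\,\mathrm{diag}(\zeta)+\widehat{\mathbf G}'\,\mathrm{diag}(\zeta')+\widehat{\mathbf G}''\,\mathrm{diag}(\zeta'')\big)}{2\prod_{j=1}^N\zeta_j^{f_j}\zeta_j'^{f_j'}\zeta_j''^{f_j''}}\in F/(\pm1).$$ Twisted 1-loop invariant: $\widetilde M$ is the cover of $M$ corresponding to $\alpha^{-1}(0)$, with lifted ideal triangulation $\widetilde{\mathcal T}$; its deck group $\mathbb Z$ is generated by the action of $\mu$. Choose lifts $\widetilde e_i,\widetilde\Delta_j$ to $\widetilde{\mathcal T}$. $\mathbf G_k^\square$ is the $N\times N$ matrix whose $(i,j)$-entry is the number of edges of $\mu^k\cdot\widetilde\Delta_j$ labelled $z_j^\square$ incident to $\widetilde e_i$, and $\mathbf G^\square(t)=\sum_{k\in\mathbb Z}\mathbf G_k^\square t^k$. Then $$\tau^{\mathrm{CS}}(\mathcal T,t)=\frac{\det\big(\mathbf G(t)\,\mathrm{diag}(\zeta)+\mathbf G'(t)\,\mathrm{diag}(\zeta')+\mathbf G''(t)\,\mathrm{diag}(\zeta'')\big)}{\prod_{j=1}^N\zeta_j^{f_j}\zeta_j'^{f_j'}\zeta_j''^{f_j''}}\in F[t^{\pm1}]/(\pm t^{\mathbb Z}),$$ where $/(\pm t^{\mathbb Z})$ means up to multiplication by $\pm t^r$, $r\in\mathbb Z$; modulo this it is independent of the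 choices of flattening, quad types and lifts. (Given the vanishing at $t=1$, the derivative at $t=1$ is well defined up to sign.) *)

(* Defs.v *)
From HB Require Import structures.
From mathcomp Require Import all_boot all_order all_algebra.
From mathcomp Require Import fingroup perm.
From mathcomp Require Import fraction complex.
From mathcomp Require Import all_classical all_reals all_analysis.

Set Implicit Arguments.
Unset Strict Implicit.
Unset Printing Implicit Defensive.
Import Order.TTheory GRing.Theory Num.Theory.
Local Open Scope ring_scope.

Definition o0 : 'I_4 := @Ordinal 4 0 isT.
Definition o1 : 'I_4 := @Ordinal 4 1 isT.
Definition o2 : 'I_4 := @Ordinal 4 2 isT.
Definition o3 : 'I_4 := @Ordinal 4 3 isT.

(* The vertices of every oriented tetrahedron are numbered by 'I_4, face [f]
   being the one opposite to vertex [f].  The numbering is compatible with the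
   orientation, which is read through [ccw]: seen from the ideal vertex [v], the
   corners [a], [b], [c] of the triangle cut off at [v] (corner [a] lying on the
   edge [v a]) occur in counterclockwise order. *)
Definition ccw (v a b c : 'I_4) : bool :=
  [exists p : 'S_4, [&& ~~ odd_perm p, p o0 == v, p o1 == a, p o2 == b
                      & p o3 == c]].

(* Pairs of opposite edges: 01|23 -> 0, 02|13 -> 1, 03|12 -> 2. *)
Definition opp_pair (a b : 'I_4) : nat :=
  if (a + b <= 3)%N then (a + b).-1 else (5 - (a + b))%N.

(* Number of primes (0, 1 or 2) on the shape labelling edge [a b], when [q] is
   the quad type carrying the unprimed shape; see [prime_label_ccw]. *)
Definition prime_label (q : 'I_3) (a b : 'I_4) : 'I_3 :=
  Ordinal (ltn_pmod (opp_pair a b + 3 - q) (isT : (0 < 3)%N)).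

Lemma tpermE4 (x y a : 'I_4) :
  tperm x y a = if a == x then y else if a == y then x else a.
Proof. by case: tpermP => [->|->|/eqP/negPf-> /eqP/negPf->]; rewrite ?eqxx //; case: eqP. Qed.

Lemma ord4E (x : 'I_4) : [\/ x = o0, x = o1, x = o2 | x = o3].
Proof.
case: x => [[|[|[|[|m]]]] h] //; [apply: Or41|apply: Or42|apply: Or43|apply: Or44];
  exact: val_inj.
Qed.

Lemma odd_perm4 (p : 'S_4) :
  let q1 := tperm o0 (p o0) in
  let q2 := tperm o1 (q1 (p o1)) in
  odd_perm p = (o0 != p o0) (+) (o1 != q1 (p o1)) (+) (o2 != q2 (q1 (p o2))).
Proof.
move=> q1 q2.
set q3 := tperm o2 (q2 (q1 (p o2))).
have E : (p * q1 * q2 * q3 = 1)%g.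
  have inj : injective (p * q1 * q2 * q3)%g by apply: perm_inj.
  have H0 : (p * q1 * q2 * q3)%g o0 = o0.
    rewrite !permM /q1 tpermR.
    have n1 : q2 o0 = o0.
      rewrite /q2 tpermD // /q1 tpermE4.
      have := @perm_inj _ p o0 o1.
      by case: (ord4E (p o0)) => ->; case: (ord4E (p o1)) => -> //= /(_ erefl).
    rewrite n1 /q3 tpermD //.
    apply/eqP => h; have : o2 = o0; last by [].
    apply: (@perm_inj _ (p * q1 * q2)%g); rewrite !permM /q1 tpermR -/q1 n1; exact: h.
  have H1 : (p * q1 * q2 * q3)%g o1 = o1.
    rewrite !permM /q2 tpermR -/q2 /q3 tpermD //.
    apply/eqP => h; have : o2 = o1; last by [].
    apply: (@perm_inj _ (p * q1 * q2)%g); rewrite !permM {2}/q2 tpermR; exact: h.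
  have H2 : (p * q1 * q2 * q3)%g o2 = o2 by rewrite !permM /q3 tpermR.
  apply/permP => x; rewrite perm1.
  case: (ord4E x) => -> //.
  case: (ord4E ((p * q1 * q2 * q3)%g o3)) => // h;
    by [have := inj o3 o0; rewrite h H0 => /(_ erefl)
       |have := inj o3 o1; rewrite h H1 => /(_ erefl)
       |have := inj o3 o2; rewrite h H2 => /(_ erefl)].
have := congr1 (@odd_perm _) E.
rewrite !odd_permM !odd_tperm odd_perm1.
by case: (odd_perm p); do 3 case: (_ != _).
Qed.

Lemma prime_label_ccw (q : 'I_3) (v a b c : 'I_4) : ccw v a b c ->
  prime_label q v b = ((prime_label q v a).+1 %% 3)%N :> nat.
Proof.
case/existsP => p /and5P[op /eqP<- /eqP<- /eqP<- _].
move: op; rewrite odd_perm4.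
have i01 := @perm_inj _ p o0 o1; have i02 := @perm_inj _ p o0 o2.
have i12 := @perm_inj _ p o1 o2.
move: i01 i02 i12; rewrite !tpermE4.
case: (ord4E (p o0)) => ->; case: (ord4E (p o1)) => -> // i01;
  case: (ord4E (p o2)) => -> // i02 i12;
  try (by have := i01 erefl); try (by have := i02 erefl);
  try (by have := i12 erefl); rewrite //= => _;
  by case: q => [[|[|[|m]]]].
Qed.

(* A path is given by its initial cell and by the word of letters along which
   [step] moves; [rel x r] says that the word [r] is a contractible loop at the
   cell [x]. *)
Inductive homotopic (X L : Type) (step : X -> L -> X) (rel : X -> seq L -> Prop)
    (x : X) : seq L -> seq L -> Prop :=
| htp_refl w : homotopic step rel x w w
| htp_sym w w' : homotopic step rel x w w' -> homotopic step rel x w' w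
| htp_trans w w' w'' : homotopic step rel x w w' ->
    homotopic step rel x w' w'' -> homotopic step rel x w w''
| htp_rel u r v : rel (foldl step x u) r ->
    homotopic step rel x (u ++ r ++ v) (u ++ v).

(* [glue_tet j f] is the tetrahedron glued to face [f] of tetrahedron [j] and
   [glue_perm j f] extends the gluing of the two faces to a bijection between the
   vertices of the two tetrahedra, mapping [f] to the face glued to it.  Since the
   gluings reverse the orientations of the faces, these bijections are odd. *)
Record gluing (n : nat) := Gluing {
  glue_tet : 'I_n.+1 -> 'I_4 -> 'I_n.+1;
  glue_perm : 'I_n.+1 -> 'I_4 -> 'S_4 }.

Section Triangulation.
Variables (n : nat) (T : gluing n).
Local Notation tet := 'I_n.+1.
Local Notation gt := (glue_tet T).
Local Notation gp := (glue_perm T).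

Definition oriented_gluing : Prop :=
  forall j f,
    [/\ odd_perm (gp j f),
        gt (gt j f) (gp j f f) = j,
        gp (gt j f) (gp j f f) = (gp j f)^-1%g
      & (gt j f, gp j f f) <> (j, f)].

(* Turning around an edge: a flag [(j, p)] is tetrahedron [j] seen from its
   vertex [p 0], about to turn around the edge [p 0, p 1] by leaving through face
   [p 2]; the orbit of [turn] is a full turn. *)
Definition turn (x : tet * 'S_4) : tet * 'S_4 :=
  (gt x.1 (x.2 o2), (tperm o2 o3 * x.2 * gp x.1 (x.2 o2))%g).

Definition turn_word (x : tet * 'S_4) : seq 'I_4 :=
  [seq (y : tet * 'S_4).2 o2 | y <- orbit turn x].

(* The link: triangle [(j, v)] is cut off at vertex [v] of tetrahedron [j]; its
   sides lie in the faces [f != v]. *)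
Definition lstep (x : tet * 'I_4) (f : 'I_4) : tet * 'I_4 :=
  (gt x.1 f, gp x.1 f x.2).

Definition one_cusped : Prop :=
  forall x y : tet * 'I_4,
    connect [rel x y | [exists f, (f != x.2) && (lstep x f == y)]] x y.

(* A vertex of the link is an orbit of [turn] on the even flags, which encode the
   corners [(j, p 0, p 1)]. *)
Definition link_vertices : nat :=
  fcard turn [pred x : tet * 'S_4 | ~~ odd_perm x.2].
Definition link_sides : nat := (3 * (4 * n.+1))./2.
Definition link_triangles : nat := 4 * n.+1.

(* The link is oriented and, having a single component, is a torus if and only if
   its Euler characteristic vanishes. *)
Definition torus_link : Prop :=
  (link_vertices + link_triangles = link_sides)%N.

Definition one_cusped_triangulation : Prop :=
  [/\ oriented_gluing, one_cusped & torus_link].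

(* [around (j, a, b) w (j', c, d)]: turning around the edge [a b] of tetrahedron
   [j] and crossing successively the faces [w], one reaches the edge [c d] of
   tetrahedron [j'] (edges are not oriented). *)
Inductive around : tet * 'I_4 * 'I_4 -> seq 'I_4 -> tet * 'I_4 * 'I_4 -> Prop :=
| around_nil j a b : around (j, a, b) [::] (j, a, b)
| around_flip j a b : around (j, a, b) [::] (j, b, a)
| around_cons j a b f w y : f != a -> f != b ->
    around (gt j f, gp j f a, gp j f b) w y -> around (j, a, b) (f :: w) y.

(* [e i] represents the [i]-th edge of the triangulation. *)
Definition edge_enumeration (e : tet -> tet * 'I_4 * 'I_4) : Prop :=
  (forall i, (e i).1.2 <> (e i).2) /\
  (forall j a b, a <> b -> exists! i, exists w, around (j, a, b) w (e i)).

(* Paths in the dual 1-skeleton: words of faces crossed successively. *)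
Definition walk (j : tet) (w : seq 'I_4) : tet := foldl gt j w.

Fixpoint rev_walk (j : tet) (w : seq 'I_4) : seq 'I_4 :=
  if w is f :: w' then rcons (rev_walk (gt j f) w') (gp j f f) else [::].

Definition M_relator (j : tet) (r : seq 'I_4) : Prop :=
  (exists f, r = [:: f; gp j f f]) \/ (exists p, r = turn_word (j, p)).

Definition M_homotopic : tet -> seq 'I_4 -> seq 'I_4 -> Prop :=
  homotopic gt M_relator.

Definition link_relator (x : tet * 'I_4) (r : seq 'I_4) : Prop :=
  (exists f, f != x.2 /\ r = [:: f; gp x.1 f f]) \/
  (exists p : 'S_4, p o0 = x.2 /\ r = turn_word (x.1, p)).

Definition link_homotopic : tet * 'I_4 -> seq 'I_4 -> seq 'I_4 -> Prop :=
  homotopic lstep link_relator.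

Definition base : tet := ord0.
Definition loop (w : seq 'I_4) : Prop := walk base w = base.

(* An epimorphism from pi_1(M, base) to Z, given on representatives; its values
   on words that are not loops are irrelevant. *)
Definition pi1_epi (alpha : seq 'I_4 -> int) : Prop :=
  [/\ forall u v, loop u -> loop v -> alpha (u ++ v) = alpha u + alpha v,
      forall u v, loop u -> loop v -> M_homotopic base u v -> alpha u = alpha v
    & forall m, exists2 u, loop u & alpha u = m].

(* A closed curve in normal position is the cyclic word of its crossings: the
   crossing [(j, v, f)] leaves triangle [(j, v)] through its side in face [f]. *)
Definition crossing : Type := (tet * 'I_4 * 'I_4)%type.
Definition cr_src (d : crossing) : tet * 'I_4 := d.1.
Definition cr_tgt (d : crossing) : tet * 'I_4 := lstep d.1 d.2.
Definition cr_inv (d : crossing) : crossing :=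
  (cr_tgt d, gp d.1.1 d.2 d.2).

Definition normal_step (d d' : crossing) : bool :=
  (cr_tgt d == cr_src d') && (d' != cr_inv d).

Definition normal_closed (c : seq crossing) : Prop :=
  all (fun d : crossing => d.2 != d.1.2) c /\ path.cycle normal_step c.

(* Consecutive crossings: [(d, d')] is the normal arc that enters triangle
   [cr_src d'] by crossing [d] and leaves it by crossing [d']. *)
Definition arcs (X : Type) (c : seq X) : seq (X * X) := zip (rotr 1 c) c.

(* Simplicity: the curve is realised by straight segments.  [x : 'I_4 -> rat]
   gives the barycentric coordinates, in triangle [cr_src d], of the point where
   the crossing [d] takes place (the coordinate of index [a] refers to corner [a],
   the one of index [d.1.2] is not used and set to 0).  Two distinct segments
   lying in the same closed triangle must be disjoint.  Rational coordinates lose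
   nothing, since the combinatorial data only depend on the order of the crossing
   points along the sides. *)
Definition side_point (d : crossing) (x : 'I_4 -> rat) : Prop :=
  [/\ x d.1.2 = 0, x d.2 = 0,
      forall a, a != d.1.2 -> a != d.2 -> 0 < x a & \sum_a x a = 1].

Definition transport (d : crossing) (x : 'I_4 -> rat) : 'I_4 -> rat :=
  fun a => x ((gp d.1.1 d.2)^-1%g a).

Definition segment_point (s : rat)
    (A : (crossing * ('I_4 -> rat)) * (crossing * ('I_4 -> rat))) (a : 'I_4) : rat :=
  (1 - s) * transport A.1.1 A.1.2 a + s * A.2.2 a.

Definition disjoint_segments
    (A B : (crossing * ('I_4 -> rat)) * (crossing * ('I_4 -> rat))) : Prop :=
  forall s t : rat, 0 <= s <= 1 -> 0 <= t <= 1 ->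
    ~ (forall a, segment_point s A a = segment_point t B a).

Definition simple_curve (c : seq crossing) : Prop :=
  exists X : seq ('I_4 -> rat),
    [/\ size X = size c,
        forall i d x, onth (zip c X) i = Some (d, x) -> side_point d x
      & forall i k A B, i <> k ->
          onth (arcs (zip c X)) i = Some A -> onth (arcs (zip c X)) k = Some B ->
          cr_src A.2.1 = cr_src B.2.1 -> disjoint_segments A B].

Definition face_word (c : seq crossing) : seq 'I_4 := [seq d.2 | d <- c].

Definition nontrivial_in_link (c : seq crossing) : Prop :=
  if c is d :: _ then ~ link_homotopic (cr_src d) (face_word c) [::] else False.

Definition peripheral_curve (c : seq crossing) : Prop :=
  [/\ normal_closed c, simple_curve c & nontrivial_in_link c].

(* The value of [alpha] on the free homotopy class of a closed curve. *)
Definition curve_value (alpha : seq 'I_4 -> int) (c : seq crossing) (k : int)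
    : Prop :=
  if c is d :: _ then
    exists2 u, walk base u = d.1.1
             & alpha (u ++ face_word c ++ rev_walk base u) = k
  else k = 0.

(* [q j] is the quad type of tetrahedron [j]; the index [s : 'I_3] is the number
   of primes of the symbol written as a square. *)
Section Labels.
Variable q : tet -> 'I_3.
Variable e : tet -> tet * 'I_4 * 'I_4.

Definition label (j : tet) (a b : 'I_4) : 'I_3 := prime_label (q j) a b.

Definition edges_of (j : tet) (s : 'I_3) : {set 'I_4 * 'I_4} :=
  [set ab : 'I_4 * 'I_4 | (ab.1 < ab.2)%N && (label j ab.1 ab.2 == s)]%SET.

Definition G (s : 'I_3) : 'M[int]_n.+1 :=
  \matrix_(i, j)
    #|[set ab in edges_of j s | `[< exists w, around (j, ab.1, ab.2) w (e i) >]]|%:Z.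

(* Seen from the cusp, an arc entering through the side in face [f] and leaving
   through the side in face [g] cuts off the corner [w] common to both sides.
   The corner is on its left when [w], [g], [f] are in counterclockwise order and
   on its right when [w], [f], [g] are. *)
Definition corner_sign (v w f g : 'I_4) : int :=
  (ccw v w g f)%:Z - (ccw v w f g)%:Z.

Definition Cv (c : seq crossing) (s : 'I_3) : 'rV[int]_n.+1 :=
  \row_j \sum_(A <- arcs c | A.2.1.1 == j)
    \sum_(w | label j A.2.1.2 w == s)
      corner_sign A.2.1.2 w (cr_inv A.1).2 A.2.2.

Definition flattening (f : 'I_3 -> 'cV[int]_n.+1) : Prop :=
  [/\ \sum_s G s *m f s = const_mx 2,
      \sum_s f s = const_mx 1
    & forall c, peripheral_curve c -> \sum_s Cv c s *m f s = 0].

(* The cover of M defined by ker alpha.  Its tetrahedra are the classes [[u]] of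
   paths [u] from the base tetrahedron, [[u] = [v]] meaning that [u] and [v] have
   the same end and that [alpha] vanishes on the loop [u v^-1]; the deck
   transformation mu^k maps [[u]] to [[g u]] for any loop [g] with
   [alpha g = k].  The chosen lift of tetrahedron [j] is [[pT j]], and the chosen
   lift of the edge [e i] is the edge of [[pE i]] with the same end vertices.
   The edge [a b] of mu^k [[pT j]] is identified with it when turning around
   [a b] along some [w] leads to [e i] in the tetrahedron
   mu^k [[pT j w]] = [[pE i]]. *)
Definition lifts (pT pE : tet -> seq 'I_4) : Prop :=
  (forall j, walk base (pT j) = j) /\ (forall i, walk base (pE i) = (e i).1.1).

Variables (alpha : seq 'I_4 -> int) (pT pE : tet -> seq 'I_4).

Definition Gk (k : int) (s : 'I_3) : 'M[int]_n.+1 :=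
  \matrix_(i, j)
    #|[set ab in edges_of j s |
        `[< exists2 w, around (j, ab.1, ab.2) w (e i)
                     & k + alpha (pT j ++ w ++ rev_walk base (pE i)) = 0 >]]|%:Z.

End Labels.

Section Shapes.
Variable K : fieldType.
Variable z : tet -> K.

Definition shape_param (s : 'I_3) (j : tet) : K :=
  nth 0 [:: z j; (1 - z j)^-1; 1 - (z j)^-1] s.

Definition zeta (s : 'I_3) (j : tet) : K :=
  nth 0 [:: (z j)^-1; (1 - z j)^-1; (z j * (z j - 1))^-1] s.

Definition diag_zeta (s : 'I_3) : 'M[K]_n.+1 := diag_mx (\row_j zeta s j).

Definition gluing_equations (q : tet -> 'I_3) (e : tet -> tet * 'I_4 * 'I_4) : Prop :=
  forall i, \prod_j \prod_s shape_param s j ^ G q e s i j = 1.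

Definition completeness_equations (q : tet -> 'I_3) : Prop :=
  forall c, peripheral_curve c -> \prod_j \prod_s shape_param s j ^ Cv q c s ord0 j = 1.

Definition zeta_power (f : 'I_3 -> 'cV[int]_n.+1) : K :=
  \prod_j \prod_s zeta s j ^ f s j ord0.

Definition Ghat (q : tet -> 'I_3) (e : tet -> tet * 'I_4 * 'I_4)
    (c : seq crossing) (s : 'I_3) : 'M[int]_n.+1 :=
  \matrix_(i, j) if i == ord_max then Cv q c s ord0 j else G q e s i j.

Definition one_loop (q : tet -> 'I_3) (e : tet -> tet * 'I_4 * 'I_4)
    (f : 'I_3 -> 'cV[int]_n.+1) (c : seq crossing) : K :=
  \det (\sum_s map_mx (fun m : int => m%:~R) (Ghat q e c s) *m diag_zeta s)
    / (2 * zeta_power f).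

(* Laurent polynomials over K are handled inside the field K(t). *)
Local Notation Kt := {fraction {poly K}}.
Local Notation "P %:F" := (FracField.tofrac P).
Definition tvar : Kt := ('X)%:F.
Definition cst (a : K) : Kt := (a%:P)%:F.

Definition Gt (q : tet -> 'I_3) (e : tet -> tet * 'I_4 * 'I_4)
    (alpha : seq 'I_4 -> int) (pT pE : tet -> seq 'I_4) (s : 'I_3) : 'M[Kt]_n.+1 :=
  \matrix_(i, j)
    \sum_(k \in [set: int]) (Gk q e alpha pT pE k s i j)%:~R * tvar ^ k.

Definition twisted_one_loop (q : tet -> 'I_3) (e : tet -> tet * 'I_4 * 'I_4)
    (alpha : seq 'I_4 -> int) (pT pE : tet -> seq 'I_4)
    (f : 'I_3 -> 'cV[int]_n.+1) : Kt :=
  \det (\sum_s Gt q e alpha pT pE s *m map_mx cst (diag_zeta s))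
    / cst (zeta_power f).

(* The Laurent polynomial P / t^m, its value and its derivative at t = 1. *)
Definition laurent_value1 (x : Kt) (v : K) : Prop :=
  exists (m : nat) (P : {poly K}), x = P%:F / tvar ^+ m /\ v = P.[1].

Definition laurent_deriv1 (x : Kt) (v : K) : Prop :=
  exists (m : nat) (P : {poly K}),
    x = P%:F / tvar ^+ m /\ v = P^`().[1] - m%:R * P.[1].

End Shapes.

Section Geometry.
Variable R : realType.
Local Notation C := (complex R).
Variables (q : tet -> 'I_3) (z : tet -> C).

(* Homogeneous coordinates of the vertices of tetrahedron [j] in standard
   position: infinity, 0, 1 and the shape of the edge joining infinity to 0. *)
Definition std_vertex (j : tet) (v : 'I_4) : 'cV[C]_2 :=
  \col_i nth 0 [:: nth 0 [:: 1; 0; 1; shape_param z (label q j o0 o1) j] v;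
                   nth 0 [:: 0; 1; 1; 1] v] i.

(* [A j f] moves the tetrahedron glued to face [f] of [j] from its standard
   position to the position adjacent to [j] along [f]; this determines [A j f] up
   to a scalar. *)
Definition developing_matrices (A : tet -> 'I_4 -> 'M[C]_2) : Prop :=
  forall j f, A j f \in unitmx /\
    forall v, v != f -> exists c : C,
      A j f *m std_vertex (gt j f) (gp j f v) = c *: std_vertex j v.

Variable A : tet -> 'I_4 -> 'M[C]_2.

Fixpoint holonomy (j : tet) (w : seq 'I_4) : 'M[C]_2 :=
  if w is f :: w' then A j f *m holonomy (gt j f) w' else 1%:M.

(* The preimage in SL_2(C) of the image of the holonomy representation
   pi_1(M, base) -> PGL_2(C) = PSL_2(C). *)
Definition holonomy_group (B : 'M[C]_2) : Prop :=
  \det B = 1 /\ exists w (c : C), loop w /\ B = c *: holonomy base w.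

Definition holonomy_faithful : Prop :=
  forall w, loop w -> is_scalar_mx (holonomy base w) -> M_homotopic base w [::].

Definition holonomy_discrete : Prop :=
  forall B, holonomy_group B -> exists2 eps : R, 0 < eps &
    forall B', holonomy_group B' ->
      (forall i k, `|B' i k - B i k| < real_complex R eps) -> B' = B.

(* The upper half-space {((x, y), t) | 0 < t}, the Poincare extension of the
   Moebius transformation given by a matrix of determinant 1, and the hyperbolic
   volume dx dy dt / t^3. *)
Definition half_space : set (R * R * R) := [set p | 0 < p.2].

Definition poincare (B : 'M[C]_2) (p : R * R * R) : R * R * R :=
  let w : C := Complex p.1.1 p.1.2 in
  let t : C := real_complex R p.2 in
  let a := B ord0 ord0 in let b := B ord0 ord_max in
  let c := B ord_max ord0 in let d := B ord_max ord_max in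
  let den := `|c * w + d| ^+ 2 + `|c| ^+ 2 * t ^+ 2 in
  let w' := ((a * w + b) * conjc (c * w + d) + a * conjc c * t ^+ 2) / den in
  (complex.Re w', complex.Im w', complex.Re (t / den)).

Definition hyperbolic_volume (D : set (R * R * R)) : \bar R :=
  (\int[(@lebesgue_measure R \x @lebesgue_measure R) \x @lebesgue_measure R]_(p in D)
     (p.2 ^- 3)%:E)%E.

Definition finite_covolume : Prop :=
  exists D : set (measurableTypeR R * measurableTypeR R * measurableTypeR R),
    [/\ measurable D, (D `<=` half_space)%classic,
        forall p, half_space p -> exists2 B, holonomy_group B & D (poincare B p)
      & (hyperbolic_volume D < +oo)%E].

Definition geometric_holonomy : Prop :=
  [/\ developing_matrices A, holonomy_faithful, holonomy_discrete
    & finite_covolume].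

(* The subfield of C generated by the traces of [holonomy_group]. *)
Definition trace_field (x : C) : Prop :=
  forall F : {pred C}, divring_closed F ->
    (forall B, holonomy_group B -> \tr B \in F) -> x \in F.

End Geometry.
End Triangulation.

(* Main.v *)
(* At [t = 1] the rows of the twisted matrix add up to zero, since the pair of
   opposite edges of every tetrahedron contributes [zeta + zeta' + zeta'' = 0]
   twice.  So the determinant vanishes at [1], and its derivative is the
   determinant in which the last row is replaced by the derivative [R] of the sum
   of the rows; [R_j] is the sum of [k(ab) zeta(ab)] over the edges [ab] of
   [Delta_j], where [t ^ k(ab)] is the monomial attached to [ab].  It remains to
   see that [C_lambda zeta = +- 2 R] modulo the rows of the untwisted matrix.

   The differences of [k] between consecutive corners of the triangles of the link
   form a cocycle [w], and the crossing numbers of [lambda] with the sides of the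
   link another one, [I].  By Euler's formula cocycles modulo coboundaries have
   dimension at most 2; pairing with [alpha] kills [w] and [I] but not the crossing
   numbers of [mu], and [w] is not a coboundary, so [I = c w + dh] with [c], [h]
   rational.  If [c m <> 1] for every integer [m], colouring the link by [h] modulo
   [c] shows that the simple curve [lambda] separates: [I] is the coboundary of an
   integral function, hence [lambda] is contractible because the fundamental group
   of the link is abelian.  If [c m = 1], then [alpha(mu) = 1] forces [m = +-1].

   For the trace field: completeness makes the conjugates of [mu] that fix the
   vertex [v] of a tetrahedron unipotent, say [1 + N_v], and
   [tr(N_1 N_3 N_0 N_2) / (tr(N_1 N_2) tr(N_3 N_0))] is the shape of the edge
   joining vertices 0 and 1. *)
Require Import Defs.
From HB Require Import structures.
From mathcomp Require Import all_boot all_order all_algebra.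
From mathcomp Require Import fingroup perm.
From mathcomp Require Import fraction complex.
From mathcomp Require Import all_classical all_reals all_analysis.
From mathcomp Require Import zify ring lra.
Set Implicit Arguments.
Unset Strict Implicit.
Unset Printing Implicit Defensive.
Import Order.TTheory GRing.Theory Num.Theory.
Local Open Scope ring_scope.
Import generic_quotient.

(** * The fundamental group of the torus is abelian *)

(** Why [w] and [I] must be proportional: the exponent [k] of an edge of a tetrahedron compares, in
    the cyclic cover, the sheet of the tetrahedron with the sheet of the edge. Hence [w] is, up to
    sign, the restriction of [alpha] to the torus as a cocycle on sides, while [acoch] is the same
    class on dual edges; their pairing is a cup square and vanishes. The cocycle [I] is Poincare
    dual to [lambda], and [lambda] lies in the kernel of [alpha]. The pairing cannot tell a
    primitive class from its multiples: the coefficient is where simplicity of [lambda] enters. The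
    factor 2 in front of [R] arises because an edge of a tetrahedron is seen from both its ends, at
    two corners with the same [k]; it cancels the 2 in the denominator of the 1-loop invariant. The
    obstacle is that non-triviality of [lambda] is about homotopy of words in the link, whereas
    colourings and cocycles only see homology. The bridge is commutativity of the fundamental group,
    extracted from the Euler characteristic alone by cutting the link open into a polygon and
    contracting its sides. *)

Section Polygon.
Variables (D V : finType) (Gam : groupType) (e : D -> D) (g : D -> Gam).
Hypotheses (eK : involutive e) (e_neq : forall d, e d != d).
Hypothesis gV : forall d, g (e d) = ((g d)^-1)%g.

Let act (a : Gam) (x : V * Gam) : V * Gam := (x.1, (a * x.2)%g).

Lemma cycle_drop_degenerate (X : eqType) (s t : D -> X) x p :
  s x = t x -> path.cycle [rel a b | t a == s b] (x :: p) ->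
  path.cycle [rel a b | t a == s b] p.
Proof.
move=> st; case: p => // y p /=.
rewrite rcons_path /= => /andP[/eqP xy /andP[yp /eqP lx]].
by rewrite rcons_path yp /= lx st xy eqxx.
Qed.

(* A closed polygon with sides glued in pairs by [e]; [s d] and [t d] are the ends
   of the side [d] in the universal cover, where vertices are written as a vertex of
   the surface and an element of [Gam], and [g d] is the deck transformation mapping
   [e d] to [d]. *)
Definition polygon (s t : D -> V * Gam) (P : seq D) : Prop :=
  [/\ uniq P, forall d, d \in P -> e d \in P,
      path.cycle [rel a b | t a == s b] P
    & forall d, d \in P -> s d = act (g d) (t (e d))].

Lemma polygon_end s t P d : polygon s t P -> d \in P -> t d = act (g d) (s (e d)).
Proof.
case=> _ Pe _ sP dP; rewrite (sP _ (Pe _ dP)) eK gV /act /= mulKVg.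
by case: (t d).
Qed.

(** The element [g d] translates [s (e d)] to [t d], and translations act freely. *)
Lemma polygon_adjacent s t P d : polygon s t P -> d \in P ->
  t d = s (e d) -> g d = 1%g.
Proof.
move=> pP dP; rewrite (polygon_end pP dP) => /(congr1 snd) /= h.
by apply: (mulIg (s (e d)).2); rewrite mul1g.
Qed.

Lemma polygon_rot i s t P : polygon s t P -> polygon s t (rot i P).
Proof.
case=> uP Pe cP sP; split; rewrite ?rot_uniq ?rot_cycle //.
- by move=> d; rewrite !mem_rot; exact: Pe.
- by move=> d; rewrite mem_rot; exact: sP.
Qed.

(** Sides come in pairs, so one or three are impossible, and two sides carry inverse elements. Of
    the three pairings of a quadrilateral, the two that pair adjacent sides make every [g] trivial;
    the one that pairs opposite sides is the torus, where the corners give the commutation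
    relation. *)
Lemma polygon_commute4 s t P : polygon s t P -> (size P <= 4)%N ->
  {in P &, forall x y, commute (g x) (g y)}.
Proof.
case: P => [|a [|b [|c [|d [|//]]]]] pP _ //.
- have [_ /(_ a) /=] := pP; rewrite !inE eqxx => /(_ isT) /eqP ea.
  by have := e_neq a; rewrite ea eqxx.
- have [_ /(_ a) Pe _ _] := pP; move: Pe; rewrite !inE eqxx => /(_ isT).
  rewrite (negPf (e_neq a)) /= => /eqP ea x y; rewrite !inE -ea.
  have cV : commute (g a) (g a)^-1 by apply: commuteV.
  case/orP => /eqP->; case/orP => /eqP->; rewrite ?gV.
  - exact: commute_refl.
  - exact: cV.
  - by apply: commute_sym.
  - exact: commute_refl.
- have [uP Pe _ _] := pP; move: uP; rewrite /= !inE !negb_or -!andbA andbT.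
  case/and3P => ab ac bc.
  have ea := Pe a; have eb := Pe b; have ec := Pe c; move: ea eb ec.
  rewrite !inE !eqxx !orbT (negPf (e_neq a)) (negPf (e_neq b)) (negPf (e_neq c)).
  move=> /(_ isT) /= /orP[] /eqP ea.
    move=> _ /(_ isT); rewrite orbF => /orP[] /eqP h.
      by have := eK c; rewrite h ea => E; rewrite E eqxx in bc.
    by have := eK c; rewrite h -ea eK => E; rewrite E eqxx in ac.
  move=> /(_ isT); rewrite /= => /orP[] /eqP h _.
    by have := eK b; rewrite h ea => E; rewrite E eqxx in bc.
  by have := eK b; rewrite h -ea eK => E; rewrite E eqxx in ab.
have [uP Pe cP sP] := pP; move: uP; rewrite /= !inE !negb_or -!andbA andbT.
case/and5P => ab ac ad bc /andP[bd cd].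
move: (cP) => /= /and5P[/eqP tab /eqP tbc /eqP tcd /eqP tda _].
have ia : a \in [:: a; b; c; d] by rewrite !inE eqxx.
have ib : b \in [:: a; b; c; d] by rewrite !inE eqxx ?orbT.
have ic : c \in [:: a; b; c; d] by rewrite !inE eqxx ?orbT.
have id : d \in [:: a; b; c; d] by rewrite !inE eqxx ?orbT.
have adj x : x \in [:: a; b; c; d] -> t x = s (e x) -> g x = 1%g /\ g (e x) = 1%g.
  by move=> xP h; have g1 := polygon_adjacent pP xP h; rewrite gV g1 invg1.
suff : [\/ forall x, x \in [:: a; b; c; d] -> g x = 1%g |
  [/\ g c = ((g a)^-1)%g, g d = ((g b)^-1)%g & commute (g a) (g b)]].
  case=> [h x y /h-> /h->|[gc gd cab] x y]; first exact: commute_refl.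
  have ZP h : commute h (g a) -> commute h (g b) ->
    forall z, z \in [:: a; b; c; d] -> commute h (g z).
    move=> ha hb z; rewrite !inE => /or4P[] /eqP-> //; first by rewrite gc; apply: commuteV.
    by rewrite gd; apply: commuteV.
  have cba := commute_sym cab.
  move=> xP yP; apply: (ZP _ _ _ _ yP); apply: commute_sym; apply: (ZP _ _ _ _ xP) => //;
    exact: commute_refl.
have := Pe a ia; rewrite !inE (negPf (e_neq a)) /= => /or3P[] /eqP ea.
- have [ga gb] : g a = 1%g /\ g b = 1%g by rewrite -ea; apply: adj; rewrite ?ea.
  have ec : e c = d.
    have := Pe c ic; rewrite !inE (negPf (e_neq c)) /= => /or3P[] /eqP // h.
      by have := eK c; rewrite h ea => E; rewrite E eqxx in bc.
    by have := eK c; rewrite h -ea eK => E; rewrite E eqxx in ac.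
  have [gc gd] : g c = 1%g /\ g d = 1%g by rewrite -ec; apply: adj; rewrite ?ec.
  by left=> x; rewrite !inE => /or4P[] /eqP->.
- have eb : e b = d.
    have := Pe b ib; rewrite !inE (negPf (e_neq b)) /= => /or3P[] /eqP // h.
      by have := eK b; rewrite h ea => E; rewrite E eqxx in bc.
    by have := eK b; rewrite h -ea eK => E; rewrite E eqxx in ab.
  right; split; [by rewrite -ea gV|by rewrite -eb gV|].
  (* All corners are lifts of one vertex; reaching [s b = t a] from [s d] in two ways gives
     [g a * g b] and [g b * g a]. *)
  have E1 : t a = act (g a) (s c) by rewrite (polygon_end pP ia) ea.
  have E2 : s b = act (g b) (t d) by rewrite (sP _ ib) eb.
  have E3 : s a = act (g a) (t c) by rewrite (sP _ ia) ea.
  have E4 : t b = act (g b) (s d) by rewrite (polygon_end pP ib) eb.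
  move: E1; rewrite tab E2 tda E3 tcd -tbc E4 /act => -[].
  by rewrite !mulgA => /mulIg h; exact: commute_sym.
- have [ga gd] : g a = 1%g /\ g d = 1%g.
    by have := adj d id; rewrite -ea eK => h; case: h => //; rewrite ea.
  have eb : e b = c.
    have := Pe b ib; rewrite !inE (negPf (e_neq b)) /= => /or3P[] /eqP // h.
      by have := eK b; rewrite h ea => E; rewrite E eqxx in bd.
    by have := eK b; rewrite h -ea eK => E; rewrite E eqxx in ab.
  have [gb gc] : g b = 1%g /\ g c = 1%g by rewrite -eb; apply: adj; rewrite ?eb.
  by left=> x; rewrite !inE => /or4P[] /eqP->.
Qed.

(* Going around the vertex [v], the product of the [g x] met on the way is trivial, so
   that a single one of them is controlled by the others. *)
Lemma centralizer_around_vertex s t P v x0 (Z : Gam -> Prop) :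
  polygon s t P -> x0 \in P -> (s x0).1 = v -> Z 1%g ->
  (forall a b, Z a -> Z b -> Z (a * b)%g) ->
  (forall x, x \in P -> x != x0 -> (s x).1 = v -> Z (g x)) -> Z ((g x0)^-1)%g.
Proof.
move=> [uP Pe cP sP] x0P lx0 Z1 ZM Zg.
(* Crossing the side [x] and taking the next side of the polygon turns around the initial vertex of
   [x]. *)
pose f x := next P (e x).
have f_inj : injective f.
  by move=> x y /(can_inj (prev_next uP)) /(can_inj eK).
have fP x : x \in P -> f x \in P by move=> xP; rewrite mem_next Pe.
have sf x : x \in P -> s x = act (g x) (s (f x)).
  by move=> xP; rewrite (sP _ xP) (eqP (next_cycle cP (Pe _ xP))).
have exn : exists n, (0 < n)%N && (iter n f x0 == x0).
  by exists (fingraph.order f x0); rewrite fingraph.order_gt0 iter_order ?eqxx.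
(* First return to [x0]: the factors met in between come from sides other than [x0]. *)
case: (ex_minnP exn) => n /andP[n0 /eqP nx0] nmin.
have itP i : iter i f x0 \in P by elim: i => //= i; exact: fP.
have itl i : (s (iter i f x0)).1 = v.
  by elim: i => //= i; rewrite (sf _ (itP i)).
have step i : (0 < i <= n)%N -> Z ((s (f x0)).2 * ((s (iter i f x0)).2)^-1)%g.
  elim: i => // i IH /andP[_ lin]; case: (posnP i) => [->|i0].
    by rewrite /= mulgV.
  have := IH; rewrite i0 (ltnW lin) => /(_ isT) IHi.
  have ne : iter i f x0 != x0.
    apply/negP => h; have := nmin i; rewrite i0 h => /(_ isT).
    by rewrite leqNgt lin.
  have := Zg _ (itP i) ne (itl i) => /(ZM _ _ IHi).
  by rewrite (sf _ (itP i)) /= invgM -!mulgA mulVg mulg1.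
have := step n; rewrite n0 leqnn nx0 => /(_ isT).
by rewrite (sf _ x0P) /= invgM mulKVg.
Qed.

(* By induction on the number of sides: as long as there are more than four, some side
   joins distinct vertices and can be contracted. *)
Lemma polygon_commute s t (P : seq D) (L : {set V}) :
  polygon s t P -> (size P <= 2 * #|L| + 2)%N ->
  (P = [::] \/ forall l, l \in L -> exists2 x, x \in P & (s x).1 = l) ->
  {in P &, forall x y, commute (g x) (g y)}.
Proof.
have [m] := ubnP (size P); elim: m => // m IHm in s t P L *.
rewrite ltnS => leP pP szP LP.
have [le4|gt4] := leqP (size P) 4; first exact: polygon_commute4 pP le4.
have L2 : (1 < #|L|)%N by lia.
case: LP => [P0|LP]; first by rewrite P0 in gt4.
have [uP Pe cP sP] := pP.
(* Otherwise all sides of the cycle would start at the same vertex of the surface, but [L] has at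
   least two. *)
have [d dP nd] : exists2 d, d \in P & (s d).1 != (t d).1.
  apply/hasP; apply: contraT => /hasPn all_eq.
  case/card_gt1P: L2 => l1 [l2 [/LP [x1 x1P <-] /LP [x2 x2P <-]]] /negP[].
  have nx x : x \in P -> (s x).1 = (s (next P x)).1.
    move=> xP; have := all_eq _ xP; rewrite negbK => /eqP ->.
    by rewrite (eqP (next_cycle cP xP)).
  have it i : (s (iter i (next P) x1)).1 = (s x1).1 /\ iter i (next P) x1 \in P.
    elim: i => // i [IH1 IH2] /=; split; last by rewrite mem_next.
    by rewrite -nx.
  have : fconnect (next P) x1 x2.
    by rewrite (fconnect_cycle (cycle_next uP) x1P).
  by move=> /iter_findex <-; rewrite (it _).1.
case: (rot_to dP) => i p defP.
have edp : e d \in p.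
  have := Pe d dP; rewrite -(mem_rot i) defP inE (negPf (e_neq d)) //.
have {}pP : polygon s t (d :: p) by rewrite -defP; exact: polygon_rot.
suff : {in d :: p &, forall x y, commute (g x) (g y)}.
  by move=> h x y xP yP; apply: h; rewrite -defP mem_rot.
have {}LP l : l \in L -> exists2 x, x \in d :: p & (s x).1 = l.
  by case/LP => x xP; exists x; rewrite // -defP mem_rot.
have szE : size P = (size p).+1 by rewrite -(size_rot i) defP.
rewrite szE in leP szP gt4; move: pP leP szP gt4 LP; clear uP Pe cP sP dP defP szE P.
case/splitPr: edp => p1 p2; rewrite size_cat /= addnS => pP leP szP gt4 LP.
have := pP; case.
set P := d :: _ => uP Pe cP sP.
have dP : d \in P by rewrite mem_head.
have edP := Pe _ dP.
have memP x : (x \in P) = [|| x == d, x == e d | x \in p1 ++ p2].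
  by rewrite /P !(inE, mem_cat); do !case: (_ \in _); do !case: (_ == _).
have [dN edN uP'] : [/\ d \notin p1 ++ p2, e d \notin p1 ++ p2 & uniq (p1 ++ p2)].
  move: uP; rewrite /P /= !mem_cat inE !negb_or !cat_uniq /= negb_or.
  by case/andP => /and3P[-> _ ->] /and3P[-> /andP[-> ->] /andP[-> ->]].
set u := (s d).1 in nd; set v := (t d).1 in nd.
(* The contraction must be equivariant: each lift of [v] slides back along the lift of [d] that ends
   there. *)
pose mv (x : V * Gam) := if x.1 == v then (u, x.2 * (t d).2^-1 * (s d).2)%g else x.
have mvE a x : mv (act a x) = act a (mv x).
  by rewrite /mv /act /=; case: eqP => //=; rewrite !mulgA.
have mv_d : mv (s d) = mv (t d).
  by rewrite /mv -/u -/v eqxx (negPf nd) mulgV mul1g /u; case: (s d).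
have mv_ed : mv (s (e d)) = mv (t (e d)).
  have E1 := sP _ dP; have E2 := polygon_end pP dP.
  have := mv_d; rewrite E1 E2 !mvE /act => -[h1] /mulgI h2.
  by rewrite (surjective_pairing (mv (s (e d)))) (surjective_pairing (mv (t (e d)))) h1 h2.
have pP' : polygon (mv \o s) (mv \o t) (p1 ++ p2).
  split=> // [x xP'||x xP'].
  - have xP : x \in P by rewrite memP xP' !orbT.
    have := Pe _ xP; rewrite memP => /or3P[/eqP h|/eqP /(can_inj eK) h|//].
      by rewrite -h eK xP' in edN.
    by rewrite -h xP' in dN.
  - have c0 : path.cycle [rel a b | (mv \o t) a == (mv \o s) b] P.
      by apply: sub_cycle cP => a b /eqP /= ->.
    have c1 := cycle_drop_degenerate (s := mv \o s) (t := mv \o t) mv_d c0.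
    rewrite -(rot_cycle (size p1)) rot_size_cat /= in c1.
    have := cycle_drop_degenerate (s := mv \o s) (t := mv \o t) mv_ed c1.
    by rewrite -(rot_cycle (size p2)) rot_size_cat.
  - by rewrite /= sP ?mvE // memP xP' !orbT.
have IH : {in p1 ++ p2 &, forall x y, commute (g x) (g y)}.
  apply: (IHm _ _ _ (L :\ v)%SET) pP' _ _.
  - by rewrite size_cat; lia.
  - have := cardsD1 v L; rewrite size_cat; move: szP; case: (v \in L) => /=; lia.
  case P'0 : (p1 ++ p2) => [|y0 p0]; [by left|right]; rewrite -P'0.
  move=> l; rewrite !inE => /andP[lv /LP [x]]; rewrite -/P memP => /or3P[] /eqP.
  - move=> -> /esym lu.
    have [y yp sy] : exists2 y, y \in p1 ++ p2 & mv (s y) = mv (s d).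
      move: cP P'0; rewrite /P; case: (p1) (p2) => [|y q1] q2 /=.
        case: q2 => //= z q2 /and3P[/eqP h1 /eqP h2 _] _.
        by exists z; rewrite ?mem_head // -h2 -mv_ed -h1 mv_d.
      by case/andP => /eqP h _ _; exists y; rewrite ?mem_head // -h mv_d.
    exists y => //=; rewrite sy /mv -/u (negPf nd) //.
  - move=> -> sv; move: lv; rewrite -sv /v (polygon_end pP dP) /= eqxx //.
  - move/eqP=> xp sx; exists x => //=; rewrite /mv sx (negPf lv) //.
(* Since [d] starts at [u], the only contracted side starting at [v] is [e d], and going around [v]
   controls it by the sides already known to commute. *)
have Zd y : y \in p1 ++ p2 -> commute (g d) (g y).
  move=> yP'; have -> : g d = ((g (e d))^-1)%g by rewrite gV invgK.
  apply: (@centralizer_around_vertex s t P v (e d) (fun a => commute a (g y))) => //.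
  - by rewrite /v (polygon_end pP dP).
  - exact/commute_sym/commute1.
  - by move=> a b /commute_sym ca /commute_sym cb; exact/commute_sym/commuteM.
  - move=> x; rewrite memP => /or3P[/eqP-> _|/eqP->|xP' _ _]; last exact: IH.
      by move=> sd; rewrite /u sd eqxx in nd.
    by rewrite eqxx.
have Zed y : y \in p1 ++ p2 -> commute (g (e d)) (g y).
  by move=> yP'; rewrite gV; exact/commute_sym/commuteV/commute_sym/Zd.
have Zdd : commute (g d) (g (e d)) by rewrite gV; exact/commuteV/commute_refl.
move=> x y; rewrite !memP => /or3P[/eqP->|/eqP->|xP] /or3P[/eqP->|/eqP->|yP];
  by [apply: commute_refl|exact: Zdd|exact/commute_sym/Zdd|exact: Zd|exact: Zed
     |exact/commute_sym/Zd|exact/commute_sym/Zed|exact: IH].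
Qed.
End Polygon.

(** * Unfolding a triangulated surface into a polygon *)

Section Surface.
Variables (D Tr V : finType) (Gam : groupType).
Variables (e nxt : D -> D) (src : D -> Tr) (l : D -> V) (g kap : D -> Gam).
Hypotheses (eK : involutive e) (e_neq : forall d, e d != d).
Hypothesis gV : forall d, g (e d) = ((g d)^-1)%g.
Hypotheses (nxt3 : forall d, nxt (nxt (nxt d)) = d) (nxt_neq : forall d, nxt d != d).
Hypothesis src_nxt : forall d, src (nxt d) = src d.
Hypothesis src_fiber : forall d d', src d' = src d ->
  [\/ d' = d, d' = nxt d | d' = nxt (nxt d)].
Hypothesis src_surj : forall x, exists d, src d = x.
Hypothesis l_turn : forall d, l (nxt (e d)) = l d.
Hypothesis kap_turn : forall d, kap d = (g d * kap (nxt (e d)))%g.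
Hypothesis conn : forall B : {set Tr}, B != finset.set0 ->
  (forall d, src d \in B -> src (e d) \in B) -> B = [set: Tr]%SET.
Hypothesis euler : (#|Tr| <= 2 * #|[set l d | d : D]|)%N.

(** A function [u] selects one lift of each triangle in the universal cover; [gu], [su] and [tu] are
    the gluing elements and the ends of the sides for these lifts. *)
Let gu (u : Tr -> Gam) d := (u (src d) * g d * (u (src (e d)))^-1)%g.
Let su (u : Tr -> Gam) d := (l d, (u (src d) * kap d)%g).
Let tu u d := su u (nxt d).

Lemma gauge_inv u d : gu u (e d) = ((gu u d)^-1)%g.
Proof. by rewrite /gu eK gV !invgM invgK mulgA. Qed.

Lemma gauge_glue u d : su u d = ((tu u (e d)).1, (gu u d * (tu u (e d)).2)%g).
Proof.
rewrite /su /tu /su /gu /= l_turn src_nxt; congr pair.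
by rewrite kap_turn !mulgA mulgKV.
Qed.

(** The lifts of the triangles of [Vis] form a disc with boundary [P]. A triangle added to it
    replaces one side by two, whence the size; the sides outside [P] are those along which triangles
    have been attached, and the lifts there match exactly. *)
Definition partial_polygon (Vis : {set Tr}) (u : Tr -> Gam) (P : seq D) : Prop :=
  [/\ uniq P /\ size P = (#|Vis| + 2)%N,
      forall d, d \in P -> src d \in Vis,
      path.cycle [rel a b | tu u a == su u b] P,
      forall d, src d \in Vis -> d \notin P ->
        [/\ src (e d) \in Vis, gu u d = 1%g & e d \notin P]
    & forall d, src d \in Vis -> exists2 x, x \in P & l x = l d].

Lemma nxt2_neq d : nxt (nxt d) != d.
Proof.
by apply/eqP => h; have := nxt_neq d; rewrite -{2}(nxt3 d) h eqxx.
Qed.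

Lemma partial_polygon1 d : partial_polygon [set src d] (fun=> 1%g)
  [:: d; nxt d; nxt (nxt d)].
Proof.
split.
- rewrite cards1 /= !inE !negb_or (eq_sym d) nxt_neq (eq_sym d) nxt2_neq.
  by rewrite eq_sym nxt_neq.
- by move=> x; rewrite !inE => /or3P[] /eqP->; rewrite ?src_nxt.
- by rewrite /= /tu nxt3 !eqxx.
- by move=> x /set1P /src_fiber[]->; rewrite !inE eqxx ?orbT.
- by move=> x /set1P /src_fiber[]->; [exists d|exists (nxt d)|exists (nxt (nxt d))];
    rewrite // !inE eqxx ?orbT.
Qed.

Lemma partial_polygon_step Vis u P : partial_polygon Vis u P ->
  Vis != finset.set0 -> Vis != [set: Tr]%SET ->
  exists x, exists u', exists P', x \notin Vis /\ partial_polygon (x |: Vis) u' P'.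
Proof.
move=> ppP V0 VT.
have [d0 d0V ed0] : exists2 d0, src d0 \in Vis & src (e d0) \notin Vis.
  have : [exists d0, (src d0 \in Vis) && (src (e d0) \notin Vis)].
    apply: contraT => /existsPn h; case/negP: VT; apply/eqP/conn => // d dV.
    by have := h d; rewrite dV negbK.
  by case/existsP => d0 /andP[]; exists d0.
have d0P : d0 \in P.
  by apply: contraT => h; case: ppP => _ _ _ /(_ _ d0V h)[]; rewrite (negPf ed0).
have {ppP} [p pp] : exists p, partial_polygon Vis u (d0 :: p).
  case: (rot_to d0P) => i p E; exists p; rewrite -E.
  case: ppP => -[uP sP] srcP cP h1 h2; split; rewrite ?rot_uniq ?size_rot ?rot_cycle //.
  - by move=> d; rewrite mem_rot; exact: srcP.
  - by move=> d; rewrite !mem_rot; exact: h1.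
  - by move=> d /h2 [x xP lx]; exists x; rewrite ?mem_rot.
case: pp => -[/= /andP[d0p up] [sp]] srcP cP h1 h2 {P d0P}.
set d1 := e d0 in ed0 *; set x1 := src d1.
(* The lift of the new triangle is the one for which the gluing element across [d0] becomes
   trivial. *)
pose u' x := if x == x1 then (u (src d0) * g d0)%g else u x.
have u'V x : x \in Vis -> u' x = u x.
  by rewrite /u'; case: eqP => // -> h; rewrite h in ed0.
have u'1 : u' x1 = (u (src d0) * g d0)%g by rewrite /u' eqxx.
have srcp d : d \in p -> src d \in Vis by move=> dp; apply: srcP; rewrite inE dp orbT.
have suV d : src d \in Vis -> su u' d = su u d by rewrite /su => /u'V ->.
have tuV d : src d \in Vis -> tu u' d = tu u d by move=> dV; rewrite /tu suV ?src_nxt.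
have guV d : src d \in Vis -> src (e d) \in Vis -> gu u' d = gu u d.
  by move=> dV edV; rewrite /gu !u'V.
have gd0 : gu u' d0 = 1%g by rewrite /gu u'V // -/d1 -/x1 u'1 mulgV.
have gd1 : gu u' d1 = 1%g by rewrite gauge_inv gd0 invg1.
have sd1 : su u' d1 = tu u' d0.
  by rewrite gauge_glue gd1 mul1g /d1 eK; case: (tu u' d0).
have sd0 : su u' d0 = su u' (nxt d1).
  by rewrite gauge_glue gd0 mul1g -/d1 -/(tu u' d1); case: (tu u' d1).
have notV d : src d = x1 -> d \notin d0 :: p.
  by move=> sd; apply/negP => /srcP; rewrite sd (negPf ed0).
have s1 : src (nxt d1) = x1 by rewrite src_nxt.
have s2 : src (nxt (nxt d1)) = x1 by rewrite !src_nxt.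
have := notV _ s1; have := notV _ s2; rewrite !inE !negb_or => /andP[n20 n2p] /andP[n10 n1p].
have h2' d : src d \in Vis -> exists2 x, x \in [:: nxt d1, nxt (nxt d1) & p] & l x = l d.
  case/h2=> x; rewrite inE => /orP[/eqP->|xp] lx.
    by exists (nxt d1); rewrite ?mem_head // l_turn.
  by exists x; rewrite // !inE xp !orbT.
exists x1, u', [:: nxt d1, nxt (nxt d1) & p]; split => //; split.
- rewrite /= !inE negb_or n1p n2p up eq_sym nxt_neq; split => //.
  by rewrite cardsU1 ed0 add1n /= sp addSn.
- move=> d; rewrite !inE => /or3P[/eqP->|/eqP->|/srcp ->]; rewrite ?orbT //.
    by rewrite s1 eqxx.
  by rewrite s2 eqxx.
- rewrite /= eqxx /=.
  have c0 : path [rel a b | tu u' a == su u' b] d0 (rcons p d0).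
    have aV : all [pred d | src d \in Vis] (d0 :: p) by apply/allP.
    apply: (sub_in_cycle _ aV cP) => a b aV' bV' /=.
    by rewrite tuV ?suV.
  have t2 : tu u' (nxt (nxt d1)) = tu u' d0 by rewrite /tu nxt3 sd1.
  by move: c0; case: (p) => [|y q] /=; rewrite ?rcons_path /= t2 sd0.
- move=> d; rewrite in_setU1 => /orP[/eqP/src_fiber|dV].
    case=> ->; rewrite !inE ?eqxx ?orbT //.
    move=> _; rewrite /d1 eK -/d1 gd1 d0V orbT; split => //.
    by rewrite !negb_or (eq_sym d0) n10 (eq_sym d0) n20.
  rewrite !inE !negb_or => /and3P[_ _ dp].
  have [->|dd0] := eqVneq d d0.
    rewrite -/d1 eqxx gd0; split => //; rewrite eq_sym nxt_neq eq_sym nxt2_neq /=.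
    by have := notV _ (erefl x1); rewrite inE negb_or => /andP[].
  have [] := h1 d dV; first by rewrite inE negb_or dd0 dp.
  rewrite inE negb_or => edV gud /andP[ed0' edp]; rewrite edV orbT guV //; split => //.
  rewrite edp andbT; apply/andP; split; apply/eqP => E.
    by move: edV; rewrite E s1 (negPf ed0).
  by move: edV; rewrite E s2 (negPf ed0).
- move=> d; rewrite in_setU1 => /orP[/eqP/src_fiber|]; last exact: h2'.
  case=> ->; [|by exists (nxt d1); rewrite ?mem_head|].
    have [|x xP lx] := h2' (nxt d0); first by rewrite src_nxt.
    by exists x; rewrite // lx -[in RHS]l_turn /d1 eK.
  by exists (nxt (nxt d1)); rewrite // !inE eqxx orbT.
Qed.

(** Once all triangles are visited the polygon has [#|Tr| + 2] sides, and [euler] is exactly the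
    bound required by [polygon_commute]. The sides not on the boundary carry the trivial element. *)
Theorem genus_one_commute : exists u : Tr -> Gam, forall d d',
  commute (u (src d) * g d * (u (src (e d)))^-1)%g
          (u (src d') * g d' * (u (src (e d')))^-1)%g.
Proof.
have [x0 _|T0] := pickP (@predT Tr); last first.
  by exists (fun=> 1%g) => d; have := T0 (src d).
case: (src_surj x0) => d00 _.
have [Vis [u [P pp]] VisT] : exists2 Vis, exists u P, partial_polygon Vis u P &
    Vis = [set: Tr]%SET.
  have : forall k, (k < #|Tr|)%N -> exists2 Vis, exists u P, partial_polygon Vis u P &
    #|Vis| = k.+1.
    elim=> [_|k IH kT].
      exists [set src d00]; last by rewrite cards1.
      by exists (fun=> 1%g), [:: d00; nxt d00; nxt (nxt d00)]; exact: partial_polygon1.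
    have [Vis [u [P pp]] cV] := IH (ltnW kT).
    have V0 : Vis != finset.set0 by rewrite -card_gt0 cV.
    have VT : Vis != [set: Tr]%SET.
      by apply/eqP => E; move: kT; rewrite -cV E cardsT ltnn.
    case: (partial_polygon_step pp V0 VT) => x [u' [P' [xV pp']]].
    by exists (x |: Vis); [exists u', P'|rewrite cardsU1 xV cV].
  move/(_ #|Tr|.-1); rewrite ltn_predL; have T0 : (0 < #|Tr|)%N by apply/card_gt0P; exists x0.
  move=> /(_ T0) [Vis h cV]; exists Vis => //; apply/eqP.
  by rewrite eqEcard finset.subsetT cardsT cV prednK ?leqnn.
case: pp => -[uP sP] srcP cP h1 h2; rewrite VisT in sP srcP h1 h2.
exists u.
have PP : polygon e (gu u) (su u) (tu u) P.
  split=> // [d dP|d dP]; last exact: gauge_glue.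
  apply: contraT => h; have [_ _] := h1 (e d) (finset.in_setT _) h.
  by rewrite eK dP.
have cm : {in P &, forall x y, commute (gu u x) (gu u y)}.
  apply: (polygon_commute eK e_neq (gauge_inv u) (L := [set l d | d : D]) PP).
    by rewrite sP cardsT leq_add2r.
  by right=> _ /imsetP[d _ ->]; case: (h2 d (finset.in_setT _)) => x xP lx; exists x.
move=> d d'.
have [dP|/(h1 _ (finset.in_setT _))[_ g1 _]] := boolP (d \in P); last first.
  by rewrite -/(gu u d) g1; exact/commute_sym/commute1.
have [d'P|/(h1 _ (finset.in_setT _))[_ g1 _]] := boolP (d' \in P); last first.
  by rewrite -/(gu u d') g1; exact/commute1.
exact: cm.
Qed.
End Surface.

(** * Cocycles of the link *)

Section Cohomology.
Variables (D Tr V : finType).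
Variables (e nxt : D -> D) (src : D -> Tr) (l : D -> V).
Hypotheses (eK : involutive e) (e_neq : forall d, e d != d).
Hypothesis nxt_inj : injective nxt.
Hypothesis src_nxt : forall d, src (nxt d) = src d.
Hypothesis src_fiber : forall d d', src d' = src d ->
  [\/ d' = d, d' = nxt d | d' = nxt (nxt d)].
Hypothesis l_turn : forall d, l (nxt (e d)) = l d.
Hypothesis l_surj : forall v, exists d, l d = v.
Hypothesis conn : forall B : {set Tr}, B != finset.set0 ->
  (forall d, src d \in B -> src (e d) \in B) -> B = [set: Tr]%SET.
Hypothesis euler : (#|D| <= 2 * (#|Tr| + #|V|))%N.

Definition cocycle (x : D -> rat) : Prop :=
  (forall d, x (e d) = - x d) /\ (forall y, \sum_(d | src d == y) x d = 0).

Definition coboundary (x : D -> rat) : Prop :=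
  exists h : V -> rat, forall d, x d = h (l d) - h (l (nxt d)).

Local Notation ED := {ffun D -> rat^o}.
Local Notation ETr := {ffun Tr -> rat^o}.
Local Notation EV := {ffun V -> rat^o}.

Let symf (x : ED) : ED := [ffun d => x d + x (e d)].
Let sgnf (x : ED) : ED := [ffun d => (-1) ^+ (enum_rank d < enum_rank (e d))%N * x d].
Let sumf (x : ED) : ETr := [ffun y => \sum_(d | src d == y) x d].
Let difff (h : EV) : ED := [ffun d => h (l d) - h (l (nxt d))].

Let symf_linear : linear symf.
Proof. by move=> a x y; apply/ffunP => d; rewrite !ffunE scalerDr addrACA. Qed.
Let sgnf_linear : linear sgnf.
Proof. by move=> a x y; apply/ffunP => d; rewrite !ffunE mulrDr -scalerAr. Qed.
Let sumf_linear : linear sumf.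
Proof.
move=> a x y; apply/ffunP => t; rewrite !ffunE scaler_sumr -big_split /=.
by apply: eq_bigr => d _; rewrite !ffunE.
Qed.
Let difff_linear : linear difff.
Proof.
by move=> a x y; apply/ffunP => d; rewrite !ffunE scalerBr opprD addrACA.
Qed.

HB.instance Definition _ := GRing.isLinear.Build rat ED ED _ symf symf_linear.
HB.instance Definition _ := GRing.isLinear.Build rat ED ED _ sgnf sgnf_linear.
HB.instance Definition _ := GRing.isLinear.Build rat ED ETr _ sumf sumf_linear.
HB.instance Definition _ := GRing.isLinear.Build rat EV ED _ difff difff_linear.

Let A := lker (linfun symf).
Let Z := (A :&: lker (linfun sumf))%VS.
Let B := limg (linfun difff).

Let memA (x : ED) : (x \in A) = [forall d, x (e d) == - x d].
Proof.
rewrite memv_ker lfunE /=; apply/eqP/fintype.forallP => [/ffunP h d|h].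
  by have := h d; rewrite !ffunE => /eqP; rewrite addrC addr_eq0.
by apply/ffunP => d; rewrite !ffunE (eqP (h d)) subrr.
Qed.

(** A sign telling [d] from [e d] carries antisymmetric functions injectively to symmetric ones, and
    a function of both kinds is zero: two independent copies of [A] fit in the whole space. *)
Let dimA : (2 * \dim A <= #|D|)%N.
Proof.
have capK : (A :&: lker (linfun sgnf) = 0)%VS.
  apply/eqP; rewrite -subv0; apply/subvP => x; rewrite memv_cap memv_ker lfunE /=.
  case/andP => _ /eqP/ffunP h; rewrite memv0; apply/eqP/ffunP => d.
  have := h d; rewrite !ffunE => /eqP; rewrite mulf_eq0 expf_eq0 oppr_eq0 oner_eq0 andbF /=.
  by move/eqP.
have capS : (A :&: (linfun sgnf @: A) = 0)%VS.
  apply/eqP; rewrite -subv0; apply/subvP => x; rewrite memv_cap => /andP[xA].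
  case/memv_imgP => y yA xy; rewrite memv0; apply/eqP/ffunP => d.
  move: xA yA; rewrite !memA => /fintype.forallP /(_ d) /eqP + /fintype.forallP /(_ d) /eqP.
  have rE : (enum_rank (e d) < enum_rank d)%N = ~~ (enum_rank d < enum_rank (e d))%N.
    rewrite -leqNgt [RHS]leq_eqVlt; case: eqP => // E0; have E := enum_rank_inj (val_inj E0).
    by have := e_neq d; rewrite E eqxx.
  rewrite xy lfunE /= !ffunE eK rE => + yd; rewrite yd signrN; lra.
rewrite mul2n -addnn -{2}(limg_ker_dim (linfun sgnf) A) capK dimv0 add0n.
rewrite -(dimv_disjoint_sum capS).
have := dimvS (subvf (A + linfun sgnf @: A)%VS); rewrite dimvf.
by have -> : dim ED = #|D| by rewrite -[RHS]muln1.
Qed.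

Let delta (y : Tr) : ETr := [ffun t => (t == y)%:R].

(** The antisymmetric function supported on [d] and [e d] has as sums the difference of the
    indicators of two adjacent triangles. By connectedness a single further indicator generates
    everything. *)
Let dim_sums : (#|Tr| <= (\dim (linfun sumf @: A)).+1)%N.
Proof.
have [y0 _|T0] := pickP (@predT Tr); last first.
  by rewrite leqW // eq_card0.
set W := (linfun sumf @: A + <[delta y0]>)%VS.
have deltaW y : delta y \in W.
  suff E : [set y | delta y \in W]%SET = [set: Tr]%SET.
    by have := finset.in_setT y; rewrite -E inE.
  apply: conn => [|d].
    by apply/finset.set0Pn; exists y0; rewrite inE memvE addvSr.
  rewrite !inE => dW; pose x : ED := [ffun d' => (d' == d)%:R - (d' == e d)%:R].
  have xA : x \in A.
    rewrite memA; apply/fintype.forallP => d'; rewrite !ffunE opprB.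
    by rewrite (inj_eq (can_inj eK)) -(inj_eq (can_inj eK)) eK.
  have -> : delta (src (e d)) = delta (src d) - linfun sumf x.
    apply/ffunP => t; rewrite lfunE /= !ffunE.
    under eq_bigr do rewrite ffunE.
    rewrite big_split /= sumrN.
    have S d0 : \sum_(i | src i == t) (i == d0)%:R = (t == src d0)%:R :> rat.
      case: (eqVneq t (src d0)) => [->|ne].
        by rewrite (bigD1 d0) //= eqxx big1 ?addr0 // => i /andP[_ /negPf->].
      by rewrite big1 // => i /eqP it; case: eqP => // E; rewrite -it E eqxx in ne.
    by rewrite !S opprB addrC subrK.
  by apply: memvB => //; apply: (subvP (addvSl _ _)); apply: memv_img.
have : (fullv <= W)%VS.
  apply/subvP => y _; have -> : y = \sum_t y t *: delta t.
    apply/ffunP => t; rewrite sum_ffunE (bigD1 t) //= !ffunE eqxx.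
    rewrite big1 ?addr0 ?[_ *: _]mulr1 // => i it; rewrite !ffunE eq_sym (negPf it).
    exact: mulr0.
  by apply: memv_suml => t _; apply: memvZ.
move/dimvS; rewrite dimvf; have -> : dim ETr = #|Tr| by rewrite -[RHS]muln1.
move=> h; apply: (leq_trans h); apply: (leq_trans (dimv_add_leqif _ _).1).
by rewrite -addn1 leq_add2l dim_vline leq_b1.
Qed.

(** The kernel of the coboundary consists of constants: such a function is constant on each
    triangle, and adjacent triangles share vertices. *)
Let dim_coboundaries : (#|V| <= (\dim B).+1)%N.
Proof.
have := limg_ker_dim (linfun difff) fullv; rewrite -/B capfv.
rewrite dimvf; have -> : dim EV = #|V| by rewrite -[RHS]muln1.
move=> <-; rewrite -addn1 addnC leq_add2l.
suff kerS : (lker (linfun difff) <= <[[ffun=> 1] : EV]>)%VS.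
  by apply: (leq_trans (dimvS kerS)); rewrite dim_vline leq_b1.
apply/subvP => h; rewrite memv_ker lfunE /= => /eqP/ffunP hd.
have [v0 _|V0] := pickP (@predT V); last first.
  by rewrite (_ : h = 0) ?mem0v //; apply/ffunP => v; have := V0 v.
apply/vlineP; exists (h v0); apply/ffunP => v; rewrite !ffunE [RHS]mulr1.
have hn d : h (l (nxt d)) = h (l d).
  by have := hd d; rewrite !ffunE => /eqP; rewrite subr_eq0 => /eqP.
have hs d d' : src d' = src d -> h (l d') = h (l d).
  by case/src_fiber => ->; rewrite ?hn.
have [d0 ld0] := l_surj v0; have [d ld] := l_surj v.
suff E : [set y | [forall d, (src d == y) ==> (h (l d) == h v0)]]%SET = [set: Tr]%SET.
  have := finset.in_setT (src d); rewrite -E inE => /fintype.forallP /(_ d).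
  by rewrite eqxx /= ld => /eqP.
apply: conn => [|d1].
  apply/finset.set0Pn; exists (src d0); rewrite inE; apply/fintype.forallP => d1.
  by apply/implyP => /eqP /hs ->; rewrite ld0.
rewrite !inE => /fintype.forallP /(_ d1); rewrite eqxx /= => /eqP h1.
apply/fintype.forallP => d2; apply/implyP => /eqP /hs ->.
by rewrite -hn l_turn h1.
Qed.

Let memZ (x : ED) : cocycle x <-> x \in Z.
Proof.
rewrite memv_cap memA memv_ker lfunE /=; split=> [[h1 h2]|].
  apply/andP; split; first by apply/fintype.forallP => d; rewrite h1.
  by apply/eqP/ffunP => y; rewrite !ffunE h2.
case/andP => /fintype.forallP h1 /eqP/ffunP h2; split=> [d|y]; first exact/eqP.
by have := h2 y; rewrite !ffunE.
Qed.

Lemma coboundary_cocycle x : coboundary x -> cocycle x.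
Proof.
case=> h hx; split=> [d|y].
  by rewrite !hx l_turn opprB -(l_turn (e d)) eK.
under eq_bigr do rewrite hx.
rewrite big_split /= sumrN; apply/eqP; rewrite subr_eq0; apply/eqP.
rewrite (reindex_inj nxt_inj) /=; apply: eq_bigl => d; by rewrite src_nxt.
Qed.

Let memB (x : ED) : coboundary x <-> x \in B.
Proof.
split=> [[h hx]|/memv_imgP[h _ ->]].
  apply/memv_imgP; exists [ffun v => h v]; rewrite ?memvf // lfunE /=.
  by apply/ffunP => d; rewrite !ffunE hx.
by exists h => d; rewrite lfunE /= ffunE.
Qed.

Let dimv_add_line (U : {vspace ED}) w : w \notin U -> (\dim U < \dim (U + <[w]>))%N.
Proof.
move=> wU; rewrite (ltn_leqif (dimv_leqif_sup (addvSl _ _))).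
by apply: contra wU => /subvP; apply; rewrite memvE addvSr.
Qed.

(** The three bounds give dim Z <= |D|/2 - |Tr| + 1 <= |V| + 1 and dim B >= |V| - 1, so adding [w1]
    and [w2] to the coboundaries exhausts the cocycles; [P] detects the coefficient of [w2]. *)
Theorem cohomology_rank2 (w1 w2 x : D -> rat) (P : (D -> rat) -> rat) :
  (forall c y y', P (fun d => c * y d + y' d) = c * P y + P y') ->
  (forall y y', y =1 y' -> P y = P y') ->
  (forall y, coboundary y -> P y = 0) ->
  cocycle w1 -> P w1 = 0 -> ~ coboundary w1 ->
  cocycle w2 -> P w2 != 0 -> cocycle x -> P x = 0 ->
  exists c, exists h : V -> rat, forall d, x d = c * w1 d + (h (l d) - h (l (nxt d))).
Proof.
move=> Plin Pext PB Zw1 Pw1 NBw1 Zw2 Pw2 Zx Px.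
pose fw1 : ED := [ffun d => w1 d]; pose fw2 : ED := [ffun d => w2 d].
pose fx : ED := [ffun d => x d].
have coc_ext y : cocycle y -> cocycle ([ffun d => y d] : ED).
  move=> [h1 h2]; split=> [d|t]; first by rewrite !ffunE h1.
  by under eq_bigr do rewrite ffunE.
have PZ (y : ED) c : y \in (B + <[c]>)%VS -> exists2 k, exists2 h : V -> rat,
    forall d, y d = k * c d + (h (l d) - h (l (nxt d))) & True & P y = k * P c.
  case/memv_addP => b bB [_ /vlineP[k ->] ->]; exists k.
    case/memB: bB => h hb; exists h => // d; rewrite !ffunE hb.
    by rewrite addrC.
  rewrite (Pext _ (fun d => k * c d + b d)) => [|d]; last by rewrite !ffunE addrC.
  by rewrite Plin (PB b) ?addr0 //; exact/memB.
have n1 : fw1 \notin B.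
  apply/negP => /memB [h hb]; case: NBw1; exists h => d.
  by rewrite -hb ffunE.
have n2 : fw2 \notin (B + <[fw1]>)%VS.
  apply/negP => /PZ [k _]; rewrite (Pext _ w2) => [|d]; last by rewrite ffunE.
  rewrite (Pext fw1 w1) => [|d]; last by rewrite ffunE.
  by rewrite Pw1 mulr0 => h; rewrite h eqxx in Pw2.
set W := (B + <[fw1]> + <[fw2]>)%VS.
have WZ : (W <= Z)%VS.
  rewrite !subv_add -!memvE; apply/andP; split; last exact/memZ/coc_ext.
  apply/andP; split; last exact/memZ/coc_ext.
  by apply/subvP => y /memB/coboundary_cocycle/memZ.
have dimZ : (\dim Z + \dim (linfun sumf @: A) = \dim A)%N by rewrite limg_ker_dim.
have WE : W = Z.
  apply/eqP; rewrite eqEdim WZ /=.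
  have count (a s b z d w nT nV nD : nat) : (2 * a <= nD -> nT <= s.+1 -> nV <= b.+1 ->
    z + s = a -> nD <= 2 * (nT + nV) -> d < w -> b < d -> z <= w)%N by lia.
  exact: (count _ _ _ _ _ _ _ _ _ dimA dim_sums dim_coboundaries dimZ euler
            (dimv_add_line n2) (dimv_add_line n1)).
have : fx \in W by rewrite WE; apply/memZ/coc_ext.
case/memv_addP => y yW [_ /vlineP[k ->] E].
have Ek : k = 0.
  have : P fx = P x by apply: Pext => d; rewrite ffunE.
  rewrite Px E (Pext _ (fun d => k * fw2 d + y d)) => [|d]; last by rewrite !ffunE addrC.
  rewrite Plin; have [k' _ ->] := PZ _ _ yW.
  rewrite (Pext fw1 w1) ?Pw1 ?mulr0 ?addr0 => [|d]; last by rewrite ffunE.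
  rewrite (Pext fw2 w2) => [|d]; last by rewrite ffunE.
  by move/eqP; rewrite mulf_eq0 (negPf Pw2) orbF => /eqP.
have [c [h hy _] _] := PZ _ _ yW.
exists c, h => d; have := congr1 (fun f : ED => f d) E.
by rewrite Ek scale0r addr0 [fx d]ffunE hy ffunE.
Qed.
End Cohomology.

(** Transport [y0] along each orbit from its root; the hypothesis says that there is no monodromy
    where the orbit closes up. *)
Lemma orbit_potential (D : finType) (Y : Type) (f : D -> D) (F : D -> Y -> Y)
    (y0 : Y) : injective f ->
  (forall d, foldl (fun y x => F x y) y0 (orbit f d) = y0) ->
  exists k : D -> Y, forall d, k (f d) = F d (k d).
Proof.
move=> f_inj loop0; pose r d := froot f d; pose i d := findex f (r d) d.
have rc d : fconnect f (r d) d by rewrite (fconnect_sym f_inj) connect_root.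
exists (fun d => foldl (fun y x => F x y) y0 (traject f (r d) (i d))) => d.
have rf : r (f d) = r d.
  apply/esym/eqP; rewrite root_connect; first exact: fconnect1.
  exact: fconnect_sym f_inj.
have id : iter (i d) f (r d) = d by exact: iter_findex.
have : (i d < fingraph.order f (r d))%N by exact: findex_max.
rewrite leq_eqVlt => /orP[/eqP h|h].
  have fd : f d = r d by rewrite -[d in LHS]id -iterS h iter_order.
  have -> : i (f d) = 0%N by rewrite /i rf fd findex0.
  by have := loop0 (r d); rewrite /orbit -h trajectSr foldl_rcons id => ->.
have -> : i (f d) = (i d).+1.
  by rewrite /i rf; have := findex_iter h; rewrite iterS id.
by rewrite rf trajectSr foldl_rcons id.
Qed.

(** The quotient of the two permutations fixes [a] and [b], so it is the identity or a
    transposition, and the latter is odd. *)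
Lemma even_perm_eq (p p' : 'S_4) a b : ~~ odd_perm p -> ~~ odd_perm p' ->
  a != b -> p a = p' a -> p b = p' b -> p = p'.
Proof.
move=> ep ep' ab pa pb; pose s := (p' * p^-1)%g.
have sa : s a = a by rewrite permM -pa permK.
have sb : s b = b by rewrite permM -pb permK.
have es : odd_perm s = false by rewrite odd_permM odd_permV (negPf ep) (negPf ep').
have E2 c d : c != d -> c != a -> c != b -> d != a -> d != b ->
    (forall x, [\/ x = a, x = b, x = c | x = d]) -> s = 1%g.
  move=> cd ca cb da db all4.
  have nfix x y : s y = y -> x != y -> s x != y.
    by move=> sy; apply: contra => /eqP E; rewrite -(inj_eq (@perm_inj _ s)) E sy.
  have := (nfix c a sa ca, nfix c b sb cb, nfix d a sa da, nfix d b sb db).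
  case=> -[[sca scb] sda] sdb.
  have scd : s c != s d by rewrite (inj_eq perm_inj).
  case: (all4 (s c)) => E; rewrite ?E ?eqxx // in sca scb.
    apply/permP => x; rewrite perm1; case: (all4 x) => ->//.
    by case: (all4 (s d)) => F //; rewrite ?F ?E ?eqxx // in sda sdb scd.
  suff sE : s = tperm c d by move: es; rewrite sE odd_tperm cd.
  apply/permP => x; case: (all4 x) => ->.
  - by rewrite tpermD // eq_sym.
  - by rewrite tpermD // eq_sym.
  - by rewrite tpermL.
  - by rewrite tpermR; case: (all4 (s d)) => F //; rewrite ?F ?E ?eqxx // in sda sdb scd.
have s1 : s = 1%g.
{ move: E2; case: (ord4E a) (ord4E b) ab => -> [] -> //= _ E2;
   [apply: (E2 o2 o3)|apply: (E2 o1 o3)|apply: (E2 o1 o2)|apply: (E2 o2 o3)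
   |apply: (E2 o0 o3)|apply: (E2 o0 o2)|apply: (E2 o1 o3)|apply: (E2 o0 o3)
   |apply: (E2 o0 o1)|apply: (E2 o1 o2)|apply: (E2 o0 o2)|apply: (E2 o0 o1)].
  all: try by [].
  all: move=> x; case: (ord4E x) => ->;
    first [exact: Or41|exact: Or42|exact: Or43|exact: Or44]. }
by move: s1 => /(canRL (mulgK _)); rewrite invgK mul1g => ->.
Qed.

Lemma even_perm_ex (a b c d v w : 'I_4) : uniq [:: a; b; c; d] -> v != w ->
  exists p : 'S_4, [/\ ~~ odd_perm p, p a = v & p b = w].
Proof.
rewrite /= !inE !negb_or -!andbA andbT => /and5P[ab ac ad bc /andP[bd cd]] vw.
pose p := (tperm a v * tperm (tperm a v b) w)%g.
have pb : p b = w by rewrite permM tpermL.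
have pa : p a = v.
  rewrite permM tpermL tpermD // 1?eq_sym //.
  by rewrite -{1}(tpermL a v) (inj_eq perm_inj).
have [op|op] := boolP (odd_perm p); last by exists p.
exists (tperm c d * p)%g; rewrite odd_permM odd_tperm cd op.
have [fa fb] : tperm c d a = a /\ tperm c d b = b by rewrite !tpermD // eq_sym.
by split; rewrite // permM ?fa ?fb.
Qed.

(** Rotation of the triangle cut off at vertex [o0], locked so that simplification leaves it
    folded. *)
Definition c3 : 'S_4 := locked (tperm o1 o2 * tperm o2 o3)%g.

Lemma c3E : [/\ c3 o0 = o0, c3 o1 = o3, c3 o2 = o1 & c3 o3 = o2].
Proof. by rewrite /c3 -lock; split; rewrite permM !tpermE4. Qed.

Lemma c3_cube : (c3 * c3 * c3)%g = 1%g.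
Proof.
have [h0 h1 h2 h3] := c3E.
by apply/permP => x; rewrite !permM perm1; case: (ord4E x) => ->;
  rewrite !(h0, h1, h2, h3).
Qed.

Lemma odd_c3 : odd_perm c3 = false.
Proof. by rewrite /c3 -lock odd_permM !odd_tperm. Qed.

(** * Flags *)

Section Flags.
Variables (n : nat) (T : gluing n).
Hypothesis hT : oriented_gluing T.
Local Notation tet := 'I_n.+1.
Local Notation gt := (glue_tet T).
Local Notation gp := (glue_perm T).

Lemma gp_odd j f : odd_perm (gp j f). Proof. by case: (hT j f). Qed.
Lemma gtK j f : gt (gt j f) (gp j f f) = j. Proof. by case: (hT j f). Qed.
Lemma gpV j f : gp (gt j f) (gp j f f) = ((gp j f)^-1)%g. Proof. by case: (hT j f). Qed.
Lemma glue_neq j f : (gt j f, gp j f f) <> (j, f). Proof. by case: (hT j f). Qed.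
Lemma gpK j f a : gp (gt j f) (gp j f f) (gp j f a) = a.
Proof. by rewrite gpV permK. Qed.

(* The flag [(j, p)] encodes two things at once: the corner [(j, p 0, p 1)], and the
   side of the triangle [(j, p 0)] of the link lying in face [p 2], oriented from
   corner [p 1] to corner [p 3].  Then [fopp] is the same side with the other
   orientation, seen from the adjacent triangle, and [fnxt] the next side of the
   triangle; it starts at corner [p 3]. *)
Definition flag : Type := {x : tet * 'S_4 | ~~ odd_perm x.2}.
HB.instance Definition _ := Finite.on flag.

Definition fr (d : flag) : 'S_4 := (val d).2.
Definition ft (d : flag) : tet := (val d).1.
Lemma fr_even d : ~~ odd_perm (fr d). Proof. exact: (valP d). Qed.

Lemma fnxt_subproof d : ~~ odd_perm (ft d, (c3 * fr d)%g).2.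
Proof. by rewrite odd_permM odd_c3 /= fr_even. Qed.
Definition fnxt (d : flag) : flag := Sub (ft d, (c3 * fr d)%g) (fnxt_subproof d).

Lemma finv_subproof d :
  ~~ odd_perm (gt (ft d) (fr d o2), (tperm o1 o3 * fr d * gp (ft d) (fr d o2))%g).2.
Proof. by rewrite /= !odd_permM odd_tperm gp_odd (negPf (fr_even d)). Qed.
Definition fopp (d : flag) : flag :=
  Sub (gt (ft d) (fr d o2), (tperm o1 o3 * fr d * gp (ft d) (fr d o2))%g) (finv_subproof d).

Lemma fr_nxt d : [/\ ft (fnxt d) = ft d, fr (fnxt d) o0 = fr d o0,
  fr (fnxt d) o1 = fr d o3, fr (fnxt d) o2 = fr d o1 & fr (fnxt d) o3 = fr d o2].
Proof. by have [h0 h1 h2 h3] := c3E; split; rewrite // /fr /= permM ?h0 ?h1 ?h2 ?h3. Qed.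

Lemma fr_opp d : [/\ ft (fopp d) = gt (ft d) (fr d o2),
  fr (fopp d) o0 = gp (ft d) (fr d o2) (fr d o0),
  fr (fopp d) o1 = gp (ft d) (fr d o2) (fr d o3),
  fr (fopp d) o2 = gp (ft d) (fr d o2) (fr d o2)
  & fr (fopp d) o3 = gp (ft d) (fr d o2) (fr d o1)].
Proof. by split; rewrite // /fr /= !permM tpermE4. Qed.

Lemma flag_inj d d' : ft d = ft d' -> fr d = fr d' -> d = d'.
Proof.
move=> h1 h2; apply: val_inj.
by rewrite (surjective_pairing (val d)) (surjective_pairing (val d')); congr pair.
Qed.

Lemma foppK : involutive fopp.
Proof.
move=> d; have [h1 _ _ h3 _] := fr_opp d; have [k1 _ _ _ _] := fr_opp (fopp d).
apply: flag_inj; first by rewrite k1 h1 h3 gtK.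
rewrite [fr (fopp _)]/fr /= h1 h3 gpV -/(fr _) {1}/fr /= !mulgA.
by rewrite tperm2 mul1g mulgK.
Qed.

Lemma fnxt3 d : fnxt (fnxt (fnxt d)) = d.
Proof.
apply: flag_inj; first by rewrite /ft /=.
by rewrite /fr /= !mulgA c3_cube mul1g.
Qed.

Lemma fnxt_inj : injective fnxt.
Proof. by apply: (can_inj (g := fun d => fnxt (fnxt d))) => d; rewrite fnxt3. Qed.

Lemma fnxt_neq d : fnxt d != d.
Proof.
apply/eqP => h; have [_ _ h1 _ _] := fr_nxt d.
by move: h1; rewrite h => /perm_inj.
Qed.

Lemma turn_val d : turn T (val d) = val (fnxt (fopp d)).
Proof.
rewrite /turn /= -/(ft d) -/(fr d) /fr /= -/(fr d); congr pair.
rewrite !mulgA; congr (_ * _ * _)%g.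
have [h0 h1 h2 h3] := c3E.
by apply/permP => x; rewrite [RHS]permM; case: (ord4E x) => ->;
  rewrite ?h0 ?h1 ?h2 ?h3 !tpermE4.
Qed.

Definition cr (d : flag) : crossing n := (ft d, fr d o0, fr d o2).
Definition fsrc (d : flag) : tet * 'I_4 := (ft d, fr d o0).

Lemma cr_inj : injective cr.
Proof.
move=> d d' [h1 h2 h3]; apply: flag_inj => //.
by apply: (@even_perm_eq _ _ o0 o2) => //; exact: fr_even.
Qed.

Lemma cr_surj j v f : f != v -> exists d, cr d = (j, v, f).
Proof.
move=> fv; case: (@even_perm_ex o0 o2 o1 o3 v f isT) => [|p [ep h1 h2]].
  by rewrite eq_sym.
by exists (Sub (j, p) ep); rewrite /cr /ft /fr /= h1 h2.
Qed.

Lemma corner_surj j v w : w != v -> exists d, [/\ ft d = j, fr d o0 = v & fr d o1 = w].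
Proof.
move=> fv; case: (@even_perm_ex o0 o1 o2 o3 v w isT) => [|p [ep h1 h2]].
  by rewrite eq_sym.
by exists (Sub (j, p) ep).
Qed.

Lemma corner_inj d d' : ft d = ft d' -> fr d o0 = fr d' o0 -> fr d o1 = fr d' o1 ->
  d = d'.
Proof.
move=> h1 h2 h3; apply: flag_inj => //.
by apply: (@even_perm_eq _ _ o0 o1) => //; exact: fr_even.
Qed.

Lemma cr_opp d : cr (fopp d) = cr_inv T (cr d).
Proof. by have [h1 h2 h3 h4 h5] := fr_opp d; rewrite /cr h1 h2 h4. Qed.

Lemma fsrc_opp d : fsrc (fopp d) = lstep T (fsrc d) (fr d o2).
Proof. by have [h1 h2 h3 h4 h5] := fr_opp d; rewrite /fsrc h1 h2. Qed.

Lemma fopp_neq d : fopp d != d.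
Proof.
apply/eqP => h; have [h1 _ _ h2 _] := fr_opp d; rewrite h in h1 h2.
by apply: (@glue_neq (ft d) (fr d o2)); rewrite -h1 -h2.
Qed.

Lemma fsrc_nxt d : fsrc (fnxt d) = fsrc d.
Proof. by have [h1 h2 _ _ _] := fr_nxt d; rewrite /fsrc h1 h2. Qed.

Lemma fsrc_fiber d d' : fsrc d' = fsrc d ->
  [\/ d' = d, d' = fnxt d | d' = fnxt (fnxt d)].
Proof.
case=> h1 h2; have [k1 k2 k3 k4 k5] := fr_nxt d.
have [m1 m2 m3 m4 m5] := fr_nxt (fnxt d).
have : [\/ fr d' o1 = fr d o1, fr d' o1 = fr d o2 | fr d' o1 = fr d o3].
  have : fr d' o1 != fr d o0 by rewrite -h2 (inj_eq perm_inj).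
  rewrite -[fr d' o1](permKV (fr d)); case: (ord4E ((fr d)^-1%g (fr d' o1))) => -> //;
    rewrite ?eqxx // => _; by [apply: Or31|apply: Or32|apply: Or33].
case=> h; [apply: Or31|apply: Or33|apply: Or32]; apply: corner_inj => //;
  by rewrite ?m1 ?m2 ?m3 ?k1 ?k2 ?k3 ?k5.
Qed.

Lemma fsrc_surj x : exists d, fsrc d = x.
Proof.
case: x => j v; have [w wv] : exists w, w != v.
  by case: (ord4E v) => ->; [exists o1|exists o0|exists o0|exists o0].
by case: (corner_surj j wv) => d [h1 h2 _]; exists d; rewrite /fsrc h1 h2.
Qed.

Lemma fsrc_conn (hc : one_cusped T) (B : {set tet * 'I_4}) : B != finset.set0 ->
  (forall d, fsrc d \in B -> fsrc (fopp d) \in B) -> B = [set: tet * 'I_4]%SET.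
Proof.
case/set0Pn => x0 x0B Bc; apply/setP => y; rewrite inE.
case/connectP: (hc x0 y) => p + ->; elim: p x0 x0B => //= x p IH x0 x0B.
case/andP => /existsP[f /andP[fx /eqP xE]]; apply: IH.
case: x0 x0B fx xE => j v x0B fx xE.
case: (cr_surj j fx) => d [h1 h2 h3].
by have := Bc d; rewrite fsrc_opp /fsrc h1 h2 h3 xE; apply.
Qed.

Lemma turn_inj : injective (turn T).
Proof.
move=> [j p] [j' p']; rewrite /turn /= => -[E1 E2].
have E3 : gp j (p o2) (p o2) = gp j' (p' o2) (p' o2).
  by have := congr1 (fun s : 'S_4 => s o3) E2; rewrite !permM !tpermE4.
have jj : j = j' by rewrite -(gtK j (p o2)) E1 E3 gtK.
have E4 : gp j (p o2) = gp j' (p' o2).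
  by apply: invg_inj; rewrite -!gpV E1 E3.
by move: E2; rewrite E4 => /mulIg /mulgI ->; rewrite jj.
Qed.

(** An orbit of [turn] is encoded by its root, so that the cardinal of this type is [link_vertices]
    by definition. *)
Definition vert : Type :=
  {x : tet * 'S_4 | (froot (turn T) x == x) && ~~ odd_perm x.2}.
HB.instance Definition _ := Finite.on vert.

Lemma froot_turn x : froot (turn T) (turn T x) = froot (turn T) x.
Proof.
apply/esym/eqP; rewrite root_connect ?fconnect1 //; exact: fconnect_sym turn_inj.
Qed.

Lemma odd_turn x : odd_perm (turn T x).2 = odd_perm x.2.
Proof. by rewrite /turn /= !odd_permM odd_tperm gp_odd /=; case: odd_perm. Qed.

Lemma fvert_subproof (d : flag) (x := val d : tet * 'S_4) :
  (froot (turn T) (froot (turn T) x) == froot (turn T) x)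
  && ~~ odd_perm (froot (turn T) x).2.
Proof.
rewrite root_root ?eqxx /=; last exact: fconnect_sym turn_inj.
have := connect_root (frel (turn T)) (val d); move/iter_findex => <-.
have := valP d; elim: (findex _ _ _) => //= i IH h.
by rewrite odd_turn IH.
Qed.

Definition fvert (d : flag) : vert := Sub (froot (turn T) (val d : tet * 'S_4)) (fvert_subproof d).

Lemma fvert_turn d : fvert (fnxt (fopp d)) = fvert d.
Proof. apply: val_inj; rewrite [LHS](_ : _ = froot (turn T) (val (fnxt (fopp d)))) //.
by rewrite -turn_val froot_turn. Qed.

Lemma fvert_surj v : exists d, fvert d = v.
Proof.
case: v => x /= xP; have /andP[/eqP rx ex] := xP.
exists (Sub x ex); exact: val_inj.
Qed.

Lemma card_fsrc : (#|{: flag}| <= 3 * #|{: tet * 'I_4}|)%N.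
Proof.
rewrite -!sum1_card (partition_big fsrc predT) //= mulnC big_distrl /=.
apply: leq_sum => x _; rewrite mul1n sum1dep_card.
case: (fsrc_surj x) => d <-.
rewrite cardE; apply: (@uniq_leq_size _ _ [:: d; fnxt d; fnxt (fnxt d)] (enum_uniq _)).
by move=> d'; rewrite mem_enum inE => /eqP /fsrc_fiber [] ->; rewrite !inE eqxx ?orbT.
Qed.

Lemma card_vert (ht : torus_link T) : #|{: vert}| = (2 * n.+1)%N.
Proof.
have : link_vertices T = #|{: vert}|.
  rewrite card_sig; apply: eq_card => x; rewrite !inE; congr (_ && _).
move: ht; rewrite /torus_link => + E; rewrite E /link_triangles /link_sides.
move: #|_| => m; lia.
Qed.

End Flags.

(** * The cochain of [alpha] *)

Section Homotopy.
Variables (X L : Type) (step : X -> L -> X) (rel : X -> seq L -> Prop).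

Lemma homotopic_cat2l x p w w' : homotopic step rel (foldl step x p) w w' ->
  homotopic step rel x (p ++ w) (p ++ w').
Proof.
elim=> [u|u v _ IH|u v t _ IH _ IH'|u r v ru].
- exact: htp_refl.
- exact: htp_sym.
- exact: htp_trans IH'.
- by rewrite !catA -(catA _ r); apply: htp_rel; rewrite foldl_cat.
Qed.

Lemma homotopic_cat2r x q w w' : homotopic step rel x w w' ->
  homotopic step rel x (w ++ q) (w' ++ q).
Proof.
elim=> [u|u v _ IH|u v t _ IH _ IH'|u r v ru].
- exact: htp_refl.
- exact: htp_sym.
- exact: htp_trans IH'.
- by rewrite -!catA; apply: htp_rel.
Qed.
End Homotopy.

Section RevWalk.
Variables (n : nat) (T : gluing n).
Hypothesis hT : oriented_gluing T.
Local Notation tet := 'I_n.+1.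
Local Notation gt := (glue_tet T).
Local Notation gp := (glue_perm T).
Variables (X : Type) (step : X -> 'I_4 -> X) (rel : X -> seq 'I_4 -> Prop).
Variables (pr : X -> tet) (ok : X -> 'I_4 -> bool).
Hypothesis pr_step : forall x f, pr (step x f) = gt (pr x) f.
Hypothesis ok_inv : forall x f, ok x f -> ok (step x f) (gp (pr x) f f).
Hypothesis step_inv : forall x f, step (step x f) (gp (pr x) f f) = x.
Hypothesis rel_inv : forall x f, ok x f -> rel x [:: f; gp (pr x) f f].

(** The section is used twice: in the manifold every face may be crossed, while in the link the face
    opposite to the vertex may not. *)
Fixpoint valid (x : X) (w : seq 'I_4) : bool :=
  if w is f :: w' then ok x f && valid (step x f) w' else true.

Lemma valid_cat x u v : valid x (u ++ v) = valid x u && valid (foldl step x u) v.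
Proof. by elim: u x => //= f u IH x; rewrite IH andbA. Qed.

Lemma foldl_rev_walk x w : foldl step (foldl step x w) (rev_walk T (pr x) w) = x.
Proof.
elim: w x => //= f w IH x.
by rewrite foldl_rcons -pr_step IH step_inv.
Qed.

Lemma valid_rev_walk x w : valid x w -> valid (foldl step x w) (rev_walk T (pr x) w).
Proof.
elim: w x => //= f w IH x /andP[xf /IH]; rewrite -cats1 valid_cat pr_step => -> /=.
by rewrite -pr_step foldl_rev_walk ok_inv.
Qed.

Lemma rev_walk_cancel x p w v : valid (foldl step x p) w ->
  homotopic step rel x (p ++ w ++ rev_walk T (pr (foldl step x p)) w ++ v) (p ++ v).
Proof.
elim: w p v => [|f w IH] p v /=; first by move=> _; exact: htp_refl.
case/andP=> okf vw; rewrite -cats1 -catA.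
have := IH (rcons p f) ([:: gp (pr (foldl step x p)) f f] ++ v).
rewrite foldl_rcons pr_step cat_rcons => /(_ vw) h; apply: htp_trans h _.
rewrite cat_rcons; apply: (@htp_rel _ _ step rel x p [:: f; _] v); exact: rel_inv okf.
Qed.

Lemma rev_walk_cancelV x p y w v : valid y w -> foldl step x p = foldl step y w ->
  homotopic step rel x (p ++ rev_walk T (pr y) w ++ w ++ v) (p ++ v).
Proof.
elim: w y p v => [|f w IH] y p v /=; first by move=> _ _; exact: htp_refl.
case/andP=> okf vw E; rewrite -cats1 -catA -pr_step.
have vr : valid (step y f) w by [].
set q := p ++ rev_walk T (pr (step y f)) w.
have Eq : foldl step x q = step y f by rewrite foldl_cat E foldl_rev_walk.
have := htp_rel (step := step) (rel := rel) (x := x) (u := q)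
  (r := [:: gp (pr y) f f; f]) (w ++ v).
rewrite Eq => h; apply: htp_trans (_ : homotopic step rel x (q ++ w ++ v) _).
  rewrite /q -!catA /= in h *; apply: h.
  have := rel_inv (ok_inv okf); rewrite pr_step gpV // permK; exact.
by rewrite /q -catA; apply: IH.
Qed.
End RevWalk.

Section Cochain.
Variables (n : nat) (T : gluing n).
Hypothesis hT : oriented_gluing T.
Local Notation tet := 'I_n.+1.
Local Notation gt := (glue_tet T).
Local Notation gp := (glue_perm T).
Local Notation base := (base n).
Local Notation rw := (rev_walk T base).
Variables (alpha : seq 'I_4 -> int).
Hypothesis halpha : pi1_epi T alpha.
Variable pT : tet -> seq 'I_4.
Hypothesis hpT : forall j, walk T base (pT j) = j.

Let okT (x : tet) (f : 'I_4) := true.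
Let validT (x : tet) w : valid gt okT x w.
Proof. by elim: w x => //= f w IH x. Qed.

Lemma walk_cat j u v : walk T j (u ++ v) = walk T (walk T j u) v.
Proof. exact: foldl_cat. Qed.

Lemma walk_rev j w : walk T (walk T j w) (rev_walk T j w) = j.
Proof. by apply: (@foldl_rev_walk _ _ _ gt id) => // x f; rewrite gtK. Qed.

Lemma M_cancel x p w v :
  M_homotopic T x (p ++ w ++ rev_walk T (walk T x p) w ++ v) (p ++ v).
Proof.
apply: (rev_walk_cancel (step := gt) (rel := M_relator T) (pr := id) (ok := okT)) => //.
by move=> y f _; left; exists f.
Qed.

Lemma M_cancelV x p y w v : walk T x p = walk T y w ->
  M_homotopic T x (p ++ rev_walk T y w ++ w ++ v) (p ++ v).
Proof.
apply: (rev_walk_cancelV hT (step := gt) (rel := M_relator T) (pr := id) (ok := okT)) => //.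
- by move=> z f; rewrite gtK.
- by move=> z f _; left; exists f.
Qed.

Lemma alpha_nil : alpha [::] = 0.
Proof.
case: halpha => aM _ _; have := aM [::] [::] erefl erefl.
by move/eqP; rewrite -subr_eq0 opprD addrA subrr add0r oppr_eq0 => /eqP.
Qed.

Lemma alpha_cat u v : loop T u -> loop T v -> alpha (u ++ v) = alpha u + alpha v.
Proof. by case: halpha => aM _ _; apply: aM. Qed.

Lemma alpha_htp u v : loop T u -> loop T v -> M_homotopic T base u v -> alpha u = alpha v.
Proof. by case: halpha => _ aH _; apply: aH. Qed.

(** If [[[pT j]]] is the chosen lift of tetrahedron [j], crossing its face [f] leads to the chosen
    lift of the neighbour moved by this power of the deck generator. *)
Definition acoch (j : tet) (f : 'I_4) : int := alpha (pT j ++ f :: rw (pT (gt j f))).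

Fixpoint asum (j : tet) (w : seq 'I_4) : int :=
  if w is f :: w' then acoch j f + asum (gt j f) w' else 0.

(** The detour from [j] to the base tetrahedron and back along [pT j] is inserted after [u]. *)
Lemma alpha_split u w v j : walk T base u = j -> walk T (walk T base u) w = base ->
  walk T base v = base ->
  alpha (u ++ w ++ v) = alpha (u ++ rw (pT j)) + alpha (pT j ++ w) + alpha v.
Proof.
move=> uj wb vb.
have l1 : loop T (u ++ rw (pT j)) by rewrite /loop walk_cat uj -{1}(hpT j) walk_rev.
have l2 : loop T (pT j ++ w) by rewrite /loop walk_cat hpT -uj.
rewrite -alpha_cat // -alpha_cat //; last by rewrite /loop walk_cat l1.
apply: alpha_htp; rewrite /loop ?walk_cat ?uj; last 1 first.
- rewrite -!catA; apply: htp_sym; apply: M_cancelV; by rewrite uj hpT.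
- by rewrite -uj wb.
- by rewrite -{1}(hpT j) walk_rev hpT -uj wb.
Qed.

Lemma alpha_walk j w : alpha (pT j ++ w ++ rw (pT (walk T j w))) = asum j w.
Proof.
elim: w j => [|f w IH] j /=.
  rewrite -(alpha_nil); apply: alpha_htp => //.
    by rewrite /loop walk_cat hpT -{1}(hpT j) walk_rev.
  have := M_cancel base [::] (pT j) [::]; by rewrite cats0.
rewrite -IH -cat_rcons.
have uE : walk T base (rcons (pT j) f) = gt j f by rewrite /walk foldl_rcons -/(walk _ _ _) hpT.
rewrite -[w ++ _ in LHS]cats0 (alpha_split uE) ?alpha_nil ?addr0 //; first by rewrite /acoch cat_rcons.
by rewrite uE walk_cat -{1}(hpT (walk T (gt j f) w)) walk_rev.
Qed.

Lemma alpha_path u u' j w : walk T base u = j -> walk T base u' = walk T j w ->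
  alpha (u ++ w ++ rw u') =
  alpha (u ++ rw (pT j)) + asum j w + alpha (pT (walk T j w) ++ rw u').
Proof.
move=> uj u'E; rewrite -alpha_walk.
have lw x : walk T base u' = x -> walk T x (rw u') = base by move=> <-; exact: walk_rev.
rewrite -[w ++ rw u']cats0 (@alpha_split u _ [::] j) // ?uj ?walk_cat ?(lw _ u'E) //.
rewrite alpha_nil addr0 -addrA; congr (_ + _); rewrite catA.
rewrite -[rw u' in LHS]cats0 (@alpha_split (pT j ++ w) _ [::] (walk T j w)) //.
- by rewrite alpha_nil addr0 catA.
- by rewrite walk_cat hpT.
- by rewrite walk_cat hpT (lw _ u'E).
Qed.

(** For a closed path the two end corrections of [alpha_path] are opposite, so the value does not
    depend on [u]. *)
Lemma alpha_loop u j w : walk T base u = j -> walk T j w = j ->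
  alpha (u ++ w ++ rw u) = asum j w.
Proof.
move=> uj wj; rewrite (@alpha_path u u j w) ?wj //.
rewrite addrAC -[RHS]add0r; congr (_ + _).
rewrite -alpha_cat; last 2 first.
- by rewrite /loop walk_cat uj -{1}(hpT j) walk_rev.
- by rewrite /loop walk_cat hpT -{1}uj walk_rev.
rewrite -alpha_nil; apply: alpha_htp => //.
  by rewrite /loop !walk_cat uj -{1}(hpT j) walk_rev hpT -{1}uj walk_rev.
rewrite -!catA; apply: htp_trans (_ : homotopic _ _ _ (u ++ rw u) _).
  by apply: M_cancelV; rewrite uj hpT.
by have := M_cancel base [::] u [::]; rewrite cats0.
Qed.

Lemma asum_relator j r : M_relator T j r -> walk T j r = j -> asum j r = 0.
Proof.
move=> rr rj; rewrite -(alpha_loop (hpT j) rj) -alpha_nil; apply: alpha_htp => //.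
  by rewrite /loop !walk_cat hpT rj -{1}(hpT j) walk_rev.
apply: htp_trans (_ : homotopic _ _ _ (pT j ++ rw (pT j)) _).
  by apply: htp_rel; rewrite -/(walk _ _ _) hpT.
by have := M_cancel base [::] (pT j) [::]; rewrite cats0.
Qed.

Lemma acochV j f : acoch (gt j f) (gp j f f) = - acoch j f.
Proof.
have := @asum_relator j [:: f; gp j f f]; rewrite /= gtK // addr0.
move=> h; apply/eqP; rewrite -addr_eq0 addrC h //; left; by exists f.
Qed.

Lemma walk_turn_word x : walk T x.1 (turn_word T x) = x.1.
Proof.
have gen m y : walk T y.1 [seq (z : tet * 'S_4).2 o2 | z <- traject (turn T) y m] = (iter m (turn T) y).1.
  by elim: m y => // m IH y; rewrite iterSr -IH.
by rewrite gen iter_order //; exact: turn_inj.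
Qed.

(** A full turn around an edge is a relator of the fundamental group, so [acoch] adds up to zero
    along each orbit of [turn]. *)
Lemma flag_potential : exists k : flag n -> int,
  forall d, k (fnxt (fopp hT d)) = k d + acoch (ft d) (fr d o2).
Proof.
have [k hk] : exists k : tet * 'S_4 -> int, forall x, k (turn T x) = k x + acoch x.1 (x.2 o2).
  apply: (@orbit_potential _ _ (turn T) (fun x y => y + acoch x.1 (x.2 o2)) 0 (turn_inj hT)).
  move=> x; rewrite -[RHS](@asum_relator x.1 (turn_word T x)).
  - have gen m y s : foldl (fun s (x : tet * 'S_4) => s + acoch x.1 (x.2 o2)) s (traject (turn T) y m) =
        s + asum y.1 [seq (z : tet * 'S_4).2 o2 | z <- traject (turn T) y m].
      by elim: m y s => [|m IH] y s /=; rewrite ?addr0 // IH addrA.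
    by rewrite gen add0r.
  - by right; exists x.2; case: x.
  - exact: walk_turn_word.
exists (fun d => k (val d)) => d; by rewrite -turn_val hk.
Qed.

Section Corners.
Variable Y : Type.
Variable F : flag n -> Y.

(** A flag is determined by its corner, so a function of flags can be read on triples [(j, v, w)];
    the default [y0] is taken only when [v = w]. *)
Definition at_corner (y0 : Y) (j : tet) (v w : 'I_4) : Y :=
  if [pick d : flag n | (ft d, fr d o0, fr d o1) == (j, v, w)] is Some d then F d else y0.

Lemma at_cornerE y0 d : at_corner y0 (ft d) (fr d o0) (fr d o1) = F d.
Proof.
rewrite /at_corner; case: pickP => [d' /eqP[h1 h2 h3]|/(_ d)]; last by rewrite eqxx.
by rewrite (corner_inj h1 h2 h3).
Qed.
End Corners.

Lemma at_corner_step (Y : zmodType) (F : flag n -> Y) (b : tet -> 'I_4 -> Y) y0 j v w f :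
  (forall d, F (fnxt (fopp hT d)) = F d + b (ft d) (fr d o2)) ->
  (forall j f, b (gt j f) (gp j f f) = - b j f) ->
  v != w -> f != v -> f != w ->
  at_corner F y0 (gt j f) (gp j f v) (gp j f w) = at_corner F y0 j v w + b j f.
Proof.
move=> hF bV vw fv fw; have wv : w != v by rewrite eq_sym.
case: (corner_surj j wv) => d [dj dv dw].
have [k1 k2 k3 k4 k5] := fr_nxt d.
have [m1 m2 m3 m4 m5] := fr_nxt (fnxt d).
case: (ord4E ((fr d)^-1%g f)) => /(canRL (permKV _)) fE.
- by rewrite fE dv eqxx in fv.
- by rewrite fE dw eqxx in fw.
- have [p1 p2 p3 p4 p5] := fr_opp hT d.
  have [q1 q2 q3 q4 q5] := fr_nxt (fopp hT d).
  have -> : at_corner F y0 (gt j f) (gp j f v) (gp j f w) = F (fnxt (fopp hT d)).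
    by rewrite -(at_cornerE F y0) q1 q2 q3 p1 p2 p5 dj dv dw fE.
  by rewrite hF -dj -dv -dw at_cornerE fE.
(* The other face containing the edge is crossed by turning backwards. *)
- pose d' := fopp hT (fnxt (fnxt d)).
  have [p1 p2 p3 p4 p5] := fr_opp hT (fnxt (fnxt d)).
  have Ed : fnxt (fopp hT d') = d by rewrite foppK fnxt3.
  have := hF d'; rewrite Ed -(at_cornerE F y0 d) dj dv dw => ->.
  rewrite -(at_cornerE F y0 d') p1 p2 p3 p4 m1 m2 m4 m5 k1 k2 k3 k4 dj dv dw -fE.
  by rewrite bV subrK.
Qed.

Section Lifts.
Variable e : tet -> tet * 'I_4 * 'I_4.
Hypothesis he : edge_enumeration T e.
Variable pE : tet -> seq 'I_4.
Hypothesis hpE : forall i, walk T base (pE i) = (e i).1.1.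

Lemma around_walk x w y : around T x w y -> walk T x.1.1 w = y.1.1.
Proof. by elim. Qed.

(** The relation [around] may flip the edge, so only the sum [S] of the potential at both ends is
    well defined. It changes by twice [asum], and the integers have no 2-torsion. *)
Lemma around_asum x w w' y : x.1.2 != x.2 -> around T x w y -> around T x w' y ->
  asum x.1.1 w = asum x.1.1 w'.
Proof.
case: flag_potential => k hk.
pose S (x : tet * 'I_4 * 'I_4) :=
  at_corner k 0 x.1.1 x.1.2 x.2 + at_corner k 0 x.1.1 x.2 x.1.2.
have key z u t : around T z u t -> z.1.2 != z.2 -> S t = S z + (asum z.1.1 u) *+ 2.
  elim=> [j a b _|j a b _|j a b f v s fa fb _ IH ab] /=.
  - by rewrite mul0rn addr0.
  - by rewrite mul0rn addr0 /S /= addrC.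
  - rewrite IH /=; last by rewrite (inj_eq perm_inj).
    rewrite /S /= !(at_corner_step 0 _ hk acochV) // 1?eq_sym //.
    ring.
move=> nx h1 h2; have := key _ _ _ h1 nx; rewrite (key _ _ _ h2 nx).
by rewrite !mulr2n => /addrI; move: (asum _ w) (asum _ w') => p q; lia.
Qed.

Lemma around_flip_l x w y : around T x w y -> around T (x.1.1, x.2, x.1.2) w y.
Proof.
elim=> /= [j a b|j a b|j a b f v z fa fb _ IH]; first exact: around_flip.
  exact: around_nil.
exact: around_cons.
Qed.

Lemma lift_potential : exists (idx : tet * 'I_4 * 'I_4 -> tet) (k : tet * 'I_4 * 'I_4 -> int),
  forall j a b, a != b ->
  [/\ forall i, (exists w, around T (j, a, b) w (e i)) <-> i = idx (j, a, b),
      forall i m, (exists2 w, around T (j, a, b) w (e i) &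
          m + alpha (pT j ++ w ++ rw (pE i)) = 0) <-> i = idx (j, a, b) /\ m = k (j, a, b),
      idx (j, b, a) = idx (j, a, b) /\ k (j, b, a) = k (j, a, b)
    & forall f, f != a -> f != b ->
        idx (gt j f, gp j f a, gp j f b) = idx (j, a, b) /\
        k (gt j f, gp j f a, gp j f b) = k (j, a, b) + acoch j f].
Proof.
have ch x : exists p : tet * seq 'I_4, x.1.2 != x.2 ->
    around T x p.2 (e p.1) /\ (forall i, (exists w, around T x w (e i)) -> i = p.1).
  case: x => -[j a] b /=; have [->|ab] := eqVneq a b; first by exists (ord0, [::]).
  have /eqP ab' := ab; case: (he.2 j a b ab') => i [[w hw] hi].
  by exists (i, w) => _; split => // i' /hi.
have [f hf] := choice ch.
(* The lift of [e i] is chosen through [pE], independently of the lift of its tetrahedron; [eps] is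
   the discrepancy. *)
pose eps i := alpha (pT (e i).1.1 ++ rw (pE i)).
pose k x := - (asum x.1.1 (f x).2 + eps (f x).1).
have idxP x i w : x.1.2 != x.2 -> around T x w (e i) -> i = (f x).1.
  by move=> nx h; case: (hf x nx) => _; apply; exists w.
have kP x i w : x.1.2 != x.2 -> around T x w (e i) -> k x = - (asum x.1.1 w + eps i).
  move=> nx h; rewrite /k -(idxP _ _ _ nx h); congr (- (_ + _)).
  by apply: (around_asum nx _ h); rewrite (idxP _ _ _ nx h); case: (hf x nx).
have alphaE j a b i w : around T (j, a, b) w (e i) ->
    alpha (pT j ++ w ++ rw (pE i)) = asum j w + eps i.
  move=> /around_walk /= wj; rewrite (@alpha_path (pT j) (pE i) j w) ?hpE ?wj //.
  rewrite -[X in X + _ + _]/(alpha (pT j ++ [::] ++ rw (pT (walk T j [::])))) alpha_walk /=.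
  by rewrite add0r.
exists (fun x => (f x).1), k => j a b ab; have ba : b != a by rewrite eq_sym.
have [ar0 un0] := hf (j, a, b) ab.
split.
- by move=> i; split=> [[w]|->]; [exact: idxP|exists (f (j, a, b)).2].
- move=> i m; split=> [[w h]|[-> ->]].
    rewrite (alphaE _ _ _ _ _ h) (kP (j, a, b) i w) // => /eqP; rewrite addr_eq0 => /eqP ->.
    by split => //; exact: idxP h.
  by exists (f (j, a, b)).2 => //; rewrite (alphaE _ _ _ _ _ ar0) addNr.
- have h := around_flip_l ar0.
  by rewrite -(idxP (j, b, a) _ _ ba h) (kP (j, b, a) _ _ ba h).
- move=> g ga gb; have nn : gp j g a != gp j g b by rewrite (inj_eq perm_inj).
  have [ar1 _] := hf (gt j g, gp j g a, gp j g b) nn.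
  have h := around_cons ga gb ar1.
  by rewrite (idxP (j, a, b) _ _ ab h) (kP (j, a, b) _ _ ab h) /k /=; split => //; lia.
Qed.

End Lifts.

End Cochain.

(** * Null-homologous curves of the link *)

Section NullSum.
Variables (D : finType) (Z : zmodType) (e turn : D -> D) (g kap : D -> Z) (H : D -> int).
Hypotheses (eK : involutive e) (e_neq : forall d, e d != d) (turn_inj : injective turn).
Hypotheses (gN : forall d, g (e d) = - g d) (kap_turn : forall d, g d = kap d - kap (turn d)).
Hypothesis H_turn : forall d, H (turn d) = H d.

Lemma sum_count (ds : seq D) : \sum_(d <- ds) g d = \sum_d g d *+ count_mem d ds.
Proof.
elim: ds => [|x ds IH]; first by rewrite big_nil big1.
rewrite big_cons IH (bigD1 x) //= [in RHS](bigD1 x) //= eqxx mulrnDr -addrA; congr (_ + (_ + _)).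
by apply: eq_bigr => d; rewrite eq_sym => /negPf ->.
Qed.

(** The group [Z] may have 2-torsion, so [d] is matched with [e d] through an ordering instead of
    doubling the sum. *)
Lemma antisym_sum0 (M : D -> int) : (forall d, M (e d) = M d) -> \sum_d g d *~ M d = 0.
Proof.
move=> Me; pose o d := (enum_rank d < enum_rank (e d))%N.
have oe d : o (e d) = ~~ o d.
  rewrite /o eK -leqNgt [RHS]leq_eqVlt; case: eqP => // E0.
  by have := e_neq d; rewrite (enum_rank_inj (val_inj E0)) eqxx.
rewrite (bigID o) /= [X in _ + X](reindex_inj (can_inj eK)) /=.
rewrite [X in _ + X](eq_bigl o) => [|d]; last by rewrite oe negbK.
by rewrite -big_split big1 //= => d _; rewrite gN Me mulNrz subrr.
Qed.

(** Subtracting [H] from the multiplicities leaves a function symmetric under [e], killed by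
    antisymmetry of [g]. The part weighted by [H] telescopes around each vertex, where [g] is a
    difference of values of [kap] and [H] is constant. *)
Lemma null_sum (ds : seq D) :
  (forall d, (count_mem d ds)%:Z - (count_mem (e d) ds)%:Z = H d - H (e d)) ->
  \sum_(d <- ds) g d = 0.
Proof.
move=> dsH; rewrite sum_count.
have -> : \sum_d g d *+ count_mem d ds =
    \sum_d g d *~ ((count_mem d ds)%:Z - H d) + \sum_d g d *~ H d.
  rewrite -big_split; apply: eq_bigr => d _ /=.
  by rewrite -mulrzDr subrK -pmulrn.
rewrite antisym_sum0 ?add0r => [|d]; last by have := dsH d; lia.
under eq_bigr do rewrite kap_turn mulrzBl.
rewrite big_split /= sumrN [X in X - _](reindex_inj turn_inj) /=.
by under eq_bigr do rewrite H_turn; rewrite subrr.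
Qed.
End NullSum.

(** * The fundamental group of the link *)

Section LinkGroup.
Variables (n : nat) (T : gluing n).
Hypothesis hT : oriented_gluing T.
Local Notation tet := 'I_n.+1.
Local Notation gt := (glue_tet T).
Local Notation gp := (glue_perm T).
Variable x0 : tet * 'I_4.

Definition side_ok (x : tet * 'I_4) (f : 'I_4) := f != x.2.
Local Notation validL := (valid (lstep T) side_ok).
Local Notation lwalk := (foldl (lstep T)).
Local Notation rw := (rev_walk T).

Lemma side_ok_inv x f : side_ok x f -> side_ok (lstep T x f) (gp x.1 f f).
Proof. by rewrite /side_ok /= (inj_eq perm_inj). Qed.

Lemma lstepK x f : lstep T (lstep T x f) (gp x.1 f f) = x.
Proof. by rewrite /lstep /= gtK // gpK //; case: x. Qed.

Lemma link_relV x f : side_ok x f -> link_relator T x [:: f; gp x.1 f f].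
Proof. by move=> xf; left; exists f. Qed.

Lemma L_cancel x p w v : validL (lwalk x p) w ->
  link_homotopic T x (p ++ w ++ rw (lwalk x p).1 w ++ v) (p ++ v).
Proof.
apply: (rev_walk_cancel (step := lstep T) (rel := link_relator T) (pr := fst) (ok := side_ok)) => //.
exact: link_relV.
Qed.

Lemma L_cancelV x p y w v : validL y w -> lwalk x p = lwalk y w ->
  link_homotopic T x (p ++ rw y.1 w ++ w ++ v) (p ++ v).
Proof.
apply: (rev_walk_cancelV hT (step := lstep T) (rel := link_relator T) (pr := fst) (ok := side_ok)) => //.
- exact: side_ok_inv.
- exact: lstepK.
- exact: link_relV.
Qed.

Lemma lwalk_rev x w : lwalk (lwalk x w) (rw x.1 w) = x.
Proof. by apply: (foldl_rev_walk (step := lstep T) (pr := fst)) => //; exact: lstepK. Qed.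

Lemma validL_rev x w : validL x w -> validL (lwalk x w) (rw x.1 w).
Proof.
apply: (valid_rev_walk (step := lstep T) (pr := fst)) => //; [exact: side_ok_inv|exact: lstepK].
Qed.

Definition lloop w := validL x0 w && (lwalk x0 w == x0).

Lemma lloop_cat u v : lloop u -> lloop v -> lloop (u ++ v).
Proof.
case/andP=> vu /eqP lu /andP[vv lv].
by rewrite /lloop valid_cat vu lu vv foldl_cat lu lv.
Qed.

Lemma lloop_rev u : lloop u -> lloop (rw x0.1 u).
Proof.
case/andP=> vu /eqP lu; have := validL_rev vu; have := lwalk_rev x0 u.
by rewrite /lloop lu => -> ->; rewrite eqxx.
Qed.

Definition loops : Type := {w : seq 'I_4 | lloop w}.
HB.instance Definition _ := Choice.on loops.

Definition lrel (u v : loops) : bool := `[< link_homotopic T x0 (val u) (val v) >].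

Lemma lrel_refl : reflexive lrel.
Proof. by move=> u; apply/asboolP; exact: htp_refl. Qed.
Lemma lrel_sym : symmetric lrel.
Proof. by move=> u v; apply/asboolP/asboolP; exact: htp_sym. Qed.
Lemma lrel_trans : transitive lrel.
Proof. by move=> v u w /asboolP h /asboolP h'; apply/asboolP; exact: htp_trans h h'. Qed.
Canonical lrel_equiv := EquivRel lrel lrel_refl lrel_sym lrel_trans.

Definition link_pi1 : Type := {eq_quot lrel_equiv}%qT.
HB.instance Definition _ := Choice.on link_pi1.

Definition Lmul (u v : loops) : loops := Sub (val u ++ val v) (lloop_cat (valP u) (valP v)).
Definition Linv (u : loops) : loops := Sub (rw x0.1 (val u)) (lloop_rev (valP u)).
Lemma lloop_nil : lloop [::]. Proof. by rewrite /lloop eqxx. Qed.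
Definition Lone : loops := Sub [::] lloop_nil.

Definition pil (u : loops) : link_pi1 := (\pi_({eq_quot lrel_equiv})%qT u)%qT.

Lemma pilP u v : pil u = pil v <-> link_homotopic T x0 (val u) (val v).
Proof.
split=> [/eqmodP /asboolP //|h]; apply/eqmodP; exact/asboolP.
Qed.

Lemma pil_repr (a : link_pi1) : pil (repr a) = a.
Proof. exact: reprK. Qed.

Definition pi1_mul (a b : link_pi1) : link_pi1 := pil (Lmul (repr a) (repr b)).
Definition pi1_inv (a : link_pi1) : link_pi1 := pil (Linv (repr a)).

Lemma repr_pil u : link_homotopic T x0 (val (repr (pil u))) (val u).
Proof. by apply/pilP; rewrite pil_repr. Qed.

Lemma pi1_mulE u v : pi1_mul (pil u) (pil v) = pil (Lmul u v).
Proof.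
apply/pilP; apply: htp_trans (homotopic_cat2r _ (repr_pil u)) _.
apply: homotopic_cat2l; case/andP: (valP u) => _ /eqP ->; exact: repr_pil.
Qed.

Lemma pi1_mulA : associative pi1_mul.
Proof.
move=> a b c; rewrite -(pil_repr a) -(pil_repr b) -(pil_repr c) !pi1_mulE.
by apply/pilP; rewrite /= catA; exact: htp_refl.
Qed.

Lemma pi1_mul1 : left_id (pil Lone) pi1_mul.
Proof. by move=> a; rewrite -(pil_repr a) pi1_mulE; apply/pilP; exact: htp_refl. Qed.
Lemma pi1_mul1r : right_id (pil Lone) pi1_mul.
Proof.
by move=> a; rewrite -(pil_repr a) pi1_mulE; apply/pilP; rewrite /= cats0; exact: htp_refl.
Qed.

Lemma pi1_mulV : left_inverse (pil Lone) pi1_inv pi1_mul.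
Proof.
move=> a; rewrite -{2}(pil_repr a) /pi1_inv pi1_mulE; apply/pilP => /=.
case/andP: (valP (repr a)) => vw /eqP lw.
by have := @L_cancelV x0 [::] x0 _ [::] vw (esym lw); rewrite cats0.
Qed.

Lemma pi1_mulVr : right_inverse (pil Lone) pi1_inv pi1_mul.
Proof.
move=> a; rewrite -{1}(pil_repr a) /pi1_inv pi1_mulE; apply/pilP => /=.
case/andP: (valP (repr a)) => vw /eqP lw.
by have := @L_cancel x0 [::] _ [::] vw; rewrite cats0.
Qed.
HB.instance Definition _ := isGroup.Build link_pi1 pi1_mulA pi1_mul1 pi1_mul1r pi1_mulV pi1_mulVr.

(** Words that are not loops receive the trivial class, which makes the function total. *)
Definition loop_class (w : seq 'I_4) : link_pi1 := pil (insubd Lone w).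

Lemma loop_classM u v : lloop u -> lloop v -> loop_class (u ++ v) = (loop_class u * loop_class v)%g.
Proof.
move=> lu lv; rewrite [RHS]pi1_mulE; apply/pilP; rewrite /= !val_insubd lu lv lloop_cat //.
exact: htp_refl.
Qed.

Lemma loop_class_homotopic u v : lloop u -> lloop v -> link_homotopic T x0 u v -> loop_class u = loop_class v.
Proof. by move=> lu lv h; apply/pilP; rewrite /= !val_insubd lu lv. Qed.

Lemma loop_class_eq1 u : lloop u -> loop_class u = 1%g -> link_homotopic T x0 u [::].
Proof. by move=> lu /pilP; rewrite /= val_insubd lu. Qed.

Lemma loop_class1 : loop_class [::] = 1%g.
Proof. by apply/pilP; rewrite val_insubd lloop_nil; exact: htp_refl. Qed.

Lemma loop_class_surj (a : link_pi1) : exists2 w, lloop w & a = loop_class w.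
Proof.
exists (val (repr a)); first exact: valP.
by rewrite -[LHS]pil_repr; apply/pilP; rewrite val_insubd (valP (repr a)); exact: htp_refl.
Qed.

Hypothesis hc : one_cusped T.

Lemma link_path y : exists w, validL x0 w /\ lwalk x0 w = y.
Proof.
case/connectP: (hc x0 y) => p + ->.
elim: p (x0) => [|z p IH] x /=; first by exists [::].
case/andP => /existsP[f /andP[fx /eqP xE]] /IH [w [vw lw]].
by exists (f :: w); rewrite /= xE lw vw /side_ok fx.
Qed.

Lemma link_paths : exists r : tet * 'I_4 -> seq 'I_4,
  [/\ forall y, validL x0 (r y), forall y, lwalk x0 (r y) = y & r x0 = [::]].
Proof.
have [r hr] := choice link_path.
exists (fun y => if y == x0 then [::] else r y); split=> [y|y|]; last by rewrite eqxx.
- by case: eqP => // _; case: (hr y).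
- by case: eqP => [->|_] //; case: (hr y).
Qed.

Section Paths.
Variable r : tet * 'I_4 -> seq 'I_4.
Hypotheses (rv : forall y, validL x0 (r y)) (rE : forall y, lwalk x0 (r y) = y).
Hypothesis r0 : r x0 = [::].

Local Notation rr y := (rw x0.1 (r y)).

Lemma rr_end y : lwalk y (rr y) = x0. Proof. by rewrite -{1}(rE y) lwalk_rev. Qed.
Lemma rr_valid y : validL y (rr y). Proof. by have := validL_rev (rv y); rewrite rE. Qed.

Lemma lloop_path x w : validL x w -> lloop (r x ++ w ++ rr (lwalk x w)).
Proof.
move=> vw; rewrite /lloop !valid_cat rv rE vw rr_valid /= !foldl_cat rE.
by rewrite rr_end eqxx.
Qed.

Definition side_class x f : link_pi1 := loop_class (r x ++ f :: rr (lstep T x f)).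

Fixpoint path_class x (w : seq 'I_4) : link_pi1 :=
  if w is f :: w' then (side_class x f * path_class (lstep T x f) w')%g else 1%g.

Lemma loop_class_path x w : validL x w -> loop_class (r x ++ w ++ rr (lwalk x w)) = path_class x w.
Proof.
elim: w x => [|f w IH] x vw.
  rewrite /= -loop_class1; apply: loop_class_homotopic; rewrite ?lloop_nil //=.
    exact: (lloop_path vw).
  by have := @L_cancel x0 [::] (r x) [::] (rv x); rewrite /= cats0.
move: (vw) => /= /andP[xf vw']; rewrite -IH // -loop_classM; last 2 first.
- by have := @lloop_path x [:: f]; rewrite /= xf => /(_ isT).
- exact: lloop_path.
apply: loop_class_homotopic; first exact: (lloop_path vw).
  rewrite lloop_cat ?lloop_path //.
  by have := @lloop_path x [:: f]; rewrite /= xf => /(_ isT).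
apply: htp_sym; rewrite -catA cat_cons -!cat_rcons.
by apply: L_cancelV; rewrite // rE foldl_rcons rE.
Qed.

Lemma path_class_loop w : lloop w -> path_class x0 w = loop_class w.
Proof. by case/andP => vw /eqP lw; rewrite -loop_class_path // lw r0 cats0. Qed.

Lemma path_class_relator x w : validL x w -> lwalk x w = x -> link_relator T x w ->
  path_class x w = 1%g.
Proof.
move=> vw lw rel; rewrite -loop_class_path // -loop_class1; apply: loop_class_homotopic; rewrite ?lloop_path ?lloop_nil // lw.
apply: htp_trans (_ : homotopic _ _ _ (r x ++ rr x) _).
  by apply: htp_rel; rewrite rE.
by have := @L_cancel x0 [::] (r x) [::] (rv x); rewrite /= cats0.
Qed.

Lemma side_classV x f : f != x.2 -> side_class (lstep T x f) (gp x.1 f f) = ((side_class x f)^-1)%g.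
Proof.
move=> fx; have ok1 : side_ok x f by [].
have := @path_class_relator x [:: f; gp x.1 f f].
rewrite /= lstepK ok1 side_ok_inv // mulg1 => /(_ isT erefl (link_relV ok1)) h.
by apply: (mulgI (side_class x f)); rewrite h mulgV.
Qed.

(** Noncommutative counterpart of [flag_potential]: the word of a full turn around a vertex of the
    link is a relator there. *)
Lemma link_flag_potential : exists k : flag n -> link_pi1,
  forall d, k d = (side_class (fsrc d) (fr d o2) * k (fnxt (fopp hT d)))%g.
Proof.
pose s (x : tet * 'S_4) := (x.1, x.2 o0).
have [k hk] : exists k : tet * 'S_4 -> link_pi1,
    forall x, k (turn T x) = ((side_class (s x) (x.2 o2))^-1 * k x)%g.
  apply: (@orbit_potential _ _ (turn T) (fun x y => ((side_class (s x) (x.2 o2))^-1 * y)%g) 1%g (turn_inj hT)).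
  move=> x.
  have gen m y : [/\ validL (s y) [seq (z : tet * 'S_4).2 o2 | z <- traject (turn T) y m],
      lwalk (s y) [seq (z : tet * 'S_4).2 o2 | z <- traject (turn T) y m] = s (iter m (turn T) y)
      & forall b, (foldl (fun b (x : tet * 'S_4) => (side_class (s x) (x.2 o2))^-1 * b) b
           (traject (turn T) y m) =
         (path_class (s y) [seq (z : tet * 'S_4).2 o2 | z <- traject (turn T) y m])^-1 * b)%g].
    elim: m y => [|m IH] y; first by split=> //= b; rewrite invg1 mul1g.
    have sE : lstep T (s y) (y.2 o2) = s (turn T y).
      by rewrite /lstep /s /turn /= !permM tpermE4.
    case: (IH (turn T y)) => h1 h2 h3; split.
    - by rewrite /= sE h1 /side_ok /s /= (inj_eq perm_inj).
    - by rewrite iterSr -h2 /= sE.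
    - by move=> b; rewrite /= sE h3 invgM mulgA.
  case: (gen (fingraph.order (turn T) x) x) => h1 h2 h3.
  rewrite /orbit h3 mulg1 path_class_relator ?invg1 //.
    by rewrite h2 iter_order //; exact: turn_inj.
  by right; exists x.2; case: x {h1 h2 h3}.
exists (fun d => k (val d)) => d.
by rewrite -turn_val hk mulKVg.
Qed.

Hypothesis ht : torus_link T.

(** The theorem on surfaces makes the side classes commute only after the change of lifts [u]. A
    loop at [x0] is a product of such modified classes, conjugated by [u x0]. *)
Lemma link_pi1_abelian (a b : link_pi1) : commute a b.
Proof.
have [k hk] := link_flag_potential.
have gV (d : flag n) : side_class (fsrc (fopp hT d)) (fr (fopp hT d) o2) = ((side_class (fsrc d) (fr d o2))^-1)%g.
  by have [_ _ _ -> _] := fr_opp hT d; rewrite fsrc_opp side_classV //= (inj_eq perm_inj).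
have euler : (#|{: tet * 'I_4}| <= 2 * #|[set fvert hT d | d : flag n]%SET|)%N.
  have -> : [set fvert hT d | d : flag n]%SET = [set: vert T]%SET.
    by apply/setP => v; rewrite inE; case: (fvert_surj hT v) => d <-; rewrite imset_f.
  rewrite cardsT card_vert // card_prod !card_ord; lia.
have [u hu] := @genus_one_commute _ _ _ _ (fopp hT) (@fnxt n) (@fsrc n) (fvert hT)
  (fun d => side_class (fsrc d) (fr d o2)) k (foppK hT) (fopp_neq hT) gV (@fnxt3 n) (@fnxt_neq n)
  (@fsrc_nxt n) (@fsrc_fiber n) (@fsrc_surj n) (fvert_turn hT) hk (@fsrc_conn _ _ hT hc) euler.
(* What commutes with all modified side classes commutes with modified path classes; this is applied
   once to each of the two loops. *)
have main z x w : validL x w ->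
  (forall d : flag n, commute z (u (fsrc d) * side_class (fsrc d) (fr d o2) * (u (fsrc (fopp hT d)))^-1)%g) ->
  commute z (u x * path_class x w * (u (lwalk x w))^-1)%g.
  move=> + zc; elim: w x => [|f w IH] x /=; first by rewrite mulg1 mulgV => _; exact: commute1.
  case/andP => fx vw.
  have -> : (u x * (side_class x f * path_class (lstep T x f) w) / u (lwalk (lstep T x f) w) =
    (u x * side_class x f * (u (lstep T x f))^-1) *
    (u (lstep T x f) * path_class (lstep T x f) w / u (lwalk (lstep T x f) w)))%g.
    by rewrite !mulgA mulgVK.
  apply: commuteM; last exact: IH.
  case: x fx {vw} => j v fx; case: (cr_surj j fx) => d [h1 h2 h3].
  by have := zc d; rewrite fsrc_opp /fsrc h1 h2 h3.
have [wa la ->] := loop_class_surj a; have [wb lb ->] := loop_class_surj b.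
rewrite -!path_class_loop //.
have /andP[va /eqP ea] := la; have /andP[vb /eqP eb] := lb.
have := main (u x0 * path_class x0 wa * (u x0)^-1)%g x0 wb vb; rewrite eb.
have h d : commute (u x0 * path_class x0 wa / u x0)
  (u (fsrc d) * side_class (fsrc d) (fr d o2) / u (fsrc (fopp hT d))).
  apply/commute_sym; have := main _ _ _ va (hu d); rewrite ea; exact.
move=> /(_ h); rewrite /commute !mulgA !mulgVK -!mulgA => /mulgI; rewrite !mulgA.
by move/mulIg.
Qed.

Lemma path_class_flags d ds : path [rel d d' : flag n | fsrc (fopp hT d) == fsrc d'] d ds ->
  [/\ validL (fsrc d) [seq fr x o2 | x <- d :: ds],
      lwalk (fsrc d) [seq fr x o2 | x <- d :: ds] = fsrc (fopp hT (last d ds))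
    & path_class (fsrc d) [seq fr x o2 | x <- d :: ds] =
      (\prod_(x <- d :: ds) side_class (fsrc x) (fr x o2))%g].
Proof.
have okd y : side_ok (fsrc y) (fr y o2) by rewrite /side_ok (inj_eq perm_inj).
elim: ds d => [|d' ds IH] d.
  by move=> _; split; rewrite /= ?big_seq1 ?mulg1 ?okd // fsrc_opp.
rewrite /= -[lstep _ _ _]fsrc_opp => /andP[/eqP E /IH [h1 h2 h3]]; split.
- by rewrite E okd.
- by rewrite E -h2.
- by rewrite big_cons -h3 E.
Qed.

End Paths.

(** Commutativity turns the fundamental group into a [zmodType], and the ordered product of side
    classes along the curve into a sum, to which [null_sum] applies. *)
Lemma null_homologous_contractible (ht : torus_link T) d ds (H : vert T -> int) :
  x0 = fsrc d ->
  path.cycle [rel d d' : flag n | fsrc (fopp hT d) == fsrc d'] (d :: ds) ->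
  (forall y, (count_mem y (d :: ds))%:Z - (count_mem (fopp hT y) (d :: ds))%:Z =
     H (fvert hT y) - H (fvert hT (fnxt y))) ->
  link_homotopic T x0 [seq fr x o2 | x <- d :: ds] [::].
Proof.
move=> x0E; rewrite /= rcons_path => /andP[pds /eqP lds] hH.
have [r [rv rE r0]] := link_paths.
have ab := link_pi1_abelian rv rE r0 ht.
pose Z : zmodType := HB.pack link_pi1
  (GRing.isZmodule.Build link_pi1 (@mulgA link_pi1) ab (@mul1g link_pi1) (@mulVg link_pi1)).
have [k hk] := link_flag_potential rv rE.
have [h1 h2 h3] := path_class_flags r pds.
have ll : lloop [seq fr x o2 | x <- d :: ds].
  by rewrite /lloop x0E h1 h2 lds eqxx.
apply: loop_class_eq1 => //; rewrite -(path_class_loop rv rE r0 ll) x0E h3.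
pose g (x : flag n) : Z := side_class r (fsrc x) (fr x o2).
rewrite -[LHS](_ : \sum_(x <- d :: ds) g x = _); last first.
  by elim: (d :: ds) => [|y s IH]; rewrite ?big_nil // !big_cons IH.
apply: (@null_sum _ Z (fopp hT) (fun x => fnxt (fopp hT x)) g k (fun y => H (fvert hT y))).
- exact: foppK.
- exact: fopp_neq.
- by apply: inj_comp; [exact: fnxt_inj|exact: (can_inj (foppK hT))].
- move=> y; rewrite /g; have [_ _ _ -> _] := fr_opp hT y.
  by rewrite fsrc_opp side_classV //= (inj_eq perm_inj).
- by move=> y; rewrite /g [X in X - _]hk; exact: (esym (mulgK _ _)).
- by move=> y; rewrite fvert_turn.
- by move=> y; rewrite hH -[in fvert hT (fopp hT y)](fvert_turn hT (fopp hT y)) foppK.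
Qed.

End LinkGroup.

(** * Simple curves *)

Section Separation.
Variables (v w f g : 'I_4) (al be : rat).
Hypothesis vwfg : forall a : 'I_4, [\/ a = v, a = w, a = f | a = g].
Hypotheses (al01 : 0 < al < 1) (be01 : 0 < be < 1).

(* Positive, negative or zero according to the position of [x] with respect to the
   line through the points of weight [al] and [be] at [w] of the sides [w g] and
   [w f]. *)
Definition line_form (x : 'I_4 -> rat) : rat :=
  x w * (1 - al) * (1 - be) - al * (1 - be) * x g - be * (1 - al) * x f.

(** The segment [P Q] joins two sides, so it is the whole intersection of its line with the
    triangle; the point where [U V] meets the line therefore lies on it. *)
Lemma segments_meet (P Q U V : 'I_4 -> rat) :
  P v = 0 -> P f = 0 -> P w = al -> P g = 1 - al ->
  Q v = 0 -> Q g = 0 -> Q w = be -> Q f = 1 - be ->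
  U v = 0 -> (forall a, 0 <= U a) -> U w + U f + U g = 1 ->
  V v = 0 -> (forall a, 0 <= V a) -> V w + V f + V g = 1 ->
  line_form U * line_form V <= 0 ->
  exists s t, [/\ 0 <= s <= 1, 0 <= t <= 1 &
    forall a, (1 - s) * P a + s * Q a = (1 - t) * U a + t * V a].
Proof.
case/andP: al01 => a0 a1; case/andP: be01 => b0 b1.
move=> Pv Pf Pw Pg Qv Qg Qw Qf Uv U0 U1 Vv V0 V1 le0.
(* The affine function [line_form] vanishes at parameter [t] of the segment [U V]. *)
have [t t01 tE] : exists2 t, 0 <= t <= 1 & (1 - t) * line_form U + t * line_form V = 0.
  have [u0|u0] := eqVneq (line_form U) 0.
    by exists 0; rewrite ?lexx ?ler01 // u0; ring.
  have ne : line_form U - line_form V != 0.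
    by apply/eqP => E; move: le0 u0; rewrite (_ : line_form V = line_form U); [nra|lra].
  exists (line_form U / (line_form U - line_form V)); last by field.
  have [up|un] := ltP 0 (line_form U).
    have vn : line_form V <= 0 by nra.
    by rewrite divr_ge0 ?ler_pdivrMr; lra.
  have {}un : line_form U < 0 by lra.
  have vn : 0 <= line_form V by nra.
  rewrite -mulrNN -invrN divr_ge0 ?ler_pdivrMr; lra.
pose Y a := (1 - t) * U a + t * V a.
case/andP: t01 => t0 t1.
have Y0 a : 0 <= Y a by have := U0 a; have := V0 a; rewrite /Y; nra.
have Yv : Y v = 0 by rewrite /Y Uv Vv; ring.
have Y1 : Y w + Y f + Y g = 1.
  have -> : Y w + Y f + Y g = (1 - t) * (U w + U f + U g) + t * (V w + V f + V g).
    by rewrite /Y; ring.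
  by rewrite U1 V1; ring.
have YL : line_form Y = 0.
  by rewrite -tE /line_form /Y; ring.
(* The parameter on [P Q] is read off the coordinate at [f], which is 0 at [P] and [1 - be] at
   [Q]. *)
pose s := Y f / (1 - be).
have sE : Y f = s * (1 - be) by rewrite /s divfK //; lra.
have s0 : 0 <= s by apply: divr_ge0; [exact: Y0|lra].
have gE : Y g = (1 - al) * (1 - s).
  have b2 : 1 - be != 0 by lra.
  apply: (mulIf b2); move: YL; rewrite /line_form sE.
  have -> : Y w = 1 - Y f - Y g by lra.
  by rewrite sE => YL; lra.
have s1 : s <= 1 by have := Y0 g; rewrite gE; nra.
exists s, t; split; rewrite ?s0 ?t0 //; move=> a; rewrite -/(Y a).
case: (vwfg a) => ->.
- by rewrite Pv Qv Yv; ring.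
- rewrite Pw Qw (_ : Y w = 1 - Y f - Y g); last by lra.
  by rewrite sE gE; ring.
- by rewrite Pf Qf sE; ring.
- by rewrite Pg Qg gE; ring.
Qed.

Lemma line_form_wf (y : 'I_4 -> rat) : y g = 0 -> y w + y f = 1 ->
  (0 < line_form y) = (be < y w).
Proof.
move=> yg y1; have -> : line_form y = (1 - al) * (y w - be).
  by rewrite /line_form yg (_ : y f = 1 - y w); [ring|lra].
by case/andP: al01 => *; case/andP: be01 => *; rewrite pmulr_rgt0 ?subr_gt0.
Qed.

Lemma line_form_wg (y : 'I_4 -> rat) : y f = 0 -> y w + y g = 1 ->
  (0 < line_form y) = (al < y w).
Proof.
move=> yg y1; have -> : line_form y = (1 - be) * (y w - al).
  by rewrite /line_form yg (_ : y g = 1 - y w); [ring|lra].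
by case/andP: al01 => *; case/andP: be01 => *; rewrite pmulr_rgt0 ?subr_gt0.
Qed.

Lemma line_form_fg (y : 'I_4 -> rat) : y w = 0 -> 0 < y f -> 0 < y g ->
  (0 < line_form y) = false.
Proof.
move=> yw yf yg; rewrite /line_form yw; case/andP: al01 => *; case/andP: be01 => *.
have : 0 < al * (1 - be) * y g by rewrite !mulr_gt0 //; lra.
have : 0 < be * (1 - al) * y f by rewrite !mulr_gt0 //; lra.
by move=> *; apply/negbTE; rewrite -leNgt; lra.
Qed.
End Separation.

Section SimpleCurve.
Variables (n : nat) (T : gluing n).
Hypothesis hT : oriented_gluing T.
Local Notation gp := (glue_perm T).
Variables (K : finType) (prd : K -> K) (d : K -> flag n) (x : K -> 'I_4 -> rat).
Hypothesis prd_inj : injective prd.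
Hypothesis prd_conn : forall i k, fconnect prd i k.
(** The arc [i] enters its triangle through the side [e i], at the point [xin i], and leaves it
    through the side [d i], at the point [x i]; both sides are seen from that triangle. *)
Let e i := fopp hT (d (prd i)).
Hypothesis d_step : forall i, fsrc (d i) = fsrc (e i).
Hypothesis d_normal : forall i, d i != e i.
Definition on_side (q : flag n) (y : 'I_4 -> rat) : Prop :=
  [/\ y (fr q o0) = 0, y (fr q o2) = 0, 0 < y (fr q o1), 0 < y (fr q o3)
    & y (fr q o1) + y (fr q o3) = 1].
Hypothesis x_side : forall i, on_side (d i) (x i).
Let xin i a := x (prd i) ((gp (ft (d (prd i))) (fr (d (prd i)) o2))^-1%g a).
Hypothesis x_disj : forall i k, i != k -> fsrc (d i) = fsrc (d k) ->
  forall s t, 0 <= s <= 1 -> 0 <= t <= 1 ->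
  ~ (forall a, (1 - s) * xin i a + s * x i a = (1 - t) * xin k a + t * x k a).

Lemma xin_side i : on_side (e i) (xin i).
Proof.
have [h0 h2 h1 h3 hs] := x_side (prd i).
have [_ k0 k1 k2 k3] := fr_opp hT (d (prd i)).
by rewrite /on_side /xin /e k0 k1 k2 k3 !permK; split=> //; rewrite addrC.
Qed.

Lemma flag_corners (q : flag n) a :
  [\/ a = fr q o0, a = fr q o1, a = fr q o2 | a = fr q o3].
Proof.
rewrite -[a](permKV (fr q)); case: (ord4E ((fr q)^-1%g a)) => ->;
  [exact: Or41|exact: Or42|exact: Or43|exact: Or44].
Qed.

Lemma on_side_nxt q y : on_side (fnxt q) y ->
  [/\ y (fr q o0) = 0, y (fr q o1) = 0, 0 < y (fr q o3), 0 < y (fr q o2)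
    & y (fr q o3) + y (fr q o2) = 1].
Proof. by have [_ k0 k1 k2 k3] := fr_nxt q; rewrite /on_side k0 k1 k2 k3. Qed.

Lemma on_side_nxt2 q y : on_side (fnxt (fnxt q)) y ->
  [/\ y (fr q o0) = 0, y (fr q o3) = 0, 0 < y (fr q o2), 0 < y (fr q o1)
    & y (fr q o2) + y (fr q o1) = 1].
Proof.
move/on_side_nxt; have [_ k0 k1 k2 k3] := fr_nxt q.
by rewrite k0 k1 k2 k3.
Qed.

Let b2z (b : bool) : int := (b : nat)%:Z.

(* The arc [i] cuts off the corner [w], and every other arc of the triangle lies on one
   side of it: both its ends are counted, or none. *)
Lemma arc_separates i (w f g : 'I_4) (q := d i) (v := fr q o0) :
  (forall a, [\/ a = v, a = w, a = f | a = g]) ->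
  (forall y, on_side q y -> [/\ y g = 0, 0 < y w, 0 < y f & y w + y f = 1]) ->
  (forall y, on_side (e i) y -> [/\ y f = 0, 0 < y w, 0 < y g & y w + y g = 1]) ->
  (forall p y, fsrc p = fsrc q -> p != q -> p != e i -> on_side p y ->
     [/\ y w = 0, 0 < y f, 0 < y g & y f + y g = 1]) ->
  \sum_k (b2z ((d k == q) && (x i w < x k w)) + b2z ((d k == e i) && (xin i w < x k w))
    - (b2z ((e k == q) && (x i w < xin k w)) + b2z ((e k == e i) && (xin i w < xin k w)))) = 0.
Proof.
move=> allv Hq He Hr.
have [Qg Qw Qf Q1] := Hq _ (x_side i); have [Pf Pw Pg P1] := He _ (xin_side i).
pose LF := line_form w f g (xin i w) (x i w).
have al01 : 0 < xin i w < 1 by apply/andP; split; lra.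
have be01 : 0 < x i w < 1 by apply/andP; split; lra.
have v0 p y : fsrc p = fsrc q -> on_side p y -> y v = 0.
  by case=> _ pv []; rewrite pv.
have posy p y : fsrc p = fsrc q -> on_side p y -> (forall a, 0 <= y a) /\ y w + y f + y g = 1.
  move=> pq py; have yv := v0 _ _ pq py.
  have [pE|npq] := eqVneq p q.
    have [|h1 h2 h3 h4] := Hq y; first by rewrite -pE.
    by split=> [a|]; [case: (allv a) => ->; lra|lra].
  have [pE|npe] := eqVneq p (e i).
    have [|h1 h2 h3 h4] := He y; first by rewrite -pE.
    by split=> [a|]; [case: (allv a) => ->; lra|lra].
  have [h1 h2 h3 h4] := Hr p y pq npq npe py.
  by split=> [a|]; [case: (allv a) => ->; lra|lra].
have near p y : fsrc p = fsrc q -> on_side p y ->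
    b2z ((p == q) && (x i w < y w)) + b2z ((p == e i) && (xin i w < y w)) = b2z (0 < LF y).
  move=> pq py; have [pE|npq] := eqVneq p q.
    have [|h1 h2 h3 h4] := Hq y; first by rewrite -pE.
    by rewrite pE (negPf (d_normal i)) /b2z /= addr0 /LF line_form_wf.
  have [pE|npe] := eqVneq p (e i).
    have [|h1 h2 h3 h4] := He y; first by rewrite -pE.
    by rewrite /b2z /= add0r /LF line_form_wg.
  have [h1 h2 h3 h4] := Hr p y pq npq npe py.
  by rewrite /LF line_form_fg.
rewrite big1 // => k _.
have [sk|nsk] := eqVneq (fsrc (d k)) (fsrc q); last first.
  have nz p : fsrc p = fsrc (d k) -> (p == q) = false /\ (p == e i) = false.
    by move=> pk; split; apply/negbTE; apply: contra nsk => /eqP pE; rewrite -pk pE // -d_step.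
  have [-> ->] := nz _ erefl; have [-> ->] := nz _ (esym (d_step k)).
  by rewrite /b2z.
have [ki|nki] := eqVneq k i.
  have ni : (d i == e i) = false := negPf (d_normal i).
  have ni' : (e i == d i) = false by rewrite eq_sym.
  by rewrite ki /q ni ni' !eqxx !ltxx.
have ek : fsrc (e k) = fsrc q by rewrite -d_step.
rewrite (near _ _ sk (x_side k)) (near _ _ ek (xin_side k)).
have [U0 U1] := posy _ _ ek (xin_side k); have [V0 V1] := posy _ _ sk (x_side k).
have dik : fsrc (d i) = fsrc (d k) by rewrite sk.
have nik : i != k by rewrite eq_sym.
(* If the ends of arc [k] were not strictly on the same side of arc [i], the two segments would
   meet. *)
have [le0|gt0] := leP (LF (xin k) * LF (x k)) 0.
  have sei : fsrc (e i) = fsrc q by rewrite -d_step.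
  have Pg' : xin i g = 1 - xin i w by lra.
  have Qf' : x i f = 1 - x i w by lra.
  have [s [t [s01 t01 st]]] := segments_meet allv al01 be01
    (v0 _ _ sei (xin_side i)) Pf erefl Pg' (v0 _ _ erefl (x_side i)) Qg erefl Qf'
    (v0 _ _ ek (xin_side k)) U0 U1 (v0 _ _ sk (x_side k)) V0 V1 le0.
  by case: (x_disj nik dik s01 t01 st).
apply/eqP; rewrite subr_eq0; apply/eqP; congr b2z; apply/idP/idP; nra.
Qed.

(* Signed numbers of the crossings of the side [f] beyond the position [th], towards
   its initial corner [o1] and its final corner [o3] respectively. *)
Definition beyond1 (f : flag n) (th : rat) : int :=
  \sum_k (b2z ((d k == f) && (th < x k (fr (d k) o1)))
         - b2z ((fopp hT (d k) == f) && (th < x k (fr (d k) o3)))).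
Definition beyond3 (f : flag n) (th : rat) : int :=
  \sum_k (b2z ((d k == f) && (th < x k (fr (d k) o3)))
         - b2z ((fopp hT (d k) == f) && (th < x k (fr (d k) o1)))).

Lemma foppE p q : (fopp hT p == q) = (p == fopp hT q).
Proof. by apply/eqP/eqP => [<-|->]; rewrite foppK. Qed.

Lemma beyond1_opp f th : beyond1 (fopp hT f) th = - beyond3 f th.
Proof.
rewrite /beyond1 /beyond3 -sumrN; apply: eq_bigr => k _.
by rewrite opprB -foppE (inj_eq (can_inj (foppK hT))).
Qed.

Lemma beyond1_arcs f th : beyond1 f th = \sum_k (b2z ((d k == f) && (th < x k (fr f o1)))
         - b2z ((e k == f) && (th < xin k (fr f o1)))).
Proof.
rewrite /beyond1 big_split sumrN /= [X in _ - X](reindex_inj prd_inj) -sumrN -big_split /=.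
apply: eq_bigr => k _; congr (b2z _ - b2z _).
  by case: eqP => // <-.
rewrite -/(e k); case: eqP => //= <-; have [_ _ k1 _ _] := fr_opp hT (d (prd k)).
by rewrite /xin /e k1 permK.
Qed.

Lemma beyond3_arcs f th : beyond3 f th = \sum_k (b2z ((d k == f) && (th < x k (fr f o3)))
         - b2z ((e k == f) && (th < xin k (fr f o3)))).
Proof.
rewrite /beyond3 big_split sumrN /= [X in _ - X](reindex_inj prd_inj) -sumrN -big_split /=.
apply: eq_bigr => k _; congr (b2z _ - b2z _).
  by case: eqP => // <-.
rewrite -/(e k); case: eqP => //= <-; have [_ _ _ _ k1] := fr_opp hT (d (prd k)).
by rewrite /xin /e k1 permK.
Qed.

(** The sides [e i] and [d i] share the corner cut off by the arc [i]. By [arc_separates] the signed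
    crossings between the arc and this corner cancel over the two sides, and the sign of the side
    [e i] changes when it is seen from the previous triangle. The two cases tell on which side of
    the curve the corner lies. *)
Lemma beyond_step i : e i = fnxt (d i) /\
    beyond3 (d i) (x i (fr (d i) o3)) = beyond3 (d (prd i)) (x (prd i) (fr (d (prd i)) o3)) \/
  e i = fnxt (fnxt (d i)) /\
    beyond1 (d i) (x i (fr (d i) o1)) = beyond1 (d (prd i)) (x (prd i) (fr (d (prd i)) o1)).
Proof.
have ce := flag_corners (d i).
have [_ _ k1 _ k3] := fr_opp hT (d (prd i)).
have [_ p0 p1 p2 p3] := fr_nxt (d i).
have [_ q0 q1 q2 q3] := fr_nxt (fnxt (d i)).
have StP th : beyond3 (d (prd i)) th = - beyond1 (e i) th by rewrite beyond1_opp opprK.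
have SsP th : beyond1 (d (prd i)) th = - beyond3 (e i) th by rewrite -beyond1_opp foppK.
have [E|E|E] := fsrc_fiber (esym (d_step i)).
- by have := d_normal i; rewrite E eqxx.
- left; split=> //; apply/eqP; rewrite -subr_eq0 StP opprK.
  have -> : x (prd i) (fr (d (prd i)) o3) = xin i (fr (d i) o3).
    by rewrite -p1 -E /xin /e k1 permK.
  have ew : fr (e i) o1 = fr (d i) o3 by rewrite E.
  rewrite beyond3_arcs beyond1_arcs ew -big_split /=; apply/eqP.
  rewrite -[RHS](@arc_separates i (fr (d i) o3) (fr (d i) o1) (fr (d i) o2)).
  + apply: eq_bigr => k _; lia.
  + by move=> a; case: (ce a); [exact: Or41|exact: Or43|exact: Or44|exact: Or42].
  + by move=> y [h0 h2 h1 h3 hs]; split=> //; rewrite addrC.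
  + by move=> y; rewrite E => /on_side_nxt [h0 h1 h3 h2 hs].
  + move=> p y /fsrc_fiber [->|->|->]; rewrite ?eqxx // E ?eqxx // => _ _.
    by move/on_side_nxt2 => [h0 h1 h3 h2 hs]; split=> //; rewrite addrC.
- right; split=> //; apply/eqP; rewrite -subr_eq0 SsP opprK.
  have -> : x (prd i) (fr (d (prd i)) o1) = xin i (fr (d i) o1).
    by rewrite -p2 -q3 -E /xin /e k3 permK.
  have ew : fr (e i) o3 = fr (d i) o1 by rewrite E q3 p2.
  rewrite beyond3_arcs beyond1_arcs ew -big_split /=; apply/eqP.
  rewrite -[RHS](@arc_separates i (fr (d i) o1) (fr (d i) o3) (fr (d i) o2)).
  + apply: eq_bigr => k _; lia.
  + by move=> a; case: (ce a); [exact: Or41|exact: Or42|exact: Or44|exact: Or43].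
  + by move=> y [h0 h2 h1 h3 hs]; split.
  + by move=> y; rewrite E => /on_side_nxt2 [h0 h1 h3 h2 hs]; split=> //; rewrite addrC.
  + move=> p y /fsrc_fiber [->|->|->]; rewrite ?eqxx // E ?eqxx // => _ _.
    by move/on_side_nxt => [h0 h1 h3 h2 hs]; split=> //; rewrite addrC.
Qed.

Lemma crossings_distinct i k : i != k ->
  (d k = d i -> x k (fr (d k) o1) != x i (fr (d i) o1)) /\
  (fopp hT (d k) = d i -> x k (fr (d k) o3) != x i (fr (d i) o1)).
Proof.
have [h0 h2 h1 h3 hs] := x_side i.
move=> ik; split=> E; apply/eqP => X.
  have [k0 k2 k1 k3 ks] := x_side k; have s1 : fsrc (d i) = fsrc (d k) by rewrite E.
  case: (x_disj ik s1 (s := 1) (t := 1)); rewrite ?ler01 ?lexx // => a.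
  rewrite !subrr !mul0r !add0r !mul1r; rewrite E in k0 k1 k2 k3 ks X.
  by case: (flag_corners (d i) a) => ->; lra.
(* Here [k] crosses the side the other way, so the arc lying in the triangle of [i] is [k'], which
   starts at [k]: its start is compared with the end of [i]. *)
pose k' := finv prd k; have k'E : prd k' = k by rewrite /k' f_finv.
have ik' : i != k'.
  by apply/eqP => ii; have := d_normal i; rewrite {2}ii /e k'E E eqxx.
have ek' : e k' = d i by rewrite /e k'E.
have [k0 k2 k1 k3 ks] := xin_side k'; have s1 : fsrc (d i) = fsrc (d k').
  by rewrite (d_step k') ek'.
have X' : xin k' (fr (d i) o1) = x i (fr (d i) o1).
  have [_ _ p1 _ _] := fr_opp hT (d k).
  by rewrite -X -[in LHS]E p1 /xin k'E permK.
case: (x_disj ik' s1 (s := 1) (t := 0)); rewrite ?ler01 ?lexx // => a.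
rewrite subrr subr0 !mul0r !mul1r add0r addr0; rewrite ek' in k0 k1 k2 k3 ks.
by case: (flag_corners (d i) a) => ->; lra.
Qed.

Variables (c : rat) (h : vert T -> rat) (kp : flag n -> int).
Let I (f : flag n) : int := \sum_k (b2z (d k == f) - b2z (fopp hT (d k) == f)).
Hypothesis I_eq : forall f, (I f)%:~R = c * (kp f)%:~R + (h (fvert hT f) - h (fvert hT (fnxt f))).

Let cong (a b : rat) := exists m : int, a - b = c * m%:~R.

Lemma cong_refl a : cong a a.
Proof. by exists 0; rewrite subrr mulr0. Qed.
Lemma cong_sym a b : cong a b -> cong b a.
Proof. by case=> m E; exists (- m); rewrite rmorphN mulrN -E opprB. Qed.
Lemma cong_trans b a a' : cong a b -> cong b a' -> cong a a'.
Proof.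
case=> m E [m' E']; exists (m + m').
by rewrite rmorphD mulrDr -E -E' addrA subrK.
Qed.

(** Distinct crossings of a side occur at distinct points, so each of the others lies beyond [i] in
    exactly one direction; the final 1 is [i] itself. *)
Lemma I_split i : I (d i) = beyond1 (d i) (x i (fr (d i) o1)) + beyond3 (d i) (x i (fr (d i) o3)) + 1.
Proof.
rewrite /I /beyond1 /beyond3 -big_split /= !(bigD1 (P := predT) i) //= eqxx !ltxx.
rewrite (negPf (fopp_neq hT (d i))) /= /b2z /= !subrr !add0r subr0 addrC.
have key (a a' b b' : rat) : a + a' = 1 -> b + b' = 1 -> b != a ->
    b2z (a < b) + b2z (a' < b') = 1.
  move=> aa bb; have -> : (a' < b') = (b < a) by apply/idP/idP; lra.
  by case: (ltgtP a b) => //= ->; rewrite eqxx.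
congr (_ + _); apply: eq_bigr => k ki; have ik : i != k by rewrite eq_sym.
have [n1 n2] := crossings_distinct ik.
have [_ _ _ _ sum_i] := x_side i; have [_ _ _ _ sum_k] := x_side k.
have [E|NE] := eqVneq (d k) (d i).
  have := key _ _ _ _ sum_i sum_k (n1 E).
  by rewrite E (negPf (fopp_neq hT (d i))) /b2z /=; lia.
have [E|NE'] //= := eqVneq (fopp hT (d k)) (d i).
have sum_k' : x k (fr (d k) o3) + x k (fr (d k) o1) = 1 by rewrite addrC.
by have := key _ _ _ _ sum_i sum_k' (n2 E); rewrite /b2z /=; lia.
Qed.

Let hs f := h (fvert hT f).
Let ht f := h (fvert hT (fnxt f)).
(** Subtracting the crossings met on the way from the initial vertex of a side extends [h], modulo
    [c], to the complement of the curve on that side. [L i] is the value just before crossing [i];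
    just after it the value is [L i - 1]. *)
Let L i := hs (d i) - (beyond1 (d i) (x i (fr (d i) o1)))%:~R.

Lemma ht_opp f : ht f = hs (fopp hT f).
Proof. by rewrite /ht /hs -[in RHS](fvert_turn hT (fopp hT f)) foppK. Qed.

Lemma hs_opp f : ht (fopp hT f) = hs f.
Proof. by rewrite ht_opp foppK. Qed.

Lemma I_cong f : cong (hs f - (I f)%:~R) (ht f).
Proof. by exists (- kp f); rewrite I_eq rmorphN /hs /ht; ring. Qed.

Lemma L_far i : cong (L i) (ht (d i) + (beyond3 (d i) (x i (fr (d i) o3)))%:~R + 1).
Proof.
have := I_cong (d i); rewrite I_split !rmorphD /= => -[m E]; exists m.
by rewrite -E /L; ring.
Qed.

(** Both crossings are compared with the vertex at the corner cut off by the arc, directly if it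
    lies on the side of the curve where [L] is taken, through [L_far] otherwise. *)
Lemma L_step i : cong (L i) (L (prd i)).
Proof.
case: (beyond_step i) => -[E S].
  apply: (cong_trans (L_far i)); apply: cong_sym; apply: (cong_trans (L_far _)).
  by rewrite S ht_opp -/(e i) E; exact: cong_refl.
rewrite /L S; have -> : hs (d i) = hs (d (prd i)); last exact: cong_refl.
by rewrite -[RHS]hs_opp -/(e i) E /ht fnxt3.
Qed.

Lemma L_const i k : cong (L i) (L k).
Proof.
have := iter_findex (prd_conn i k); move: (findex prd i k) => m; elim: m k => [|m IH] k /=.
  by move=> ->; exact: cong_refl.
move=> <-; apply: cong_trans (IH _ erefl) _; exact: L_step.
Qed.

Variable i0 : K.
Hypothesis c_inv : forall m : int, c * m%:~R != 1.

Lemma color_exit f k : d k = f ->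
  cong (hs f - (beyond1 f (x k (fr (d k) o1)))%:~R) (L i0).
Proof. by move=> <-; exact: L_const. Qed.

Lemma color_enter f k : fopp hT (d k) = f ->
  cong (hs f - (beyond1 f (x k (fr (d k) o3)))%:~R + 1) (L i0).
Proof.
move=> E; apply: cong_trans (L_const k i0); apply: cong_sym.
apply: (cong_trans (L_far k)); rewrite ht_opp E -E beyond1_opp rmorphN /= opprK.
exact: cong_refl.
Qed.

(** The curve separates the class of [L i0] from that of [L i0 - 1], and these differ because 1 is
    not a multiple of [c]. A positive crossing thus lowers the colour by one, which makes an
    integral function out of the rational [h]. *)
Let color (y : rat) : int := if `[< cong y (L i0) >] then 0 else -1.

Lemma color_cong y y' : cong y y' -> color y = color y'.
Proof.
move=> E; rewrite /color; congr (if _ then _ else _).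
apply/asboolP/asboolP => h'; [exact: cong_trans (cong_sym E) h'|exact: cong_trans E h'].
Qed.

Lemma color_eq0 y : cong y (L i0) -> color y = 0.
Proof. by move=> h'; rewrite /color; case: asboolP. Qed.

Lemma color_eqN1 y : cong (y + 1) (L i0) -> color y = -1.
Proof.
move=> h'; rewrite /color; case: asboolP => // h''.
case: (cong_trans h' (cong_sym h'')) => m E.
by have := c_inv m; rewrite -E addrAC subrr add0r eqxx.
Qed.

Let pos f k := if d k == f then x k (fr (d k) o1) else x k (fr (d k) o3).
Let sg f k : int := b2z (d k == f) - b2z (fopp hT (d k) == f).

Lemma beyond1_pos f th : beyond1 f th = \sum_k (if th < pos f k then sg f k else 0).
Proof.
apply: eq_bigr => k _; rewrite /pos /sg; case: (eqVneq (d k) f) => [->|_] /=.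
  by rewrite (negPf (fopp_neq hT f)) /=; case: (_ < _).
by case: (_ == f) => //=; case: (_ < _).
Qed.

Lemma pos_inj f k k' : k != k' -> sg f k != 0 -> sg f k' != 0 -> pos f k != pos f k'.
Proof.
move=> nk; have nk' : k' != k by rewrite eq_sym.
rewrite /pos /sg; have [n1 n2] := crossings_distinct nk; have [m1 m2] := crossings_distinct nk'.
have [E|NE] := eqVneq (d k) f; have [E'|NE'] := eqVneq (d k') f => //= s1 s2.
- by rewrite E E' in m1 *; exact: m1.
- move: s2; case: (eqVneq (fopp hT (d k')) f) => // E'' _; rewrite eq_sym; apply: n2; by rewrite E''.
- move: s1; case: (eqVneq (fopp hT (d k)) f) => // E'' _; apply: m2; by rewrite E''.
- move: s1 s2; case: (eqVneq (fopp hT (d k)) f) => // Ek _; case: (eqVneq (fopp hT (d k')) f) => // Ek' _.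
  have E : d k = d k' by rewrite -(foppK hT (d k)) Ek -Ek' foppK.
  have := m1 E; have [_ _ _ _ t1] := x_side k; have [_ _ _ _ t2] := x_side k'.
  by apply: contra => /eqP F; apply/eqP; lra.
Qed.

(* The signed number of crossings telescopes, since each crossing exchanges the two colours. *)
Lemma beyond1_color f th : beyond1 f th = color (hs f) - color (hs f - (beyond1 f th)%:~R).
Proof.
pose S th := [set k | (sg f k != 0) && (th < pos f k)]%SET.
have [m] := ubnP #|S th|; elim: m th => // m IH th; rewrite ltnS => Sm.
have [k1 k1S|S0] := pickP (mem (S th)); last first.
  have -> : beyond1 f th = 0; last by rewrite subr0 subrr.
  rewrite beyond1_pos big1 // => k _; have := S0 k; rewrite !inE.
  by case: eqP => [->|_] /=; [case: (_ < _)|move=> ->].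
have k1S' : k1 \in S th by [].
(* Take the crossing nearest to the position [th]; beyond it fewer crossings remain. *)
case: (@arg_minP _ _ _ k1 (fun k => k \in S th) (pos f) k1S') => k0 k0S k0min.
move: (k0S); rewrite inE => /andP[sg0 thk0].
have Sp : (#|S (pos f k0)| < m)%N.
  apply: leq_trans Sm; apply: proper_card; apply/properP; split.
    by apply/fintype.subsetP => k; rewrite !inE => /andP[-> /(lt_trans thk0) ->].
  by exists k0; rewrite // inE ltxx andbF.
have step : beyond1 f th = beyond1 f (pos f k0) + sg f k0.
  rewrite !beyond1_pos (bigD1 k0) //= thk0 [in RHS](bigD1 k0) //= ltxx add0r addrC.
  congr (_ + _); apply: eq_bigr => k kk0.
  have [sk|sk] := eqVneq (sg f k) 0; first by rewrite sk !if_same.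
  congr (if _ then _ else _); apply/idP/idP => [h'|h']; last exact: lt_trans thk0 h'.
  have k0' : k0 != k by rewrite eq_sym.
  rewrite lt_neqAle pos_inj //=; apply: k0min; by rewrite inE sk.
have [E|NE] := eqVneq (d k0) f.
  have sE : sg f k0 = 1 by rewrite /sg E eqxx (negPf (fopp_neq hT f)).
  have pE : pos f k0 = x k0 (fr (d k0) o1) by rewrite /pos E eqxx.
  have := IH _ Sp; have := color_exit E; rewrite -pE => C.
  rewrite (color_eq0 C) subr0 => <-; rewrite [color _](_ : _ = -1); first by rewrite step sE opprK.
  apply: color_eqN1; rewrite step sE rmorphD /= opprD addrA subrK; exact: C.
have E : fopp hT (d k0) = f.
  by move: sg0; rewrite /sg (negPf NE); case: (eqVneq (fopp hT (d k0)) f).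
have sE : sg f k0 = -1 by rewrite /sg (negPf NE) E eqxx.
have pE : pos f k0 = x k0 (fr (d k0) o3) by rewrite /pos (negPf NE).
have := IH _ Sp; have := color_enter E; rewrite -pE => C.
rewrite (color_eqN1 C) opprK => IHp; rewrite [X in _ - X](_ : _ = 0); first by rewrite step sE IHp subr0 addrK.
by apply: color_eq0; rewrite step sE rmorphD /= opprD addrA opprK.
Qed.

(** All crossing positions are positive, so [beyond1 f 0] counts every crossing of the side;
    subtracting [I f] from [h] at its start gives [h] at its end modulo [c]. *)
Theorem separating_potential : exists H : vert T -> int,
  forall f, I f = H (fvert hT f) - H (fvert hT (fnxt f)).
Proof.
exists (fun v => color (h v)) => f.
have I0 : I f = beyond1 f 0.
  rewrite beyond1_pos; apply: eq_bigr => k _; have [_ _ h1 h3 _] := x_side k.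
  by have -> : 0 < pos f k by rewrite /pos; case: ifP.
by rewrite {1}I0 beyond1_color -I0; congr (_ - _); apply: color_cong; exact: I_cong.
Qed.
End SimpleCurve.

(** * Curves of the link as cyclic words of flags *)

Lemma nth_rotr1 (X : Type) (x0 : X) s i : (i < size s)%N ->
  nth x0 (rotr 1 s) i = nth x0 s ((i + size s).-1 %% size s).
Proof.
case/lastP: s => // s y; rewrite rotr1_rcons size_rcons; case: i => [|i] ilt /=.
  by rewrite modn_small // nth_rcons ltnn eqxx.
by rewrite modnDr modn_small 1?ltnW // nth_rcons -ltnS ilt.
Qed.

Lemma nth_arcs (X : Type) (x0 : X) s i : (i < size s)%N ->
  nth (x0, x0) (arcs s) i = (nth x0 s ((i + size s).-1 %% size s), nth x0 s i).
Proof. by move=> lt; rewrite /arcs nth_zip ?size_rotr // nth_rotr1. Qed.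

Lemma size_arcs (X : Type) (s : seq X) : size (arcs s) = size s.
Proof. by rewrite /arcs size_zip size_rotr minnn. Qed.

Lemma onth_nthE (X : Type) (x0 : X) s i : (i < size s)%N -> onth s i = Some (nth x0 s i).
Proof. by move=> lt; rewrite onthE (nth_map x0). Qed.

Lemma cycle_arcs (X : Type) (x0 : X) (r : rel X) s (i : 'I_(size s)) :
  path.cycle r s -> r (nth x0 s (ord_pred i)) (nth x0 s i).
Proof.
rewrite (cycle_path x0) => /(pathP x0) /(_ i (ltn_ord i)).
case: i => -[|i] ilt /=.
  by rewrite modn_small ?ltn_predL // nth_last.
by rewrite modnDr modn_small // ltnW.
Qed.

Lemma ord_pred_conn m (i k : 'I_m) : fconnect (@ord_pred m) i k.
Proof.
pose j := (i + m - k)%N.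
have iE : iter j (@ordS m) k = i.
  have itv a : (val (iter a (@ordS m) k) = (k + a) %% m)%N.
    elim: a => [|a IH] /=; first by rewrite addn0 modn_small.
    by rewrite IH -[(_ %% _)%N.+1]addn1 modnDml addn1 addnS.
  apply: val_inj; rewrite itv /j; have := ltn_ord i; have := ltn_ord k => k1 i1.
  have -> : (k + (i + m - k) = i + m)%N by lia.
  by rewrite modnDr modn_small.
have <- : iter j (@ord_pred m) i = k; last exact: fconnect_iter.
by rewrite -iE; elim: j {iE} => //= a IH; rewrite -iterS iterSr /= ordSK.
Qed.

Section Curves.
Variables (n : nat) (T : gluing n).
Hypothesis hT : oriented_gluing T.
Local Notation tet := 'I_n.+1.
Local Notation gt := (glue_tet T).
Local Notation gp := (glue_perm T).

Definition flag_step (d d' : flag n) : bool :=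
  (fsrc (fopp hT d) == fsrc d') && (d' != fopp hT d).

Lemma curve_flags c : normal_closed T c -> exists ds : seq (flag n),
  c = [seq cr d | d <- ds] /\ path.cycle flag_step ds.
Proof.
case=> allc cyc; suff [ds dsE] : exists ds : seq (flag n), c = [seq cr d | d <- ds].
  exists ds; split=> //; move: cyc; rewrite dsE cycle_map; apply: sub_cycle => d d' /=.
  rewrite /normal_step -cr_opp (inj_eq (@cr_inj n)) => /andP[/eqP E nE].
  by rewrite /flag_step nE andbT fsrc_opp; apply/eqP.
elim: c allc {cyc} => [|[[j v] f] c IH] /=; first by exists [::].
case/andP => fv /IH [ds ->]; case: (cr_surj j fv) => d <-; by exists (d :: ds).
Qed.

Definition crossing_number (ds : seq (flag n)) (f : flag n) : int :=
  (count_mem f ds)%:Z - (count_mem (fopp hT f) ds)%:Z.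

Lemma crossing_number_opp ds f : crossing_number ds (fopp hT f) = - crossing_number ds f.
Proof. by rewrite /crossing_number foppK opprB. Qed.

Section Indexed.
Variables (d0 : flag n) (ds' : seq (flag n)).
Let ds := d0 :: ds'.
Hypothesis dsP : path.cycle flag_step ds.
Let dd (i : 'I_(size ds)) := nth d0 ds i.

Lemma index_step i : fsrc (dd i) = fsrc (fopp hT (dd (ord_pred i))) /\
  dd i != fopp hT (dd (ord_pred i)).
Proof. by have := cycle_arcs d0 i dsP => /andP[/eqP E]. Qed.

Lemma sum_index (Z : nmodType) (F : flag n -> Z) : \sum_(d <- ds) F d = \sum_i F (dd i).
Proof. by rewrite (big_nth d0) big_mkord. Qed.

Lemma count_index f : (count_mem f ds)%:Z = \sum_i ((dd i == f) : nat)%:Z.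
Proof.
rewrite -(sum_index (fun d => ((d == f) : nat)%:Z)).
by elim: ds => [|a s IH]; rewrite ?big_nil // big_cons -IH /= PoszD.
Qed.

Lemma crossing_number_index f : crossing_number ds f =
  \sum_i (((dd i == f) : nat)%:Z - ((fopp hT (dd i) == f) : nat)%:Z).
Proof.
transitivity (\sum_i ((dd i == f) : nat)%:Z - \sum_i ((dd i == fopp hT f) : nat)%:Z).
  by congr (_ - _); exact: count_index.
rewrite -sumrB; apply: eq_bigr => i _.
congr (_ - (nat_of_bool _)%:Z).
by apply/eqP/eqP => [->|<-]; rewrite foppK.
Qed.

Lemma sum_difference (Z : zmodType) (g : flag n -> Z) :
  (forall f f', fsrc f = fsrc f' -> g f = g f') ->
  \sum_(d <- ds) (g (fopp hT d) - g d) = 0.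
Proof.
move=> gc; rewrite big_split sumrN /= !sum_index.
rewrite [X in X - _](reindex_inj (@ord_pred_inj _)) /=.
apply/eqP; rewrite subr_eq0; apply/eqP/eq_bigr => i _.
by apply: gc; case: (index_step i).
Qed.

Lemma crossing_number_closed y : \sum_(f | fsrc f == y) crossing_number ds f = 0.
Proof.
pose g (f : flag n) : int := ((fsrc f == y) : nat)%:Z.
have S p : \sum_(f | fsrc f == y) ((p == f) : nat)%:Z = g p.
  rewrite /g; case: (boolP (fsrc p == y)) => py.
    rewrite (bigD1 p) //= eqxx big1 ?addr0 // => f /andP[_ /negPf].
    by rewrite eq_sym => ->.
  rewrite big1 // => f /eqP fy; case: eqP => // E; by rewrite E fy eqxx in py.
under eq_bigr do rewrite crossing_number_index.
rewrite exchange_big /=.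
have := @sum_difference _ g; rewrite sum_index => E.
transitivity (- \sum_i (g (fopp hT (dd i)) - g (dd i))); last first.
  by rewrite E ?oppr0 // => f f' ff; rewrite /g ff.
rewrite -sumrN; apply: eq_bigr => i _.
by rewrite sumrB !S opprB.
Qed.

End Indexed.

Lemma ccw_flag (d : flag n) a b c : ccw (fr d o0) a b c =
  [|| [&& a == fr d o1, b == fr d o2 & c == fr d o3],
      [&& a == fr d o2, b == fr d o3 & c == fr d o1]
    | [&& a == fr d o3, b == fr d o1 & c == fr d o2]].
Proof.
have [k k0 k1 k2 k3] := fr_nxt d; have [m m0 m1 m2 m3] := fr_nxt (fnxt d).
apply/existsP/idP => [[p /and5P[ep /eqP p0 /eqP<- /eqP<- /eqP<-]]|].
  pose d' : flag n := Sub (ft d, p) ep.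
  have : fsrc d' = fsrc d by rewrite /fsrc /ft /fr /= p0.
  have -> : p = fr d' by [].
  by case/fsrc_fiber => ->; rewrite ?m1 ?m2 ?m3 ?k1 ?k2 ?k3 !eqxx ?orbT.
have W (x : flag n) : fr x o0 = fr d o0 -> exists p : 'S_4, [&& ~~ odd_perm p,
    p o0 == fr d o0, p o1 == fr x o1, p o2 == fr x o2 & p o3 == fr x o3].
  by move=> x0; exists (fr x); rewrite fr_even x0 !eqxx.
case/or3P => /and3P[/eqP-> /eqP-> /eqP->]; first exact: W.
  by have := W (fnxt (fnxt d)); rewrite m0 m1 m2 m3 k0 k1 k2 k3; apply.
by have := W (fnxt d); rewrite k0 k1 k2 k3; apply.
Qed.

Lemma corner_sign_arc (q p f : flag n) : fsrc p = fsrc q -> fsrc f = fsrc q -> q != p ->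
  corner_sign (fr f o0) (fr f o1) (fr p o2) (fr q o2)
  - corner_sign (fr f o0) (fr f o3) (fr p o2) (fr q o2) =
  ((q == f) : nat)%:Z - ((p == f) : nat)%:Z.
Proof.
have [k k0 k1 k2 k3] := fr_nxt q; have [m m0 m1 m2 m3] := fr_nxt (fnxt q).
have n1 : (fnxt q == q) = false by apply/negbTE/fnxt_neq.
have n2 : (fnxt (fnxt q) == q) = false.
  by apply/negbTE/eqP => E; have := fnxt3 q; rewrite E => E'; rewrite E' eqxx in n1.
have n3 : (fnxt (fnxt q) == fnxt q) = false by rewrite (inj_eq (@fnxt_inj n)).
have S w : corner_sign (fr q o0) w (fr q o1) (fr q o2) = - ((w == fr q o3) : nat)%:Z.
  rewrite /corner_sign !ccw_flag !(inj_eq perm_inj) /= !andbT !andbF !orbF.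
  by rewrite sub0r.
have S' w : corner_sign (fr q o0) w (fr q o3) (fr q o2) = ((w == fr q o1) : nat)%:Z.
  rewrite /corner_sign !ccw_flag !(inj_eq perm_inj) /= !andbT !andbF !orbF.
  by rewrite subr0.
move=> /fsrc_fiber pq fq; have fv : fr f o0 = fr q o0 by case: fq.
have n1' : (q == fnxt q) = false by rewrite eq_sym.
have n2' : (q == fnxt (fnxt q)) = false by rewrite eq_sym.
have n3' : (fnxt q == fnxt (fnxt q)) = false by rewrite eq_sym.
case: pq => ->; rewrite ?eqxx // => _; case: (fsrc_fiber fq) => ->;
  by rewrite ?m0 ?m1 ?m2 ?m3 ?k0 ?k1 ?k2 ?k3 ?S ?S' !(inj_eq perm_inj) ?eqxx
     ?n1 ?n2 ?n3 ?n1' ?n2' ?n3'.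
Qed.

Definition corner_coef (c : seq (crossing n)) (j : tet) (v w : 'I_4) : int :=
  \sum_(A <- arcs c | A.2.1 == (j, v)) corner_sign v w (cr_inv T A.1).2 A.2.2.

Lemma Cv_corner_coef q c s j : Cv T q c s ord0 j =
  \sum_v \sum_(w | label q j v w == s) corner_coef c j v w.
Proof.
rewrite mxE /corner_coef.
under [RHS]eq_bigr => v _ do rewrite exchange_big /=.
rewrite (exchange_big_dep (fun A : crossing n * crossing n => A.2.1.1 == j)) /=; last first.
  by move=> v A _ /eqP ->.
apply: eq_bigr => A /eqP jA; rewrite [RHS](big_pred1 A.2.1.2) // => v.
by rewrite -jA [A.2.1]surjective_pairing xpair_eqE eqxx eq_sym.
Qed.

(** So the crossing numbers determine the coefficients of the row of the curve up to a function of
    the triangle, to be killed by the relation between the [zeta]. *)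
Lemma corner_coef_flag d0 ds' (ds := d0 :: ds') f : path.cycle flag_step ds ->
  corner_coef [seq cr d | d <- ds] (ft f) (fr f o0) (fr f o1)
  - corner_coef [seq cr d | d <- ds] (ft f) (fr f o0) (fr f o3) = crossing_number ds f.
Proof.
move=> dsP; pose dd (i : 'I_(size ds)) := nth d0 ds i.
have E w : corner_coef [seq cr d | d <- ds] (ft f) (fr f o0) w =
    \sum_i (if fsrc (dd i) == fsrc f then
      corner_sign (fr f o0) w (fr (fopp hT (dd (ord_pred i))) o2) (fr (dd i) o2) else 0).
  rewrite /corner_coef big_mkcond (big_nth (cr d0, cr d0)) size_arcs size_map big_mkord.
  apply: eq_bigr => i _; rewrite nth_arcs ?size_map // !(nth_map d0) ?ltn_mod //.
  by rewrite -cr_opp.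
rewrite !E -sumrB.
transitivity (\sum_i (((dd i == f) : nat)%:Z - ((fopp hT (dd (ord_pred i)) == f) : nat)%:Z)).
  apply: eq_bigr => i _; have [st nst] := index_step dsP i.
  rewrite -/(dd i) -/(dd (ord_pred i)) in st nst.
  case: eqP => sf; first by apply: corner_sign_arc.
  rewrite subr0; case: eqP => [E1|_]; first by rewrite E1 in sf.
  by case: eqP => // E2; rewrite st E2 in sf.
refine (etrans _ (esym (crossing_number_index d0 ds' f))).
refine (etrans (sumrB _ _ _ _) (etrans _ (esym (sumrB _ _ _ _)))).
refine (f_equal2 (fun a b : int => a - b) erefl _); apply: esym.
exact: (reindex_inj (h := @ord_pred _) (@ord_pred_inj _)).
Qed.

Lemma sum_ord4 (Z : nmodType) (F : 'I_4 -> Z) : \sum_a F a = F o0 + F o1 + F o2 + F o3.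
Proof.
rewrite !big_ord_recl big_ord0 addr0 !addrA.
by do 3?congr (_ + _); congr F; apply: val_inj.
Qed.

Lemma simple_points d0 ds' (ds := d0 :: ds') (dd := fun i : 'I_(size ds) => nth d0 ds i) :
  simple_curve T [seq cr d | d <- ds] ->
  exists x : 'I_(size ds) -> 'I_4 -> rat, (forall i, on_side (dd i) (x i)) /\
   forall i k, i != k -> fsrc (dd i) = fsrc (dd k) -> forall s t, 0 <= s <= 1 -> 0 <= t <= 1 ->
   ~ (forall a, (1 - s) * x (ord_pred i) ((gp (ft (dd (ord_pred i))) (fr (dd (ord_pred i)) o2))^-1%g a)
        + s * x i a
      = (1 - t) * x (ord_pred k) ((gp (ft (dd (ord_pred k))) (fr (dd (ord_pred k)) o2))^-1%g a)
        + t * x k a).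
Proof.
case=> X; rewrite size_map => -[sX sideX disjX].
pose x0 : 'I_4 -> rat := fun=> 0.
have sz : size (zip [seq cr d | d <- ds] X) = size ds by rewrite size_zip size_map sX minnn.
have nz i : (i < size ds)%N ->
    nth (cr d0, x0) (zip [seq cr d | d <- ds] X) i = (cr (nth d0 ds i), nth x0 X i).
  by move=> lt; rewrite nth_zip ?size_map // (nth_map d0).
exists (fun i => nth x0 X i); split=> [i|i k ik sik s t s01 t01 E].
  have := sideX i (cr (dd i)) (nth x0 X i).
  rewrite (onth_nthE (cr d0, x0)) ?sz // nz // => /(_ erefl) [h0 h2 hpos].
  rewrite /= (reindex_inj (@perm_inj _ (fr (dd i)))) /= sum_ord4 h0 h2 add0r addr0 => h1.
  by split=> //; apply: hpos; rewrite /= (inj_eq perm_inj).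
pose arc (i : 'I_(size ds)) := ((cr (dd (ord_pred i)), nth x0 X (ord_pred i)), (cr (dd i), nth x0 X i)).
have arcE (i' : 'I_(size ds)) : onth (arcs (zip [seq cr d | d <- ds] X)) i' = Some (arc i').
  have lt : (i' < size (zip [seq cr d | d <- ds] X))%N by rewrite sz.
  rewrite (onth_nthE ((cr d0, x0), (cr d0, x0))) ?size_arcs // nth_arcs // sz.
  by rewrite !nz // ltn_mod.
have nik : (i : nat) <> k by move/val_inj => E'; rewrite E' eqxx in ik.
exact: (disjX i k (arc i) (arc k) nik (arcE i) (arcE k) sik s t s01 t01 E).
Qed.

End Curves.

Lemma unit_int (m r : int) : m * r = 1 -> m = 1 \/ m = -1.
Proof.
move/(congr1 absz); rewrite abszM => /eqP; rewrite muln_eq1 => /andP[/eqP m1 _].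
by case: m m1 => [] [|[|m]] //=; [left|right].
Qed.

(** * The class of [lambda] *)

Section LambdaClass.
Variables (n : nat) (T : gluing n).
Hypothesis hT : oriented_gluing T.
Hypothesis hc : one_cusped T.
Hypothesis ht : torus_link T.
Variables (a K : flag n -> int).
Hypothesis a_opp : forall f, a (fopp hT f) = - a f.
Hypothesis K_turn : forall f, K (fnxt (fopp hT f)) = K f + a f.
Hypothesis K_opp : forall f, K (fopp hT f) = K (fnxt f) + a f.

Let w1 f : rat := (K f - K (fnxt f))%:~R.
(** Cup product with the class of [alpha], a cochain on sides against a cochain on dual edges. Each
    side is counted with both orientations, whence the factor 2 in [pairing_crossing]. *)
Let pairing (x : flag n -> rat) : rat := \sum_f x f * (a f)%:~R.

Lemma pairing_antisym (x : flag n -> rat) :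
  \sum_f x (fopp hT f) * (a f)%:~R = - pairing x.
Proof.
rewrite /pairing (reindex_inj (can_inj (foppK hT))) /= -sumrN.
by apply: eq_bigr => f _; rewrite foppK a_opp rmorphN mulrN.
Qed.

Lemma pairing_vertex (H : flag n -> rat) : (forall f, H (fnxt (fopp hT f)) = H f) ->
  pairing H = 0.
Proof.
move=> Ht; rewrite /pairing.
under eq_bigr => f _.
  rewrite (_ : a f = K (fnxt (fopp hT f)) - K f) ?rmorphB ?mulrBr; last by rewrite K_turn addrC addKr.
  over.
rewrite sumrB [X in _ - X](reindex_inj (h := fun f => fnxt (fopp hT f))) /=; last first.
  by apply: inj_comp; [exact: fnxt_inj|exact: (can_inj (foppK hT))].
apply/eqP; rewrite subr_eq0; apply/eqP/eq_bigr => f _.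
by rewrite Ht.
Qed.

Lemma pairing_coboundary y : coboundary (@fnxt n) (fvert hT) y -> pairing y = 0.
Proof.
case=> h hy; have h0 := @pairing_vertex (fun f => h (fvert hT f)).
have {h0} h0 : pairing (fun f => h (fvert hT f)) = 0.
  by apply: h0 => f; rewrite fvert_turn.
rewrite /pairing; under eq_bigr => f _.
  rewrite hy (_ : fvert hT (fnxt f) = fvert hT (fopp hT f)) ?mulrBl; last first.
    by rewrite -[RHS](fvert_turn hT (fopp hT f)) foppK.
  over.
rewrite sumrB -/(pairing (fun f => h (fvert hT f))) h0.
by rewrite (pairing_antisym (fun f => h (fvert hT f))) h0 oppr0 subrr.
Qed.

Lemma w1_cocycle : cocycle (fopp hT) (@fsrc n) w1.
Proof.
split=> [f|y]; first by rewrite /w1 K_opp K_turn -rmorphN; congr _%:~R; ring.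
rewrite -rmorph_sum /= sumrB [X in X - _](reindex_inj (@fnxt_inj n)) /=.
rewrite [X in X - _](eq_bigl (fun f => fsrc f == y)) ?subrr // => f.
by rewrite fsrc_nxt.
Qed.

(** Vanishing of a cup square: twice each term is a combination of four values of [K ^+ 2], at flags
    whose contributions cancel after reindexing. *)
Lemma pairing_w1 : pairing w1 = 0.
Proof.
have fi : injective (fopp hT) := can_inj (foppK hT).
suff : \sum_f (K f - K (fnxt f)) * a f = 0.
  move=> E; rewrite -[RHS](_ : (0 : int)%:~R = 0) // -E rmorph_sum /=.
  by apply: eq_bigr => f _; rewrite rmorphM.
apply: (@mulIf _ 2) => //; rewrite mul0r mulr_suml.
transitivity (\sum_f ((K (fnxt (fopp hT f)) ^+ 2 - K (fopp hT f) ^+ 2) - (K f ^+ 2 - K (fnxt f) ^+ 2))).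
  by apply: eq_bigr => f _; rewrite K_turn K_opp; ring.
have S (h : flag n -> flag n) : injective h -> \sum_f (K (h f)) ^+ 2 = \sum_f (K f) ^+ 2.
  by move=> hi; rewrite [RHS](reindex_inj hi).
rewrite !sumrB (S (fun f => fnxt (fopp hT f))) ?(S (fopp hT)) ?(S (@fnxt n)) ?subrr //.
- exact: fnxt_inj.
- by apply: inj_comp; [exact: fnxt_inj|].
Qed.

Lemma sum_fopp (F : flag n -> int) : \sum_f F (fopp hT f) = \sum_f F f.
Proof. by rewrite [RHS](reindex_inj (can_inj (foppK hT))). Qed.

Lemma pairing_crossing ds : pairing (fun f => (crossing_number hT ds f)%:~R) =
  (2 * \sum_(d <- ds) a d)%:~R.
Proof.
rewrite sum_count; pose S := \sum_f a f *+ count_mem f ds; rewrite -/S.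
have E : \sum_f (count_mem f ds)%:Z * a f = S.
  by apply: eq_bigr => f _; rewrite -mulr_natl natz.
have E2 : \sum_f (count_mem (fopp hT f) ds)%:Z * a f = - S.
  rewrite -E; refine (etrans _ (f_equal -%R (sum_fopp (fun f => (count_mem f ds)%:Z * a f)))).
  refine (etrans (eq_bigr (fun f => - ((count_mem (fopp hT f) ds)%:Z * a (fopp hT f))) _)
                 (sumrN _ _ _)) => f _.
  by rewrite a_opp mulrN opprK.
have E3 : \sum_f crossing_number hT ds f * a f = S - - S.
  rewrite -{1}E -E2 -sumrB; apply: eq_bigr => f _.
  by rewrite /crossing_number mulrBl.
have -> : 2 * S = S - - S by ring.
rewrite -E3 rmorph_sum /=; apply: eq_bigr => f _.
by rewrite rmorphM.
Qed.

Lemma crossing_cocycle d0 ds' : path.cycle (flag_step hT) (d0 :: ds') ->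
  cocycle (fopp hT) (@fsrc n) (fun f => (crossing_number hT (d0 :: ds') f)%:~R : rat).
Proof.
move=> dsP; split=> [f|y]; first by rewrite crossing_number_opp rmorphN.
by rewrite -rmorph_sum /= crossing_number_closed.
Qed.

Variables (dm : flag n) (dms : seq (flag n)).
Hypothesis muP : path.cycle (flag_step hT) (dm :: dms).
Hypothesis mu1 : \sum_(d <- dm :: dms) a d = 1.

(* If [K] were a vertex function plus a face function modulo [m], then [a] would be
   the coboundary of the face function modulo [m]. *)
Lemma mu_primitive (m : int) (h : vert T -> rat) :
  (forall f, exists r : int, w1 f - (h (fvert hT f) - h (fvert hT (fnxt f))) = (m * r)%:~R) ->
  exists r : int, m * r = 1.
Proof.
move=> hm; pose g f : rat := (K f)%:~R - h (fvert hT f).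
have g_nxt f : exists r : int, g f - g (fnxt f) = (m * r)%:~R.
  by case: (hm f) => r E; exists r; rewrite -E /g /w1 rmorphB /=; ring.
have g_tri f f' : fsrc f' = fsrc f -> exists r : int, g f - g f' = (m * r)%:~R.
  case/fsrc_fiber => ->.
  - by exists 0; rewrite subrr mulr0.
  - exact: g_nxt.
  - have [r E] := g_nxt f; have [r' E'] := g_nxt (fnxt f); exists (r + r').
    by rewrite mulrDr rmorphD /= -E -E'; ring.
have g_opp f : exists r : int, g (fopp hT f) - g f = (a f + m * r)%:~R.
  have [r E] := g_nxt f; exists (- r).
  rewrite mulrN rmorphB /= -E /g K_opp rmorphD /=.
  rewrite (_ : fvert hT (fopp hT f) = fvert hT (fnxt f)); first by ring.
  by rewrite -(fvert_turn hT (fopp hT f)) foppK.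
have [rho rhoE] := choice g_opp.
(* Modulo [m], [g] only depends on the triangle. Evaluating it at a chosen flag of each triangle
   gives a true function of triangles, whose variation along [mu] telescopes. *)
have mkrep y : exists f : flag n, fsrc f = y by exact: fsrc_surj.
have [rep repE] := choice mkrep.
have grep f : exists r : int, g f - g (rep (fsrc f)) = (m * r)%:~R.
  by apply: g_tri; rewrite repE.
have [del delE] := choice grep.
have S := @sum_difference n T hT dm dms muP _ (fun f => g (rep (fsrc f))).
have : \sum_(d <- dm :: dms) (a d + m * (rho d - del (fopp hT d) + del d))%:~R = 0 :> rat.
  rewrite -[RHS]S => [|f f' ->] //; apply: eq_bigr => d _.
  have := rhoE d; have := delE d; have := delE (fopp hT d).
  rewrite mulrDr mulrBr !(rmorphD, rmorphB) /= => E1 E2 E3; lra.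
rewrite -rmorph_sum big_split /= mu1 -mulr_sumr => /eqP; rewrite intr_eq0 => /eqP E.
exists (- \sum_(d <- dm :: dms) (rho d - del (fopp hT d) + del d)).
by apply/eqP; rewrite mulrN eqr_oppLR -addr_eq0 addrC; apply/eqP.
Qed.

Variables (dl : flag n) (dls : seq (flag n)).
Let dsl := dl :: dls.
Hypothesis laP : path.cycle (flag_step hT) dsl.
Hypothesis la0 : \sum_(d <- dsl) a d = 0.
Hypothesis la_simple : simple_curve T [seq cr d | d <- dsl].
Hypothesis la_nontrivial : ~ link_homotopic T (fsrc dl) [seq fr d o2 | d <- dsl] [::].

Theorem lambda_class : exists (s : bool) (h : vert T -> rat), forall f,
  (crossing_number hT dsl f)%:~R = (-1) ^+ s * w1 f + (h (fvert hT f) - h (fvert hT (fnxt f))).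
Proof.
have cV := card_vert ht.
have euler : (#|{: flag n}| <= 2 * (#|{: 'I_n.+1 * 'I_4}| + #|{: vert T}|))%N.
  by have := @card_fsrc n; rewrite cV card_prod !card_ord; lia.
have w1N : ~ coboundary (@fnxt n) (fvert hT) w1.
  case=> h hw; have [|r] := @mu_primitive 0 h; last by rewrite mul0r.
  by move=> f; exists 0; rewrite hw subrr.
have Pmu : pairing (fun f => (crossing_number hT (dm :: dms) f)%:~R) != 0.
  by rewrite pairing_crossing mu1.
have Pla : pairing (fun f => (crossing_number hT dsl f)%:~R) = 0.
  by rewrite pairing_crossing la0 mulr0.
have Plin c y y' : pairing (fun d => c * y d + y' d) = c * pairing y + pairing y'.
  rewrite /pairing mulr_sumr -big_split; apply: eq_bigr => f _ /=; ring.
have Pext y y' : y =1 y' -> pairing y = pairing y'.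
  by move=> E; apply: eq_bigr => f _; rewrite E.
have [c [h hE]] := @cohomology_rank2 _ _ _ (fopp hT) (@fnxt n) (@fsrc n) (fvert hT)
  (foppK hT) (fopp_neq hT) (@fnxt_inj n) (@fsrc_nxt n) (@fsrc_fiber n) (fvert_turn hT)
  (fvert_surj hT) (@fsrc_conn _ _ hT hc) euler w1 _ _ pairing Plin Pext
  pairing_coboundary w1_cocycle pairing_w1 w1N (crossing_cocycle muP) Pmu
  (crossing_cocycle laP) Pla.
have [|cinv] := pselect (exists m : int, c * m%:~R = 1); last first.
  case: la_nontrivial; have [x [xs xd]] := simple_points la_simple.
  have st i := (index_step laP i).
  have cinv' (m : int) : c * m%:~R != 1 by apply/eqP => E; case: cinv; exists m.
  have [|H HE] := @separating_potential n T hT _ _ _ x (@ord_pred_inj _) (@ord_pred_conn _)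
    (fun i => (st i).1) (fun i => (st i).2) xs xd c h (fun f => K f - K (fnxt f)) _ ord0 cinv'.
    by move=> f; rewrite -hE crossing_number_index.
  apply: (@null_homologous_contractible n T hT (fsrc dl) hc ht dl dls H) => //.
    by apply: sub_cycle laP => d d' /andP[].
  by move=> f; rewrite -HE -crossing_number_index.
case=> m cm; have mE : exists r : int, m * r = 1.
  (* Multiplying [hE] by [m] and using [c * m = 1] shows that [w1] is [m] times the crossing numbers
     up to the coboundary of [- m h]. *)
  apply: (@mu_primitive m (fun v => - (m%:~R * h v))) => f.
  exists (crossing_number hT dsl f); rewrite rmorphM /= hE.
  transitivity (c * m%:~R * w1 f + (m%:~R * h (fvert hT f) - m%:~R * h (fvert hT (fnxt f)))).
    by rewrite cm; ring.
  ring.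
have [m1|m1] : m = 1 \/ m = -1 by case: mE => r E; apply: unit_int E.
  by exists false, h => f; rewrite hE -[c]mulr1 -[X in c * X](_ : m%:~R = 1) ?cm // m1.
exists true, h => f; rewrite hE expr1; congr (_ * _ + _).
by rewrite -cm m1; ring.
Qed.

End LambdaClass.

(** * Determinants *)

(** [A] is the product of [B] by a lower triangular matrix that differs from the identity in its
    last row only. *)
Lemma det_last_row (K : comNzRingType) n (A B : 'M[K]_n.+1) (c : K) (l : 'I_n.+1 -> K) :
  (forall i j, i != ord_max -> A i j = B i j) ->
  (forall j, A ord_max j = c * B ord_max j + \sum_(i | i != ord_max) l i * B i j) ->
  \det A = c * \det B.
Proof.
move=> hA hmax.
pose L : 'M[K]_n.+1 := \matrix_(i, j)
  if i == ord_max then if j == ord_max then c else l j else (i == j)%:R.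
have -> : A = L *m B.
  apply/matrixP => i j; rewrite mxE (bigD1 i) //= mxE.
  have [->|ni] := eqVneq i ord_max.
    rewrite hmax; congr (_ + _); apply: eq_bigr => k nk.
    by rewrite mxE eqxx (negPf nk).
  rewrite eqxx mul1r big1 ?addr0 ?hA // => k nk.
  by rewrite mxE (negPf ni) eq_sym (negPf nk) mul0r.
rewrite det_mulmx det_trig; last first.
  apply/is_trig_mxP => i j ij; rewrite mxE.
  have ni : i != ord_max by rewrite neq_ltn (leq_trans ij) // -ltnS.
  by rewrite (negPf ni) -val_eqE /= (ltn_eqF ij).
rewrite (bigD1 ord_max) //= mxE eqxx big1 ?mulr1 // => i ni.
by rewrite mxE (negPf ni) eqxx.
Qed.

(** Putting the sum of all rows in the last row preserves the determinant, and ['X - 1] then factors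
    out of that row. At 1, the derivative of [('X - 1) * Q] is the value of [Q]. *)
Lemma det_row_sum (K : fieldType) n (P : 'M[{poly K}]_n.+1) :
  (forall j, (\sum_i P i j).[1] = 0) ->
  (\det P).[1] = 0 /\
  (\det P)^`().[1] = \det (\matrix_(i, j)
     if i == ord_max then (\sum_i' P i' j)^`().[1] else (P i j).[1]).
Proof.
move=> h1; pose S j := \sum_i P i j.
have hS j : S j = ('X - 1%:P) * (S j %/ ('X - 1%:P)).
  by rewrite mulrC divpK // dvdp_XsubCl; apply/rootP; exact: h1.
pose Q : 'M[{poly K}]_n.+1 :=
  \matrix_(i, j) if i == ord_max then S j %/ ('X - 1%:P) else P i j.
pose Q0 : 'M[{poly K}]_n.+1 := \matrix_(i, j) if i == ord_max then S j else P i j.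
have d1 : \det Q0 = 1 * \det P.
  apply: (det_last_row (l := fun=> 1)) => [i j ni|j]; rewrite mxE ?(negPf ni) //.
  rewrite eqxx mul1r /S (bigD1 ord_max) //=; congr (_ + _).
  by apply: eq_bigr => i _; rewrite mul1r.
have d2 : \det Q0 = ('X - 1%:P) * \det Q.
  apply: (det_last_row (l := fun=> 0)) => [i j ni|j]; rewrite !mxE ?(negPf ni) //.
  by rewrite !eqxx -hS big1 ?addr0 // => i _; rewrite mul0r.
have -> : \det P = ('X - 1%:P) * \det Q by rewrite -d2 d1 mul1r.
rewrite hornerM hornerXsubC subrr mul0r; split=> //.
rewrite derivM derivXsubC mul1r hornerD hornerM hornerXsubC subrr mul0r addr0.
rewrite -[LHS]/(horner_eval 1 (\det Q)) -det_map_mx; congr (\det _); apply/matrixP => i j; rewrite !mxE.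
rewrite /horner_eval; case: ifP => _ //; rewrite -/(S j) [in RHS]hS derivM derivXsubC mul1r.
by rewrite hornerD hornerM hornerXsubC subrr mul0r addr0.
Qed.

(** * The twisted matrix as a matrix of polynomials *)

Section TwistedMatrix.
Variables (n : nat) (T : gluing n) (q : 'I_n.+1 -> 'I_3)
  (e : 'I_n.+1 -> 'I_n.+1 * 'I_4 * 'I_4) (K : fieldType) (z : 'I_n.+1 -> K)
  (alpha : seq 'I_4 -> int) (pT pE : 'I_n.+1 -> seq 'I_4).
Local Notation tet := 'I_n.+1.
Local Notation zt := (zeta z).
Variables (idx : tet * 'I_4 * 'I_4 -> tet) (k : tet * 'I_4 * 'I_4 -> int).
Hypothesis idxP : forall j a b i, a != b ->
  (exists w, around T (j, a, b) w (e i)) <-> i = idx (j, a, b).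
Hypothesis kP : forall j a b i m, a != b ->
  (exists2 w, around T (j, a, b) w (e i)
    & m + alpha (pT j ++ w ++ rev_walk T (base n) (pE i)) = 0) <->
  i = idx (j, a, b) /\ m = k (j, a, b).

Local Notation cn j ab := (j, ab.1, ab.2).

Lemma card_sum (I : finType) (Q : pred I) (Z : pzRingType) :
  #|[set x | Q x]%SET|%:Z%:~R = \sum_x (Q x)%:R :> Z.
Proof.
rewrite cardsE -sum1_card big_mkcond /= -pmulrn natr_sum.
by apply: eq_bigr => x _; rewrite unfold_in; case: (Q x).
Qed.

Lemma sum_labels (Z : nmodType) j (Q : pred ('I_4 * 'I_4)) (F : 'I_4 * 'I_4 -> 'I_3 -> Z) :
  \sum_s \sum_(ab | (ab \in edges_of q j s) && Q ab) F ab s =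
  \sum_(ab : 'I_4 * 'I_4 | (ab.1 < ab.2)%N && Q ab) F ab (label q j ab.1 ab.2).
Proof.
rewrite (exchange_big_dep (fun ab : 'I_4 * 'I_4 => (ab.1 < ab.2)%N && Q ab)) /=; last first.
  by move=> s ab _; rewrite inE => /andP[/andP[-> _] ->].
apply: eq_bigr => ab /andP[h1 h2].
rewrite (eq_bigl (pred1 (label q j ab.1 ab.2))) ?big_pred1_eq // => s.
by rewrite inE h1 h2 andbT /= eq_sym.
Qed.

Lemma lt_neq4 (ab : 'I_4 * 'I_4) : (ab.1 < ab.2)%N -> ab.1 != ab.2.
Proof. by move=> h; rewrite -val_eqE neq_ltn h. Qed.

Lemma G_entry (Z : pzRingType) s i j : (G T q e s i j)%:~R =
  \sum_(ab | (ab \in edges_of q j s) && (idx (cn j ab) == i)) (1 : Z).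
Proof.
rewrite mxE card_sum [RHS]big_mkcond; apply: eq_bigr => ab _.
have [|] := boolP (ab \in edges_of q j s) => //= h.
move: (h); rewrite inE => /andP[/lt_neq4 h1 _].
have -> : `[< exists w, around T (cn j ab) w (e i) >] = (idx (cn j ab) == i).
  by apply/asboolP/eqP => [/(idxP _ _ h1)|] <- //; apply/(idxP _ _ h1).
by case: (_ == _).
Qed.

Lemma Gk_entry (Z : pzRingType) m s i j : (Gk T q e alpha pT pE m s i j)%:~R =
  \sum_(ab | (ab \in edges_of q j s) && (idx (cn j ab) == i)) ((m == k (cn j ab))%:R : Z).
Proof.
rewrite mxE card_sum [RHS]big_mkcond; apply: eq_bigr => ab _.
have [|] := boolP (ab \in edges_of q j s) => //= h.
move: (h); rewrite inE => /andP[/lt_neq4 h1 _].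
set Q := `[< _ >]; have -> : Q = (idx (cn j ab) == i) && (m == k (cn j ab)).
  apply/asboolP/andP => [/(kP _ _ _ h1)[-> ->]|[/eqP<- /eqP->]]; first by rewrite !eqxx.
  exact/(kP _ _ _ h1).
by case: (_ == _).
Qed.

Lemma Gt_entry s i j : Gt T K q e alpha pT pE s i j =
  \sum_(ab | (ab \in edges_of q j s) && (idx (cn j ab) == i)) tvar K ^ k (cn j ab).
Proof.
rewrite mxE; pose r := undup [seq k (cn j ab) | ab : 'I_4 * 'I_4].
have kr ab : k (cn j ab) \in r by rewrite mem_undup; apply/mapP; exists ab; rewrite ?mem_enum.
rewrite (@fsbigE _ _ _ _ _ r) ?undup_uniq //; last first.
  move=> m _ nr; rewrite Gk_entry big1 ?mul0r // => ab _.
  by case: eqP nr => // ->; rewrite kr.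
under eq_bigr => m _ do rewrite Gk_entry mulr_suml.
rewrite exchange_big /=; apply: eq_bigr => ab _.
rewrite big_mkcond (bigD1_seq (k (cn j ab))) ?undup_uniq //= in_setT eqxx mul1r.
rewrite big1 ?addr0 // => m /negPf->; rewrite mul0r.
by case: ifP.
Qed.

Definition edge_zeta i j : K :=
  \sum_(ab : 'I_4 * 'I_4 | (ab.1 < ab.2)%N && (idx (cn j ab) == i))
    zt (label q j ab.1 ab.2) j.

Lemma G_zeta i j : \sum_s (G T q e s i j)%:~R * zt s j = edge_zeta i j.
Proof.
rewrite /edge_zeta -(sum_labels _ (fun ab => idx (cn j ab) == i) (fun _ s => zt s j)).
by apply: eq_bigr => s _; rewrite G_entry mulr_suml; apply: eq_bigr => ab _; rewrite mul1r.
Qed.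

(** Multiplying the matrix by this power of [t] makes all exponents nonnegative. *)
Definition kbound : nat := \max_x `|k x|%N.

Definition twisted_poly : 'M[{poly K}]_n.+1 := \matrix_(i, j)
  \sum_(ab : 'I_4 * 'I_4 | (ab.1 < ab.2)%N && (idx (cn j ab) == i))
    (zt (label q j ab.1 ab.2) j)%:P * 'X^(absz (k (cn j ab) + kbound%:Z)%R).

Lemma kbound_ge0 x : 0 <= k x + kbound%:Z.
Proof.
have : (`|k x| <= kbound)%N by rewrite /kbound; apply: leq_bigmax.
by lia.
Qed.

Lemma tvar_neq0 : tvar K != 0.
Proof. by rewrite /tvar tofrac_eq0 polyX_eq0. Qed.

Lemma twisted_matrixE :
  \sum_s Gt T K q e alpha pT pE s *m map_mx (@Defs.cst K) (diag_zeta z s) =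
  (tvar K ^+ kbound)^-1 *: map_mx (@FracField.tofrac {poly K}) twisted_poly.
Proof.
apply/matrixP => i j; rewrite summxE !mxE rmorph_sum mulr_sumr.
rewrite -(sum_labels _ (fun ab => idx (cn j ab) == i) (fun ab s => (tvar K ^+ kbound)^-1 *
  FracField.tofrac ((zt s j)%:P * 'X^(absz (k (cn j ab) + kbound%:Z)%R)))).
apply: eq_bigr => s _; rewrite mxE (bigD1 j) //= big1 ?addr0; last first.
  by move=> l /negPf lj; rewrite !mxE lj mulr0n /Defs.cst !rmorph0 mulr0.
rewrite Gt_entry !mxE eqxx mulr1n mulr_suml; apply: eq_bigr => ab _.
rewrite rmorphM rmorphXn /= -/(tvar K) -/(Defs.cst _) [in RHS]mulrCA mulrC; congr (_ * _).
have -> : tvar K ^+ absz (k (cn j ab) + kbound%:Z) = tvar K ^ (k (cn j ab) + kbound%:Z).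
  by rewrite -[in RHS](gez0_abs (kbound_ge0 _)).
rewrite expfzDr ?tvar_neq0 //.
by rewrite mulrC mulfK // -exprnP expf_neq0 ?tvar_neq0.
Qed.

Lemma det_twisted :
  \det (\sum_s Gt T K q e alpha pT pE s *m map_mx (@Defs.cst K) (diag_zeta z s)) =
  FracField.tofrac (\det twisted_poly) / tvar K ^+ (kbound * n.+1).
Proof.
by rewrite twisted_matrixE detZ det_map_mx exprVn exprM mulrC.
Qed.

Lemma twisted_poly1 i j : (twisted_poly i j).[1] = edge_zeta i j.
Proof.
rewrite mxE horner_sum; apply: eq_bigr => ab _.
by rewrite hornerCM hornerXn expr1n mulr1.
Qed.

Definition edge_deriv j : K :=
  \sum_(ab : 'I_4 * 'I_4 | (ab.1 < ab.2)%N) (k (cn j ab))%:~R * zt (label q j ab.1 ab.2) j.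

Lemma sum_edges (Z : nmodType) j (F : 'I_4 * 'I_4 -> Z) :
  \sum_i \sum_(ab : 'I_4 * 'I_4 | (ab.1 < ab.2)%N && (idx (cn j ab) == i)) F ab =
  \sum_(ab : 'I_4 * 'I_4 | (ab.1 < ab.2)%N) F ab.
Proof.
by rewrite (partition_big (fun ab => idx (cn j ab)) predT) //.
Qed.

Lemma sum_lt (Z : nmodType) (F : 'I_4 * 'I_4 -> Z) :
  \sum_(ab : 'I_4 * 'I_4 | (ab.1 < ab.2)%N) F ab =
  F (o0, o1) + F (o0, o2) + F (o0, o3) + F (o1, o2) + F (o1, o3) + F (o2, o3).
Proof.
transitivity (\sum_(a : 'I_4) \sum_(b : 'I_4) if (a < b)%N then F (a, b) else 0).
  by rewrite pair_bigA big_mkcond; apply: eq_bigr => -[].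
by rewrite sum_ord4 !sum_ord4 /= !(add0r, addr0) !addrA.
Qed.

Hypothesis hz : forall j, z j != 0 /\ z j != 1.

Lemma sum_zeta j : \sum_s zt s j = 0.
Proof.
rewrite !big_ord_recl big_ord0 /= /zeta /= addr0; have [z0 z1] := hz j.
have : 1 - z j != 0 by rewrite subr_eq0 eq_sym.
have : z j - 1 != 0 by rewrite subr_eq0.
by move=> h1 h2; field; rewrite z0 h1 h2.
Qed.

Lemma sum_zeta_edges j : \sum_(ab : 'I_4 * 'I_4 | (ab.1 < ab.2)%N) zt (label q j ab.1 ab.2) j = 0.
Proof.
rewrite sum_lt /= /label /zeta; have [z0 z1] := hz j.
have h1 : 1 - z j != 0 by rewrite subr_eq0 eq_sym.
have h2 : z j - 1 != 0 by rewrite subr_eq0.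
by case: (q j) => [[|[|[|m]]] hm] //=; field; rewrite z0 h1 h2.
Qed.

End TwistedMatrix.

(** * The row of a curve modulo the rows of the edges *)

Section CurveRow.
Variables (n : nat) (T : gluing n) (q : 'I_n.+1 -> 'I_3)
  (e : 'I_n.+1 -> 'I_n.+1 * 'I_4 * 'I_4) (K : numFieldType) (z : 'I_n.+1 -> K).
Hypothesis hT : oriented_gluing T.
Hypothesis hz : forall j, z j != 0 /\ z j != 1.
Local Notation tet := 'I_n.+1.
Local Notation zt := (zeta z).
Variables (idx : tet * 'I_4 * 'I_4 -> tet) (k : tet * 'I_4 * 'I_4 -> int).
Hypothesis idxP : forall j a b i, a != b ->
  (exists w, around T (j, a, b) w (e i)) <-> i = idx (j, a, b).
Hypothesis k_sym : forall j a b, a != b -> k (j, b, a) = k (j, a, b).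

Lemma sum_flags (Z : nmodType) j (F : 'I_4 -> 'I_4 -> Z) :
  \sum_(f : flag n | ft f == j) F (fr f o0) (fr f o1) = \sum_v \sum_(w | w != v) F v w.
Proof.
rewrite pair_big_dep /=.
rewrite (partition_big (fun f : flag n => (fr f o0, fr f o1)) (fun p => p.2 != p.1)) /=; last first.
  by move=> f _; rewrite (inj_eq perm_inj).
apply: eq_bigr => -[v w] /= wv; have [d [dj dv dw]] := corner_surj j wv.
rewrite (big_pred1 d) ?dv ?dw // => f; rewrite xpair_eqE /=.
apply/idP/eqP => [/and3P[/eqP h1 /eqP h2 /eqP h3]|->]; last by rewrite dj dv dw !eqxx.
by apply: corner_inj; rewrite ?dj ?dv ?dw.
Qed.

Lemma sum_pairs (F : 'I_4 -> 'I_4 -> K) : \sum_v \sum_(w | w != v) F v w =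
  \sum_(ab : 'I_4 * 'I_4 | (ab.1 < ab.2)%N) (F ab.1 ab.2 + F ab.2 ab.1).
Proof.
under eq_bigr => v _ do rewrite big_mkcond sum_ord4.
by rewrite sum_lt sum_ord4 /=; ring.
Qed.

Lemma ccw_neq (v a b : 'I_4) : ccw v v a b = false.
Proof.
apply/negbTE/negP => vv; case/existsP: vv => p /and5P[_ /eqP h0 /eqP h1 _ _].
by have := @perm_inj _ p o0 o1; rewrite h0 h1 => /(_ erefl).
Qed.

Lemma label_sym j a b : label q j a b = label q j b a.
Proof. by rewrite /label /prime_label /opp_pair (addnC a b). Qed.

Definition flag_zeta (f : flag n) : K := zt (label q (ft f) (fr f o0) (fr f o1)) (ft f).

Lemma flag_zeta3 f : flag_zeta f + flag_zeta (fnxt f) + flag_zeta (fnxt (fnxt f)) = 0.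
Proof.
have [k0 k1 k2 k3 k4] := fr_nxt f; have [m0 m1 m2 m3 m4] := fr_nxt (fnxt f).
rewrite /flag_zeta m0 m1 m2 k0 k1 k2 k4.
have h12 : ccw (fr f o0) (fr f o1) (fr f o2) (fr f o3) by rewrite ccw_flag !eqxx.
have h23 : ccw (fr f o0) (fr f o2) (fr f o3) (fr f o1) by rewrite ccw_flag !eqxx !orbT.
have := prime_label_ccw (q (ft f)) h12; have := prime_label_ccw (q (ft f)) h23.
rewrite -!/(label q (ft f) _ _) -(sum_zeta hz (ft f)).
suff key (s1 s2 s3 : 'I_3) j : s3 = (s2.+1 %% 3)%N :> nat ->
  s2 = (s1.+1 %% 3)%N :> nat ->
  zt s1 j + zt s3 j + zt s2 j = \sum_s zt s j by exact: key.
rewrite !big_ord_recl big_ord0 addr0 /zeta.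
move: s1 s2 s3 => [[|[|[|m]]] hm] [[|[|[|m']]] hm'] [[|[|[|m'']]] hm''] //= _ _; ring.
Qed.

(** The corners of each triangle carry the three [zeta] of the tetrahedron, which add up to zero.
    Rotating the flags produces three copies of the sum, and 3 is invertible in characteristic
    zero. *)
Lemma sum_invariant_zeta j (D : flag n -> K) : (forall f, D (fnxt f) = D f) ->
  \sum_(f : flag n | ft f == j) D f * flag_zeta f = 0.
Proof.
move=> hD; set S := LHS.
have rot (F : flag n -> K) : \sum_(f : flag n | ft f == j) F (fnxt f) = \sum_(f : flag n | ft f == j) F f.
  rewrite [RHS](reindex_inj (@fnxt_inj n)) /=; apply: eq_bigl => f.
  by have [-> _ _ _ _] := fr_nxt f.
have h1 : S = \sum_(f : flag n | ft f == j) D f * flag_zeta (fnxt f).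
  by rewrite /S -rot; apply: eq_bigr => f _; rewrite hD.
have h2 : S = \sum_(f : flag n | ft f == j) D f * flag_zeta (fnxt (fnxt f)).
  by rewrite h1 -rot; apply: eq_bigr => f _; rewrite hD.
have : S + S + S = 0.
  rewrite {2}h1 {2}h2 -!big_split /= big1 // => f _.
  by rewrite -!mulrDr flag_zeta3 mulr0.
move=> S3; have : S *+ 3 = 0 by rewrite mulrS mulr2n addrA.
by move/eqP; rewrite mulrn_eq0 => /eqP.
Qed.

Variables (d0 : flag n) (ds' : seq (flag n)).
Let ds := d0 :: ds'.
Let c := [seq cr d | d <- ds].
Hypothesis dsP : path.cycle (flag_step hT) ds.
Variables (eps : K) (h : vert T -> K).
Let Kf (f : flag n) : int := k (ft f, fr f o0, fr f o1).
Hypothesis crossingE : forall f, (crossing_number hT ds f)%:~R =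
  eps * (Kf f - Kf (fnxt f))%:~R + (h (fvert hT f) - h (fvert hT (fnxt f))).

Lemma Cv_zeta j : \sum_s (Cv T q c s ord0 j)%:~R * zt s j =
  \sum_(f : flag n | ft f == j) (corner_coef T c (ft f) (fr f o0) (fr f o1))%:~R * flag_zeta f.
Proof.
pose F v w := (corner_coef T c j v w)%:~R * zt (label q j v w) j.
transitivity (\sum_(f : flag n | ft f == j) F (fr f o0) (fr f o1)); last first.
  by apply: eq_bigr => f /eqP jE; rewrite /F /flag_zeta jE.
rewrite sum_flags; transitivity (\sum_v \sum_w F v w); last first.
  apply: eq_bigr => v _; rewrite (bigD1 v) //= [X in X + _](_ : _ = 0) ?add0r //.
  rewrite /F /corner_coef big1 ?mul0r // => A _.
  by rewrite /corner_sign !ccw_neq.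
transitivity (\sum_s \sum_v \sum_(w | label q j v w == s) F v w).
  apply: eq_bigr => s _; rewrite Cv_corner_coef rmorph_sum mulr_suml; apply: eq_bigr => v _.
  by rewrite rmorph_sum mulr_suml; apply: eq_bigr => w /eqP <-.
rewrite exchange_big; apply: eq_bigr => v _ /=.
by rewrite [RHS](partition_big (label q j v) predT).
Qed.

(** A vertex of the link is an end of an edge of the triangulation; adding [h] over both ends gives
    a function of unoriented edges, that is, coefficients for the rows. *)
Let hh j v w : K := at_corner (fun f => h (fvert hT f)) 0 j v w + at_corner (fun f => h (fvert hT f)) 0 j w v.

Lemma hh_around x w y : around T x w y -> x.1.2 != x.2 ->
  hh y.1.1 y.1.2 y.2 = hh x.1.1 x.1.2 x.2.
Proof.
elim=> //= [j a b ab|j a b f v y' fa fb _ IH ab]; first by rewrite /hh addrC.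
rewrite IH ?(inj_eq perm_inj) // /hh.
rewrite !(@at_corner_step _ _ hT _ _ (fun _ _ => 0)) ?addr0 // 1?eq_sym //.
all: by move=> *; rewrite ?fvert_turn ?addr0 ?oppr0.
Qed.

(** The corner coefficients and [eps * K + h] have the same differences along sides, so they differ
    by a function of the triangle, which contributes zero. The two corners of an edge share the same
    [k], which gives [2 * eps], and their values of [h] add up to [hh]. *)
Lemma Cv_row : exists H : tet -> K, forall j,
  \sum_s (Cv T q c s ord0 j)%:~R * zt s j =
  2 * eps * edge_deriv q z k j + \sum_i H i * edge_zeta q z idx i j.
Proof.
exists (fun i => hh (e i).1.1 (e i).1.2 (e i).2) => j; rewrite Cv_zeta.
have rearrange (x y E u u' v v' : K) : x - y = E * (u - u') + (v - v') ->
  y - (E * u' + v') = x - (E * u + v) by move/(canRL (subrK _))->; ring.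
pose ha j v w := at_corner (fun f => h (fvert hT f)) 0 j v w.
pose F v w := (eps * (k (j, v, w))%:~R + ha j v w) * zt (label q j v w) j.
transitivity (\sum_(f : flag n | ft f == j) F (fr f o0) (fr f o1)).
  apply/eqP; rewrite -subr_eq0 -sumrB; apply/eqP.
  pose D f := (corner_coef T c (ft f) (fr f o0) (fr f o1))%:~R
    - (eps * (Kf f)%:~R + h (fvert hT f)).
  rewrite -[RHS](@sum_invariant_zeta j D) => [|f]; last first.
    have [m0 m1 m2 m3 m4] := fr_nxt f.
    have := corner_coef_flag f dsP; rewrite -/ds -/c => /(congr1 (fun m : int => m%:~R : K)).
    rewrite crossingE intrB (intrB _ (Kf f)) /D m0 m1 m2; exact: rearrange.
  apply: eq_bigr => f /eqP jE; rewrite /D /F /flag_zeta /ha /Kf jE mulrBl; congr (_ - (_ + _) * _).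
  by rewrite -jE at_cornerE.
rewrite sum_flags sum_pairs /edge_deriv mulr_sumr.
transitivity (\sum_(ab : 'I_4 * 'I_4 | (ab.1 < ab.2)%N)
  (2 * eps * ((k (j, ab.1, ab.2))%:~R * zt (label q j ab.1 ab.2) j)
   + hh j ab.1 ab.2 * zt (label q j ab.1 ab.2) j)).
  apply: eq_bigr => ab /lt_neq4 ab0.
  rewrite /F /hh -!/(ha _ _ _) (label_sym j ab.2 ab.1) (k_sym j ab0).
  move: (ha _ _ _) (ha _ _ _) (zt _ _) => x y u; ring.
rewrite big_split; congr (_ + _) => /=.
rewrite -(sum_edges idx j); apply: eq_bigr => i _; rewrite mulr_sumr; apply: eq_bigr => ab /andP[/lt_neq4 ab0 /eqP iE].
congr (_ * _); have [w /hh_around h1] : exists w, around T (j, ab.1, ab.2) w (e i) by apply/idxP.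
by rewrite h1.
Qed.

End CurveRow.

Section Derivative.
Variables (n : nat) (T : gluing n) (q : 'I_n.+1 -> 'I_3)
  (e : 'I_n.+1 -> 'I_n.+1 * 'I_4 * 'I_4) (K : numFieldType) (z : 'I_n.+1 -> K)
  (alpha : seq 'I_4 -> int) (pT pE : 'I_n.+1 -> seq 'I_4).
Hypothesis hz : forall j, z j != 0 /\ z j != 1.
Local Notation tet := 'I_n.+1.
Local Notation zt := (zeta z).
Variables (idx : tet * 'I_4 * 'I_4 -> tet) (k : tet * 'I_4 * 'I_4 -> int).
Hypothesis idxP : forall j a b i, a != b ->
  (exists w, around T (j, a, b) w (e i)) <-> i = idx (j, a, b).
Hypothesis kP : forall j a b i m, a != b ->
  (exists2 w, around T (j, a, b) w (e i)
    & m + alpha (pT j ++ w ++ rev_walk T (base n) (pE i)) = 0) <->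
  i = idx (j, a, b) /\ m = k (j, a, b).

Local Notation P := (twisted_poly q z idx k).

Lemma sum_twisted_poly j :
  \sum_i P i j = \sum_(ab : 'I_4 * 'I_4 | (ab.1 < ab.2)%N)
    (zt (label q j ab.1 ab.2) j)%:P * 'X^(absz (k (j, ab.1, ab.2) + (kbound k)%:Z)%R).
Proof. by rewrite -(sum_edges idx j); apply: eq_bigr => i _; rewrite mxE. Qed.

Lemma sum_twisted_poly1 j : (\sum_i P i j).[1] = 0.
Proof.
rewrite sum_twisted_poly horner_sum -[RHS](sum_zeta_edges q hz j).
by apply: eq_bigr => ab _; rewrite hornerCM hornerXn expr1n mulr1.
Qed.

(** The shift of the exponents by [kbound] contributes a multiple of the sum of [zeta] over all
    edges of the tetrahedron, which is zero. *)
Lemma deriv_sum_twisted_poly j : (\sum_i P i j)^`().[1] = edge_deriv q z k j.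
Proof.
rewrite sum_twisted_poly raddf_sum horner_sum.
transitivity (edge_deriv q z k j + (kbound k)%:R *
    \sum_(ab : 'I_4 * 'I_4 | (ab.1 < ab.2)%N) zt (label q j ab.1 ab.2) j).
  rewrite mulr_sumr -big_split /=; apply: eq_bigr => ab _.
  rewrite derivM derivC mul0r add0r derivXn hornerCM hornerMn hornerXn expr1n.
  set m := absz _; have -> : (m%:R : K) = (k (j, ab.1, ab.2) + (kbound k)%:Z)%:~R.
    by rewrite -[in RHS](gez0_abs (kbound_ge0 k _)).
  by rewrite intrD; ring.
by rewrite sum_zeta_edges // mulr0 addr0.
Qed.

Variables (c : seq (crossing n)) (eps : K) (H : tet -> K).
Hypothesis CvE : forall j, \sum_s (Cv T q c s ord0 j)%:~R * zt s j =
  2 * eps * edge_deriv q z k j + \sum_i H i * edge_zeta q z idx i j.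

Lemma det_Ghat :
  \det (\sum_s map_mx (fun m : int => m%:~R) (Ghat T q e c s) *m diag_zeta z s) =
  2 * eps * (\det P)^`().[1].
Proof.
have [_ ->] := det_row_sum sum_twisted_poly1.
have ent i j : (\sum_s map_mx (fun m : int => m%:~R) (Ghat T q e c s) *m diag_zeta z s) i j =
    \sum_s (Ghat T q e c s i j)%:~R * zt s j.
  rewrite summxE; apply: eq_bigr => s _; rewrite mxE (bigD1 j) //= big1 ?addr0.
    by rewrite !mxE eqxx mulr1n.
  by move=> l /negPf lj; rewrite !mxE lj mulr0n mulr0.
(* The last edge row has been replaced in [Ghat], so it is eliminated through the vanishing sum of
   all edge rows; this is why the coefficients below are [H i - H ord_max]. *)
have max0 j : edge_zeta q z idx ord_max j = - \sum_(i | i != ord_max) edge_zeta q z idx i j.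
  have := sum_twisted_poly1 j; rewrite horner_sum (bigD1 ord_max) //= twisted_poly1.
  under eq_bigr => i _ do rewrite twisted_poly1.
  by move/eqP; rewrite addr_eq0 => /eqP.
apply: (det_last_row (l := fun i => H i - H ord_max)) => [i j ni|j].
  rewrite ent mxE (negPf ni) twisted_poly1 -(G_zeta q z idxP).
  by apply: eq_bigr => s _; rewrite [Ghat _ _ _ _ _ _ _]mxE (negPf ni).
rewrite ent !mxE eqxx deriv_sum_twisted_poly.
transitivity (\sum_s (Cv T q c s ord0 j)%:~R * zt s j).
  by apply: eq_bigr => s _; rewrite mxE eqxx.
rewrite CvE (bigD1 ord_max) //= max0 mulrN -mulNr; congr (_ + _).
rewrite mulr_sumr -big_split; apply: eq_bigr => i /= ni.
by rewrite mxE (negPf ni) twisted_poly1 mulrBl addrC mulNr.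
Qed.

(** As the value at 1 is zero, neither the unit [t ^ r] nor the power of [t] in the denominator
    affects the derivative there. The 2 of [det_Ghat] cancels against [one_loop]. *)
Lemma twisted_derivative (f : 'I_3 -> 'cV[int]_n.+1) (b : bool) : eps = (-1) ^+ b ->
  forall (s : bool) (r : int),
  let tau := (-1) ^+ s * tvar K ^ r * twisted_one_loop T z q e alpha pT pE f in
  laurent_value1 tau 0 /\
  laurent_deriv1 tau ((-1) ^+ (s (+) b) * one_loop T z q e f c).
Proof.
move=> epsE s r tau.
pose Q := (((-1) ^+ s * (zeta_power z f)^-1) *: \det P).
have [detP1 _] := det_row_sum sum_twisted_poly1.
have Q1 : Q.[1] = 0 by rewrite hornerZ detP1 mulr0.
have dQ : Q^`().[1] = (-1) ^+ (s (+) b) * one_loop T z q e f c.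
  rewrite /Q derivZ hornerZ /one_loop det_Ghat epsE signr_addb.
  have n2 : (2 : K) != 0 by rewrite pnatr_eq0.
  have b2 : (-1) ^+ b * (-1) ^+ b = 1 :> K by rewrite -expr2 sqrr_sign.
  rewrite invfM; set x := (_).[1]; set y := (zeta_power z f)^-1.
  transitivity ((-1) ^+ s * y * x * ((-1) ^+ b * (-1) ^+ b)); first by rewrite b2 mulr1.
  by field.
have tauE : tau = tvar K ^ r * (FracField.tofrac Q / tvar K ^+ (kbound k * n.+1)).
  rewrite /tau /twisted_one_loop (det_twisted q z kP).
  have -> : (Defs.cst (zeta_power z f))^-1 = Defs.cst (zeta_power z f)^-1.
    by rewrite -[Defs.cst _]/((@FracField.tofrac {poly K} \o polyC) _) -fmorphV.
  have -> : FracField.tofrac Q = (-1) ^+ s * Defs.cst (zeta_power z f)^-1 * FracField.tofrac (\det P).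
    by rewrite /Q -mul_polyC !rmorphM /= !rmorphXn /= !rmorphN1.
  by ring.
have t0 := tvar_neq0 K.
move: tau tauE; case: r => r tau tauE.
  have tE : tau = FracField.tofrac (Q * 'X^r) / tvar K ^+ (kbound k * n.+1).
    by rewrite tauE rmorphM rmorphXn /= -/(tvar K) -exprnP; ring.
  split; exists (kbound k * n.+1)%N, (Q * 'X^r); split=> //; first by rewrite hornerM Q1 mul0r.
  by rewrite derivM hornerD !hornerM Q1 !mul0r mulr0 subr0 addr0 hornerXn expr1n mulr1.
have tE : tau = FracField.tofrac Q / tvar K ^+ (r.+1 + kbound k * n.+1).
  by rewrite tauE NegzE -exprnN exprD invfM mulrCA mulrA.
split; exists (r.+1 + kbound k * n.+1)%N, Q; split=> //.
by rewrite Q1 mulr0 subr0.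
Qed.
End Derivative.

(** * Parabolic elements and the trace field *)

(** The map sending [x] to [1 / (1 - x)] has order three, so the cycle of shapes may be started at
    any of its members, whatever the quad type. *)
Lemma mobius_cycle (K : fieldType) (x : K) (q : 'I_3) m
    (S := fun m => nth 0 [:: x; (1 - x)^-1; 1 - x^-1] ((m + 3 - q) %% 3)%N) :
  x != 0 -> x != 1 -> (m < 3)%N ->
  S m = nth 0 [:: S 0; (1 - S 0)^-1; 1 - (S 0)^-1] m.
Proof.
rewrite {}/S => x0 x1.
have n1 : x - (x - 1) != 0 by have -> : x - (x - 1) = 1 by [ring]; rewrite oner_neq0.
have n2 : 1 - x - 1 != 0 by have -> : 1 - x - 1 = - x by [ring]; rewrite oppr_eq0.
have nz : 1 - x != 0 by rewrite subr_eq0 eq_sym.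
have nz' : x - 1 != 0 by rewrite subr_eq0.
case: q => [[|[|[|m']]] hm] //; case: m => [|[|[|m]]] //= _;
field; rewrite ?oner_eq0 ?x0 ?nz ?nz' ?n1 ?n2 //.
Qed.

Section Holonomy.
Variables (C : fieldType) (n : nat) (T : gluing n).
Local Notation tet := 'I_n.+1.
Local Notation gt := (glue_tet T).
Local Notation gp := (glue_perm T).
Variables (q : tet -> 'I_3) (z : tet -> C) (A : tet -> 'I_4 -> 'M[C]_2).
Hypothesis hT : oriented_gluing T.
Hypothesis hz : forall j, z j != 0 /\ z j != 1.
Local Notation edge_shape j a b := (shape_param z (label q j a b) j).
Local Notation S0 j := (edge_shape j o0 o1).

(** The formula of [std_vertex] over an arbitrary field. *)
Definition vertex (j : tet) (v : 'I_4) : 'cV[C]_2 :=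
  \col_i nth 0 [:: nth 0 [:: 1; 0; 1; S0 j] v; nth 0 [:: 0; 1; 1; 1] v] i.
Local Notation X := vertex.

Hypothesis hA : forall j f, A j f \in unitmx /\
  forall v, v != f -> exists c : C, A j f *m X (gt j f) (gp j f v) = c *: X j v.

Definition bracket (x y : 'cV[C]_2) : C := x ord0 ord0 * y ord_max ord0 - y ord0 ord0 * x ord_max ord0.

Lemma det_mx22 (M : 'M[C]_2) :
  \det M = M ord0 ord0 * M ord_max ord_max - M ord0 ord_max * M ord_max ord0.
Proof.
have E : lift ord0 ord0 = ord_max :> 'I_2 by apply: val_inj.
have E' : lift ord_max ord0 = ord0 :> 'I_2 by apply: val_inj.
rewrite (expand_det_row _ ord0) !big_ord_recl big_ord0 /cofactor !det_mx11 !mxE E E' /=.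
by rewrite expr0 expr1 addr0; ring.
Qed.

Lemma bracket_mul (M : 'M[C]_2) x y : bracket (M *m x) (M *m y) = \det M * bracket x y.
Proof.
rewrite /bracket !mxE !big_ord_recl !big_ord0 det_mx22 !addr0.
have -> : lift ord0 ord0 = ord_max :> 'I_2 by apply: val_inj.
by ring.
Qed.

Lemma bracket_scale a b x y : bracket (a *: x) (b *: y) = a * b * bracket x y.
Proof. by rewrite /bracket !mxE; ring. Qed.

Lemma bracket_anti x y : bracket y x = - bracket x y.
Proof. by rewrite /bracket opprB; ring. Qed.

Lemma shape_nz s j : shape_param z s j != 0 /\ shape_param z s j != 1.
Proof.
have [z0 z1] := hz j; have nz : 1 - z j != 0 by rewrite subr_eq0 eq_sym.
case: s => [[|[|[|m]]] hm] //; rewrite /shape_param /=; split=> //.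
- by rewrite invr_eq0.
- by rewrite invr_eq1 -subr_eq0 addrAC subrr add0r oppr_eq0.
- by rewrite subr_eq0 eq_sym invr_eq1.
- by rewrite -subr_eq0 addrAC subrr add0r oppr_eq0 invr_eq0.
Qed.

Lemma edge_shapeE j a b : (opp_pair a b < 3)%N ->
  edge_shape j a b = nth 0 [:: S0 j; (1 - S0 j)^-1; 1 - (S0 j)^-1] (opp_pair a b).
Proof. by have [z0 z1] := hz j; apply: mobius_cycle. Qed.

Lemma bracket_vertex j v w : bracket (X j v) (X j w) =
  nth 0 [:: 1; 0; 1; S0 j] v * nth 0 [:: 0; 1; 1; 1] w
  - nth 0 [:: 1; 0; 1; S0 j] w * nth 0 [:: 0; 1; 1; 1] v.
Proof. by rewrite /bracket !mxE. Qed.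

Lemma bracket_neq0 j v w : v != w -> bracket (X j v) (X j w) != 0.
Proof.
rewrite bracket_vertex; have [s0 s1] := shape_nz (label q j o0 o1) j.
have s1' : 1 - S0 j != 0 by rewrite subr_eq0 eq_sym.
have s1'' : S0 j - 1 != 0 by rewrite subr_eq0.
by case: (ord4E v) => ->; case: (ord4E w) => -> //= _;
  rewrite ?mulr1 ?mul1r ?mulr0 ?mul0r ?subr0 ?sub0r ?oppr_eq0 ?oner_neq0.
Qed.

(* With [v] sent to infinity, this is the difference of the positions of [b] and [a],
   up to a factor depending on the choice of coordinates only. *)
Definition gap j v a b : C := bracket (X j a) (X j b) / (bracket (X j v) (X j a) * bracket (X j v) (X j b)).

Lemma gap_neq0 j v a b : uniq [:: v; a; b] -> gap j v a b != 0.
Proof.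
rewrite /= !inE negb_or andbT => /andP[/andP[va vb] ab].
by rewrite mulf_neq0 ?invr_neq0 ?mulf_neq0 ?bracket_neq0.
Qed.

Definition side_gap (d : flag n) : C := gap (ft d) (fr d o0) (fr d o1) (fr d o3).

Lemma side_gap_neq0 d : side_gap d != 0.
Proof. by apply: gap_neq0; rewrite /= !inE !(inj_eq perm_inj). Qed.

Lemma gap_anti j v a b : gap j v b a = - gap j v a b.
Proof. by rewrite /gap bracket_anti mulNr (mulrC (bracket (X j v) (X j b))). Qed.

Lemma even_ords (p : 'S_4) : ~~ odd_perm p -> ((p o0 : nat), (p o1 : nat), (p o2 : nat), (p o3 : nat)) \in
  [:: (0, 1, 2, 3); (0, 2, 3, 1); (0, 3, 1, 2); (1, 0, 3, 2); (1, 2, 0, 3); (1, 3, 2, 0);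
      (2, 0, 1, 3); (2, 1, 3, 0); (2, 3, 0, 1); (3, 0, 2, 1); (3, 1, 0, 2); (3, 2, 1, 0)]%N.
Proof.
rewrite odd_perm4.
have i01 := @perm_inj _ p o0 o1; have i02 := @perm_inj _ p o0 o2.
have i12 := @perm_inj _ p o1 o2; have i03 := @perm_inj _ p o0 o3.
have i13 := @perm_inj _ p o1 o3; have i23 := @perm_inj _ p o2 o3.
move: i01 i02 i12 i03 i13 i23; rewrite !tpermE4.
case: (ord4E (p o0)) => ->; case: (ord4E (p o1)) => -> // i01;
  try (by have := i01 erefl); case: (ord4E (p o2)) => -> // i02 i12;
  try (by have := i02 erefl); try (by have := i12 erefl);
  case: (ord4E (p o3)) => -> // i03 i13 i23;
  try (by have := i03 erefl); try (by have := i13 erefl); by have := i23 erefl.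
Qed.

(** With vertex [o0] at infinity, the shape is the ratio of the two sides of the triangle that leave
    corner [o1]. It is checked on the twelve even permutations. *)
Lemma gap_shape d : side_gap d =
  edge_shape (ft d) (fr d o0) (fr d o1) * gap (ft d) (fr d o0) (fr d o1) (fr d o2).
Proof.
have lt3 (a b : 'I_4) : (opp_pair a b < 3)%N.
  by case: (ord4E a) => ->; case: (ord4E b) => ->.
rewrite edge_shapeE // /side_gap /gap !bracket_vertex /opp_pair.
have [s0 s1] := shape_nz (label q (ft d) o0 o1) (ft d); move: (S0 (ft d)) s0 s1 => S s0 s1.
have s1' : 1 - S != 0 by rewrite subr_eq0 eq_sym.
have s1'' : S - 1 != 0 by rewrite subr_eq0.
have := even_ords (fr_even d); rewrite !inE.
move: (fr d o0 : nat) (fr d o1 : nat) (fr d o2 : nat) (fr d o3 : nat) => v a b c.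
do 11? [case/orP]; move/eqP=> [-> -> -> ->] /=; field; rewrite ?s0 ?s1' ?s1'' //.
all: have ns : - S != 0 by [rewrite oppr_eq0].
all: have n1 : S - (S - 1) != 0 by have -> : S - (S - 1) = 1 by [ring]; rewrite oner_eq0.
all: have n2 : 1 - S - 1 != 0 by have -> : 1 - S - 1 = - S by [ring].
all: rewrite ?oppr_eq0 ?oner_eq0 ?s0 ?s1' ?s1'' ?ns ?n1 ?n2 //.
Qed.

(** Two sides of a triangle are related by the shape at their common corner, or its inverse
    according to the turning direction; the sign comes from their opposite orientations at that
    corner. *)
Lemma arc_gap (p d : flag n) : fsrc p = fsrc d -> d != p ->
  side_gap d = - (\prod_w edge_shape (ft d) (fr d o0) w ^
    corner_sign (fr d o0) w (fr p o2) (fr d o2)) * side_gap p.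
Proof.
have [k k0 k1 k2 k3] := fr_nxt d; have [m m0 m1 m2 m3] := fr_nxt (fnxt d).
move=> /fsrc_fiber [] -> nd; first by rewrite eqxx in nd.
  rewrite (bigD1 (fr d o3)) //= big1 ?mulr1 => [|w wn]; last first.
    rewrite /corner_sign !ccw_flag ?m0 ?m1 ?m2 ?m3 ?k0 ?k1 ?k2 ?k3 !(inj_eq perm_inj) (negPf wn).
    by rewrite ?andbF.
  have -> : corner_sign (fr d o0) (fr d o3) (fr (fnxt d) o2) (fr d o2) = -1.
    by rewrite /corner_sign !ccw_flag ?k0 ?k1 ?k2 ?k3 !(inj_eq perm_inj).
  rewrite (gap_shape (fnxt d)) k k0 k1 k2 /side_gap gap_anti mulrA mulNr mulVf ?mulN1r //.
  by case: (shape_nz (label q (ft d) (fr d o0) (fr d o3)) (ft d)).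
rewrite (bigD1 (fr d o1)) //= big1 ?mulr1 => [|w wn]; last first.
  rewrite /corner_sign !ccw_flag ?m0 ?m1 ?m2 ?m3 ?k0 ?k1 ?k2 ?k3 !(inj_eq perm_inj) (negPf wn).
  by rewrite ?andbF.
have -> : corner_sign (fr d o0) (fr d o1) (fr (fnxt (fnxt d)) o2) (fr d o2) = 1.
  by rewrite /corner_sign !ccw_flag ?m0 ?m1 ?m2 ?m3 ?k0 ?k1 ?k2 ?k3 !(inj_eq perm_inj).
rewrite expr1z gap_shape /side_gap m m0 m1 m3 k k0 k2 k3.
by rewrite [in RHS]gap_anti mulNr mulrN opprK.
Qed.

Lemma exprz_sum (I : Type) (r : seq I) (P : pred I) (F : I -> int) (x : C) : x != 0 ->
  x ^ (\sum_(i <- r | P i) F i) = \prod_(i <- r | P i) x ^ F i.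
Proof. by move=> x0; apply: (big_morph (fun m : int => x ^ m)) => // a b; rewrite expfzDr. Qed.

Lemma prod_arcs (c : seq (crossing n)) :
  \prod_j \prod_s shape_param z s j ^ Cv T q c s ord0 j =
  \prod_(a <- arcs c) \prod_w edge_shape a.2.1.1 a.2.1.2 w ^
    corner_sign a.2.1.2 w (cr_inv T a.1).2 a.2.2.
Proof.
rewrite [RHS](partition_big (fun a : crossing n * crossing n => a.2.1.1) predT) //=.
apply: eq_bigr => j _.
transitivity (\prod_s \prod_(a <- arcs c | a.2.1.1 == j) \prod_(w | label q j a.2.1.2 w == s)
    edge_shape j a.2.1.2 w ^ corner_sign a.2.1.2 w (cr_inv T a.1).2 a.2.2).
  apply: eq_bigr => s _; have [s0 _] := shape_nz s j; rewrite mxE exprz_sum //.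
  by apply: eq_bigr => a _; rewrite exprz_sum //; apply: eq_bigr => w /eqP ->.
rewrite exchange_big /=; apply: eq_bigr => a /eqP jE.
by rewrite [RHS](partition_big (label q j a.2.1.2) predT) //= jE.
Qed.

(** The same side measured in the two adjacent triangles, with a sign for the reversed orientation:
    the dilation factor of the change of coordinates at the cusp. *)
Definition chi (d : flag n) : C := - side_gap (fopp hT d) / side_gap d.

Lemma chi_neq0 d : chi d != 0.
Proof. by rewrite mulf_neq0 ?oppr_eq0 ?invr_neq0 ?side_gap_neq0. Qed.

Lemma chi_opp d : chi (fopp hT d) = (chi d)^-1.
Proof. rewrite /chi foppK. by rewrite !mulNr invrN (invf_div (side_gap (fopp hT d))). Qed.

(** After one round along the curve the side gap returns to its initial value, having been
    multiplied by all the shapes cut off and all the [chi]; the shapes multiply to 1 by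
    completeness. *)
Lemma prod_chi d0 ds' (ds := d0 :: ds') : path.cycle (flag_step hT) ds ->
  \prod_j \prod_s shape_param z s j ^ Cv T q [seq cr d | d <- ds] s ord0 j = 1 ->
  \prod_(d <- ds) chi d = 1.
Proof.
move=> dsP; pose dd (i : 'I_(size ds)) := nth d0 ds i.
pose W i := \prod_w edge_shape (ft (dd i)) (fr (dd i) o0) w ^
    corner_sign (fr (dd i) o0) w (fr (fopp hT (dd (ord_pred i))) o2) (fr (dd i) o2).
have -> : \prod_j \prod_s shape_param z s j ^ Cv T q [seq cr d | d <- ds] s ord0 j = \prod_i W i.
  rewrite prod_arcs (big_nth (cr d0, cr d0)) size_arcs size_map big_mkord.
  apply: eq_bigr => i _; rewrite nth_arcs ?size_map // !(nth_map d0) ?ltn_mod //.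
  by rewrite -cr_opp.
move=> W1.
have -> : \prod_(d <- ds) chi d = \prod_i chi (dd i) by rewrite (big_nth d0) big_mkord.
have step i : side_gap (dd i) = W i * (chi (dd (ord_pred i)) * side_gap (dd (ord_pred i))).
  have [st nst] := index_step dsP i.
  by rewrite (arc_gap (esym st) nst) mulNr /chi divfK ?side_gap_neq0 // mulrN.
have re (F : 'I_(size ds) -> C) : \prod_i F (ord_pred i) = \prod_i F i.
  exact/esym/(reindex_inj (h := @ord_pred _) (@ord_pred_inj _)).
have : \prod_i side_gap (dd i) = \prod_i chi (dd i) * \prod_i side_gap (dd i).
  rewrite -{2}(re (fun i => side_gap (dd i))) -(re (fun i => chi (dd i))) -big_split.
  transitivity (\prod_i (W i * (chi (dd (ord_pred i)) * side_gap (dd (ord_pred i))))).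
    by apply: eq_bigr => i _; exact: step.
  by rewrite !big_split /= W1 mul1r.
have n0 : \prod_i side_gap (dd i) != 0.
  by apply/prodf_neq0 => i _; apply: side_gap_neq0.
by rewrite -{1}[\prod_i side_gap (dd i)]mul1r => /(mulIf n0) <-.
Qed.

(** A matrix that scales the vector of the cusp by [c] acts at the cusp with dilation determinant
    over [c ^+ 2]. Comparing the brackets of the three vertices of the face identifies it with
    [chi d]. *)
Lemma chi_det d : exists2 c : C, c != 0 &
  A (ft d) (fr d o2) *m X (ft (fopp hT d)) (fr (fopp hT d) o0) = c *: X (ft d) (fr d o0) /\
  \det (A (ft d) (fr d o2)) = chi d * c ^+ 2.
Proof.
have [uA AP] := hA (ft d) (fr d o2).
have [p1 p2 p3 p4 p5] := fr_opp hT d.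
have nf (a : 'I_4) : a != o2 -> fr d a != fr d o2 by rewrite (inj_eq perm_inj).
have [cv Ev] := AP _ (nf o0 isT); have [ca Ea] := AP _ (nf o1 isT); have [cb Eb] := AP _ (nf o3 isT).
pose M := A (ft d) (fr d o2); pose j' := gt (ft d) (fr d o2).
pose Y a := X j' (gp (ft d) (fr d o2) (fr d a)); pose Z a := X (ft d) (fr d a).
have D0 : \det M != 0 by rewrite -unitfE.
have nY a b : a != b -> bracket (Y a) (Y b) != 0 by move=> ab; rewrite bracket_neq0 ?(inj_eq perm_inj).
have nZ a b : a != b -> bracket (Z a) (Z b) != 0 by move=> ab; rewrite bracket_neq0 ?(inj_eq perm_inj).
have scale a b k l : M *m Y a = k *: Z a -> M *m Y b = l *: Z b ->
    k * l * bracket (Z a) (Z b) = \det M * bracket (Y a) (Y b).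
  by move=> Ha Hb; rewrite -bracket_mul Ha Hb bracket_scale.
have alg (D u v w x1 x2 x3 y1 y2 y3 : C) : D != 0 -> x1 != 0 -> x2 != 0 -> x3 != 0 ->
    y1 != 0 -> y2 != 0 -> y3 != 0 ->
    v * w * y1 = D * x1 -> u * v * y2 = D * x2 -> u * w * y3 = D * x3 ->
    u != 0 /\ D = (x1 / (x2 * x3)) / (y1 / (y2 * y3)) * u ^+ 2.
  move=> nD nx1 nx2 nx3 ny1 ny2 ny3 E1 E2 E3.
  have : u * v * y2 != 0 by rewrite E2 mulf_neq0.
  rewrite !mulf_eq0 !negb_or => /andP[/andP[nu nv] _].
  have : v * w * y1 != 0 by rewrite E1 mulf_neq0.
  rewrite !mulf_eq0 !negb_or => /andP[/andP[_ nw] _].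
  split=> //.
  have -> : x1 = v * w * y1 / D by rewrite E1 mulrC mulKf.
  have -> : x2 = u * v * y2 / D by rewrite E2 mulrC mulKf.
  have -> : x3 = u * w * y3 / D by rewrite E3 mulrC mulKf.
  by field; rewrite nD nu nv nw ny1 ny2 ny3.
have [nu DE] := alg _ _ _ _ _ _ _ _ _ _ D0 (nY o1 o3 isT) (nY o0 o1 isT) (nY o0 o3 isT)
  (nZ o1 o3 isT) (nZ o0 o1 isT) (nZ o0 o3 isT) (scale _ _ _ _ Ea Eb) (scale _ _ _ _ Ev Ea)
  (scale _ _ _ _ Ev Eb).
exists cv => //; split; first by rewrite p1 p2.
by rewrite -/M {1}DE /chi /side_gap p1 p2 p3 p5 gap_anti opprK.
Qed.
End Holonomy.

(** * Unipotent matrices of size two and their traces *)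

Section Plane.
Variable C : fieldType.
Implicit Types (x y : 'cV[C]_2) (M N : 'M[C]_2).

Lemma ord2E (i : 'I_2) : i = ord0 \/ i = ord_max.
Proof. by case: i => [[|[|m]] h] //; [left|right]; apply: val_inj. Qed.

Lemma lift2 : lift ord0 ord0 = ord_max :> 'I_2. Proof. exact: val_inj. Qed.

Lemma cV2P x y : x ord0 ord0 = y ord0 ord0 -> x ord_max ord0 = y ord_max ord0 -> x = y.
Proof. by move=> h0 h1; apply/matrixP => i j; rewrite !ord1; case: (ord2E i) => ->. Qed.

Lemma mulmx2 m N (A : 'M[C]_(2, m)) i j :
  (N *m A) i j = N i ord0 * A ord0 j + N i ord_max * A ord_max j.
Proof. by rewrite mxE !big_ord_recl big_ord0 addr0 lift2. Qed.

Lemma mx_kernel0 N x y : N *m x = 0 -> N *m y = 0 -> bracket x y != 0 -> N = 0.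
Proof.
move=> Nx Ny xy; have H i : N i ord0 = 0 /\ N i ord_max = 0.
  have := congr1 (fun M : 'cV[C]_2 => M i ord0) Nx; have := congr1 (fun M : 'cV[C]_2 => M i ord0) Ny.
  rewrite !mulmx2 !mxE => Ey Ex; split; apply: (mulIf xy); rewrite mul0r /bracket.
    transitivity ((N i ord0 * x ord0 ord0 + N i ord_max * x ord_max ord0) * y ord_max ord0
      - (N i ord0 * y ord0 ord0 + N i ord_max * y ord_max ord0) * x ord_max ord0); first by ring.
    by rewrite Ex Ey !mul0r subr0.
  transitivity ((N i ord0 * y ord0 ord0 + N i ord_max * y ord_max ord0) * x ord0 ord0
    - (N i ord0 * x ord0 ord0 + N i ord_max * x ord_max ord0) * y ord0 ord0); first by ring.
  by rewrite Ex Ey !mul0r subr0.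
by apply/matrixP => i j; rewrite [RHS]mxE; case: (ord2E j) => ->; case: (H i).
Qed.

Lemma three_eigenvectors M x1 x2 x3 c1 c2 c3 :
  M *m x1 = c1 *: x1 -> M *m x2 = c2 *: x2 -> M *m x3 = c3 *: x3 ->
  bracket x1 x2 != 0 -> bracket x1 x3 != 0 -> bracket x2 x3 != 0 -> M = c1%:M.
Proof.
move=> E1 E2 E3 n12 n13 n23.
have rel : bracket x1 x2 *: x3 = bracket x1 x3 *: x2 - bracket x2 x3 *: x1.
  by apply: cV2P; rewrite !mxE /bracket; ring.
have E : c3 *: (bracket x1 x3 *: x2 - bracket x2 x3 *: x1) = bracket x1 x3 *: (c2 *: x2) - bracket x2 x3 *: (c1 *: x1).
  by rewrite -rel -E1 -E2 !scalemxAr -mulmxBr -rel -scalemxAr E3 scalerA mulrC -scalerA.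
have c12 : c2 = c3.
  have := congr1 (bracket x1) E; have -> : bracket x1 (c3 *: (bracket x1 x3 *: x2 - bracket x2 x3 *: x1)) = c3 * bracket x1 x3 * bracket x1 x2.
    by rewrite /bracket !mxE; ring.
  have -> : bracket x1 (bracket x1 x3 *: (c2 *: x2) - bracket x2 x3 *: (c1 *: x1)) = c2 * bracket x1 x3 * bracket x1 x2.
    by rewrite /bracket !mxE; ring.
  by move/(mulIf n12)/(mulIf n13).
have c13 : c1 = c3.
  have := congr1 (fun u => bracket u x2) E; have -> : bracket (c3 *: (bracket x1 x3 *: x2 - bracket x2 x3 *: x1)) x2 = c3 * (- bracket x2 x3) * bracket x1 x2.
    by rewrite /bracket !mxE; ring.
  have -> : bracket (bracket x1 x3 *: (c2 *: x2) - bracket x2 x3 *: (c1 *: x1)) x2 = c1 * (- bracket x2 x3) * bracket x1 x2.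
    by rewrite /bracket !mxE; ring.
  by move/(mulIf n12)/mulIf; rewrite oppr_eq0 => /(_ n23).
apply/eqP; rewrite -subr_eq0; apply/eqP; apply: mx_kernel0 n12; rewrite mulmxBl mul_scalar_mx.
  by rewrite E1 subrr.
by rewrite E2 c12 c13 subrr.
Qed.

Definition perp x : 'rV[C]_2 := \row_i nth 0 [:: - x ord_max ord0; x ord0 ord0] i.

Lemma perp_mul x y : perp x *m y = (bracket x y)%:M.
Proof.
apply/matrixP => i j; rewrite !ord1 !mxE !big_ord_recl big_ord0 lift2 !mxE /= /bracket mulr1n.
by ring.
Qed.

Lemma line_mul x y u v : (x *m perp y) *m (u *m perp v) = bracket y u *: (x *m perp v).
Proof. by rewrite mulmxA -(mulmxA x) perp_mul mul_mx_scalar -scalemxAl. Qed.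

Lemma line_trace x y : \tr (x *m perp y) = bracket y x.
Proof. by rewrite mxtrace_mulC perp_mul /mxtrace big_ord1 mxE eqxx. Qed.

Lemma line_trace2 x y a b :
  \tr ((a *: (x *m perp x)) *m (b *: (y *m perp y))) = - (a * b * bracket x y ^+ 2).
Proof.
rewrite -scalemxAl -scalemxAr line_mul !mxtraceZ line_trace (bracket_anti x y); ring.
Qed.

Lemma line_trace4 x y z w a b c d :
  \tr ((a *: (x *m perp x)) *m (b *: (y *m perp y)) *m (c *: (z *m perp z)) *m (d *: (w *m perp w))) =
  a * b * c * d * (bracket x y * bracket y z * bracket z w * bracket w x).
Proof.
do 3 rewrite -?scalemxAl -?scalemxAr line_mul.
by rewrite !mxtraceZ line_trace; ring.
Qed.

(** [N = M - 1] kills [x], so its determinant vanishes; then [\det M = 1] forces its trace to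
    vanish, and a nilpotent matrix with kernel containing [x] is a multiple of [x *m perp x]. *)
Lemma unipotent_form M x y : \det M = 1 -> M *m x = x -> bracket x y != 0 ->
  exists m, M = 1%:M + m *: (x *m perp x).
Proof.
move=> dM Mx xy; have [N ME] : exists N, M = 1%:M + N by exists (M - 1%:M); rewrite addrC subrK.
have x0 : x != 0 by apply: contra_neq xy => ->; rewrite /bracket !mxE; ring.
have Nx : N *m x = 0.
  by move: Mx; rewrite ME mulmxDl mul1mx => /eqP; rewrite -[X in _ == X]addr0 => /eqP/addrI.
have dN : \det N = 0.
  have : (\det N) *: x = 0 by rewrite -mul_scalar_mx -mul_adj_mx -mulmxA Nx mulmx0.
  by move/eqP; rewrite scaler_eq0 (negPf x0) orbF => /eqP.
have tN : N ord0 ord0 + N ord_max ord_max = 0.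
  have : \det M = 1 + (N ord0 ord0 + N ord_max ord_max) + \det N.
    by rewrite ME !det_mx22 !mxE /=; ring.
  by rewrite dM dN addr0 -{1}[1]addr0 => /addrI.
have e0 := congr1 (fun M : 'cV[C]_2 => M ord0 ord0) Nx.
have e1 := congr1 (fun M : 'cV[C]_2 => M ord_max ord0) Nx.
rewrite !mulmx2 !mxE in e0 e1.
have e11 : N ord_max ord_max = - N ord0 ord0 by apply/eqP; rewrite -addr_eq0 addrC tN.
have mE m : N ord0 ord0 = - (m * (x ord0 ord0 * x ord_max ord0)) ->
    N ord0 ord_max = m * x ord0 ord0 ^+ 2 -> N ord_max ord0 = - (m * x ord_max ord0 ^+ 2) ->
    M = 1%:M + m *: (x *m perp x).
  move=> h00 h01 h10; rewrite ME; congr (_ + _).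
  apply/matrixP => i j; rewrite mxE [in RHS]mxE big_ord1 !mxE.
  case: (ord2E i) => ->; case: (ord2E j) => -> /=.
  - by rewrite h00; ring.
  - by rewrite h01; ring.
  - by rewrite h10; ring.
  - by rewrite e11 h00; ring.
rewrite e11 in e1; move: (N ord0 ord0) (N ord0 ord_max) (N ord_max ord0) e0 e1 mE => a b c e0 e1 mE.
have [x1|x1] := eqVneq (x ord_max ord0) 0; rewrite ?x1 in e0 e1 mE.
  have x00 : x ord0 ord0 != 0.
    by apply: contra_neq x0 => h; apply: cV2P; rewrite mxE ?h ?x1.
  exists (b / x ord0 ord0 ^+ 2); apply: mE; rewrite ?mulr0 ?oppr0.
  - by move: e0; rewrite mulr0 addr0 => /eqP; rewrite mulf_eq0 (negPf x00) orbF => /eqP.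
  - by rewrite divfK // expf_neq0.
  - move: e1; rewrite mulr0 addr0 => /eqP; rewrite mulf_eq0 (negPf x00) orbF => /eqP ->.
    by rewrite expr0n mulr0 oppr0.
have aE : a = c * x ord0 ord0 / x ord_max ord0.
  apply: (mulIf x1); rewrite divfK //; apply/eqP; rewrite -subr_eq0 -oppr_eq0; apply/eqP.
  by rewrite -e1; ring.
have bE : b = - a * x ord0 ord0 / x ord_max ord0.
  apply: (mulIf x1); rewrite divfK //; apply/eqP; rewrite -subr_eq0; apply/eqP.
  by rewrite -e0; ring.
exists (- c / x ord_max ord0 ^+ 2); apply: mE.
- by rewrite aE; field.
- by rewrite bE aE; field.
- by field.
Qed.

Section TraceField.
Variables (F : {pred C}) (G : 'M[C]_2 -> Prop).
Hypothesis hF : divring_closed F.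
Hypothesis G1 : G 1%:M.
Hypothesis GM : forall M N, G M -> G N -> G (M *m N).
Hypothesis GF : forall M, G M -> \tr M \in F.

HB.instance Definition _ := GRing.isDivringClosed.Build C F hF.

(** Traces of products of matrices [N - 1] are reached by expanding them; this property is stable
    under the successive multiplications, which the mere membership of the trace is not. *)
Let good M := forall N, G N -> \tr (M *m N) \in F.

Lemma good_step M N : good M -> G N -> good (M *m (N - 1%:M)).
Proof.
move=> gM gN N' gN'; rewrite mulmxBr mulmx1 mulmxBl raddfB rpredB ?gM //.
by rewrite -mulmxA; apply: gM; apply: GM.
Qed.

(** [P v - 1] is an unknown multiple [m_v] of [Z v *m perp (Z v)]. Each [m_v] occurs once in the
    trace of the product of four and once in the product of the two other traces, so it cancels and
    a cross-ratio remains. *)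
Lemma cross_ratio_trace (P : 'I_4 -> 'M[C]_2) (Z : 'I_4 -> 'cV[C]_2) :
  (forall v, G (P v)) -> (forall v, \det (P v) = 1) -> (forall v, P v *m Z v = Z v) ->
  (forall v, P v != 1%:M) -> (forall v w, v != w -> bracket (Z v) (Z w) != 0) ->
  bracket (Z o1) (Z o3) * bracket (Z o3) (Z o0) * bracket (Z o0) (Z o2) * bracket (Z o2) (Z o1) /
    (bracket (Z o1) (Z o2) ^+ 2 * bracket (Z o0) (Z o3) ^+ 2) \in F.
Proof.
move=> gP dP PZ P1 Zn.
have form v : exists m, P v = 1%:M + m *: (Z v *m perp (Z v)).
  have [w vw] : exists w : 'I_4, v != w.
    by exists (if v == o0 then o1 else o0); have [->|] := eqVneq v o0.
  exact: unipotent_form (dP v) (PZ v) (Zn _ _ vw).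
have [m0 E0] := form o0; have [m1 E1] := form o1; have [m2 E2] := form o2; have [m3 E3] := form o3.
have nz v m : P v = 1%:M + m *: (Z v *m perp (Z v)) -> m != 0.
  by move=> E; apply: contra_neq (P1 v) => m0'; rewrite E m0' scale0r addr0.
have n0 := nz _ _ E0; have n1 := nz _ _ E1; have n2 := nz _ _ E2; have n3 := nz _ _ E3.
have N v m : P v = 1%:M + m *: (Z v *m perp (Z v)) -> P v - 1%:M = m *: (Z v *m perp (Z v)).
  by move=> ->; rewrite addrC addKr.
have g1 : good 1%:M by move=> M gM; rewrite mul1mx GF.
have tr_good M : good M -> \tr M \in F by move=> gM; rewrite -(mulmx1 M) gM.
have t4 := tr_good _ (good_step (good_step (good_step (good_step g1 (gP o1)) (gP o3)) (gP o0)) (gP o2)).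
have t12 := tr_good _ (good_step (good_step g1 (gP o1)) (gP o2)).
have t30 := tr_good _ (good_step (good_step g1 (gP o3)) (gP o0)).
rewrite mul1mx (N _ _ E1) (N _ _ E3) (N _ _ E0) (N _ _ E2) line_trace4 in t4.
rewrite mul1mx (N _ _ E1) (N _ _ E2) line_trace2 in t12.
rewrite mul1mx (N _ _ E3) (N _ _ E0) line_trace2 in t30.
have := rpred_div (rpred_div t4 t12) t30; set u := _ / _ / _; set v := _ / (_ * _).
suff -> : u = v by [].
have n12 := Zn o1 o2 isT; have n03 := Zn o0 o3 isT; rewrite /u /v (bracket_anti (Z o0) (Z o3)).
rewrite sqrrN.
  move: (bracket (Z o1) (Z o2)) (bracket (Z o0) (Z o3)) n12 n03 (bracket (Z o1) (Z o3)) (bracket (Z o0) (Z o2)) (bracket (Z o2) (Z o1)).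
move=> b12 b03 n12 n03 b13 b02 b21; field; rewrite ?oppr_eq0 ?oner_eq0 ?n0 ?n1 ?n2 ?n3 ?n12 ?n03 /=.
by rewrite ?mulf_neq0 ?expf_neq0.
Qed.
End TraceField.

End Plane.

(** * Parabolic elements fixing the vertices of a tetrahedron *)

Section Parabolic.
Variables (C : fieldType) (n : nat) (T : gluing n).
Local Notation tet := 'I_n.+1.
Local Notation gt := (glue_tet T).
Local Notation gp := (glue_perm T).
Variables (q : tet -> 'I_3) (z : tet -> C) (A : tet -> 'I_4 -> 'M[C]_2).
Hypothesis hT : oriented_gluing T.
Hypothesis hz : forall j, z j != 0 /\ z j != 1.
Local Notation X := (vertex q z).
Hypothesis hA : forall j f, A j f \in unitmx /\
  forall v, v != f -> exists c : C, A j f *m X (gt j f) (gp j f v) = c *: X j v.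
Variable hol : tet -> seq 'I_4 -> 'M[C]_2.
Hypothesis hol_nil : forall j, hol j [::] = 1%:M.
Hypothesis hol_cons : forall j f w, hol j (f :: w) = A j f *m hol (gt j f) w.
Local Notation lwalk := (foldl (lstep T)).
Local Notation validL := (valid (lstep T) (@side_ok n)).
Local Notation chi := (chi q z hT).

Lemma holonomy_cat j u w : hol j (u ++ w) = hol j u *m hol (walk T j u) w.
Proof. by elim: u j => [|f u IH] j /=; rewrite ?hol_nil ?mul1mx // !hol_cons IH mulmxA. Qed.

Lemma holonomy_unit j w : hol j w \in unitmx.
Proof.
elim: w j => [|f w IH] j; rewrite ?hol_nil ?unitmx1 // hol_cons unitmx_mul IH andbT.
by case: (hA j f).
Qed.

Lemma lwalk_walk x w : (lwalk x w).1 = walk T x.1 w.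
Proof. by elim: w x => //= f w IH x; rewrite IH. Qed.

(* [kap] measures how far the holonomy along [w] is from being parabolic. *)
Definition fixes (x : tet * 'I_4) (w : seq 'I_4) (kap : C) : Prop :=
  exists2 c, c != 0 & hol x.1 w *m X (lwalk x w).1 (lwalk x w).2 = c *: X x.1 x.2 /\
    \det (hol x.1 w) = kap * c ^+ 2.

Lemma fixes_nil x : fixes x [::] 1.
Proof.
by exists 1; rewrite ?oner_neq0 //= hol_nil mul1mx scale1r det1 expr1n mulr1.
Qed.

Lemma fixes_cat x u w k l : fixes x u k -> fixes (lwalk x u) w l -> fixes x (u ++ w) (k * l).
Proof.
case=> c c0 [Ec dc] [d d0 [Ed dd]]; exists (c * d); first by rewrite mulf_neq0.
rewrite foldl_cat holonomy_cat -lwalk_walk; split.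
  by rewrite -mulmxA Ed -scalemxAr Ec scalerA mulrC.
by rewrite det_mulmx dc dd; ring.
Qed.

Lemma fixes_step d : fixes (fsrc d) [:: fr d o2] (chi d).
Proof.
have [c c0 [Ec dc]] := chi_det hT hz hA d; exists c => //.
have -> : lwalk (fsrc d) [:: fr d o2] = fsrc (fopp hT d) by rewrite fsrc_opp.
by rewrite hol_cons hol_nil mulmx1.
Qed.

Lemma fixes_path x w : validL x w -> exists2 k, k != 0 &
  fixes x w k /\ fixes (lwalk x w) (rev_walk T x.1 w) k^-1.
Proof.
elim: w x => [|f w IH] x /=.
  by move=> _; exists 1; rewrite ?oner_neq0 //; split; rewrite ?invr1; exact: fixes_nil.
case/andP=> xf vw; have [k k0 [hk hk']] := IH _ vw.
have [d dE] := cr_surj x.1 xf.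
have dx : fsrc d = x by case: dE => h1 h2 _; rewrite /fsrc h1 h2 -surjective_pairing.
have df : fr d o2 = f by case: dE.
have ox : fsrc (fopp hT d) = lstep T x f by rewrite fsrc_opp dx df.
exists (chi d * k); first by rewrite mulf_neq0 ?chi_neq0.
have hd := fixes_step d; have hd' := fixes_step (fopp hT d).
rewrite dx df in hd; rewrite ox chi_opp // in hd'; split.
  by rewrite -[f :: w]cat1s; apply: fixes_cat.
rewrite invfM mulrC -cats1; apply: fixes_cat; first exact: hk'.
have -> : lwalk (lwalk (lstep T x f) w) (rev_walk T (gt x.1 f) w) = lstep T x f by exact: (lwalk_rev hT).
by have [_ _ _ h _] := fr_opp hT d; rewrite h df in hd'; case: dE => <- _ _.
Qed.

Lemma fixes_flags d ds : path [rel d d' : flag n | fsrc (fopp hT d) == fsrc d'] d ds ->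
  fixes (fsrc d) [seq fr d o2 | d <- d :: ds] (\prod_(d <- d :: ds) chi d) /\
  lwalk (fsrc d) [seq fr d o2 | d <- d :: ds] = fsrc (fopp hT (last d ds)).
Proof.
elim: ds d => [|d' ds IH] d /=.
  by move=> _; rewrite big_seq1 fsrc_opp; split=> //; exact: fixes_step.
case/andP=> /eqP E /IH [h1 h2]; rewrite -fsrc_opp E big_cons; split=> //.
rewrite -cat1s; apply: fixes_cat; first exact: fixes_step.
by rewrite /= -fsrc_opp E.
Qed.

(** The three vertices of the common face are pairwise independent eigenvectors of the composite. *)
Lemma glue_back j f : exists c, A j f *m A (gt j f) (gp j f f) = c%:M.
Proof.
have [_ h1] := hA j f; have [_ h2] := hA (gt j f) (gp j f f).
have eig v : v != f -> exists c, A j f *m A (gt j f) (gp j f f) *m X j v = c *: X j v.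
  move=> vf; have [c E] := h1 v vf.
  have := h2 (gp j f v); rewrite (inj_eq perm_inj) => /(_ vf) [d].
  rewrite gtK // gpK // => Ed; exists (d * c).
  by rewrite -mulmxA Ed -scalemxAr E scalerA.
have [a [b [c [af bf cf abc]]]] : exists a b c : 'I_4, [/\ a != f, b != f, c != f & uniq [:: a; b; c]].
  by case: (ord4E f) => ->; [exists o1, o2, o3|exists o0, o2, o3|exists o0, o1, o3|exists o0, o1, o2].
have [ca Ea] := eig a af; have [cb Eb] := eig b bf; have [cc Ec] := eig c cf.
move: abc; rewrite /= !inE negb_or andbT => /andP[/andP[ab ac] bc].
by exists ca; apply: three_eigenvectors Ea Eb Ec _ _ _; apply: bracket_neq0.
Qed.

Lemma holonomy_rev j w : exists c, hol j w *m hol (walk T j w) (rev_walk T j w) = c%:M.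
Proof.
elim: w j => [|f w IH] j; first by exists 1; rewrite hol_nil mul1mx.
have [c E] := IH (gt j f); have [d D] := glue_back j f; exists (c * d).
rewrite /= -cats1 holonomy_cat hol_cons walk_rev // [hol _ [:: _]]hol_cons hol_nil mulmx1.
rewrite mulmxA -(mulmxA (A j f)) E -scalemx1 -scalemxAr mulmx1 -scalemxAl D.
by rewrite -scalemx1 scalerA scalemx1.
Qed.

Variables (F : {pred C}).
Hypothesis hF : divring_closed F.
HB.instance Definition _ := GRing.isDivringClosed.Build C F hF.
Hypothesis trF : forall w c, loop T w -> \det (c *: hol (base n) w) = 1 ->
  \tr (c *: hol (base n) w) \in F.
Hypothesis faithful : forall w, loop T w -> is_scalar_mx (hol (base n) w) ->
  M_homotopic T (base n) w [::].

Variables (alpha : seq 'I_4 -> int) (pT : tet -> seq 'I_4).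
Hypothesis halpha : pi1_epi T alpha.
Hypothesis hpT : forall j, walk T (base n) (pT j) = j.

Lemma holonomy_conj j w : walk T j w = j -> exists2 s, s != 0 &
  loop T (pT j ++ w ++ rev_walk T (base n) (pT j)) /\
  exists U V, [/\ U *m V = s%:M, V *m U = s%:M &
    hol (base n) (pT j ++ w ++ rev_walk T (base n) (pT j)) = U *m hol j w *m V].
Proof.
move=> wj; have [s E] := holonomy_rev (base n) (pT j).
have uU := holonomy_unit (base n) (pT j); rewrite hpT in E.
have uV := holonomy_unit j (rev_walk T (base n) (pT j)).
exists s.
  apply/eqP => s0; move: E; rewrite s0 raddf0 => /(congr1 (mulmx (invmx (hol (base n) (pT j))))).
  by rewrite mulKmx // mulmx0 => V0; move: uV; rewrite V0 unitmxE det0 unitr0.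
split; first by rewrite /loop !walk_cat // hpT wj -[X in walk T X (rev_walk _ _ _)](hpT j) walk_rev.
exists (hol (base n) (pT j)), (hol j (rev_walk T (base n) (pT j))); split=> //.
  have VE : hol j (rev_walk T (base n) (pT j)) = s *: invmx (hol (base n) (pT j)).
    by rewrite -[LHS](mulKmx uU) E mul_mx_scalar.
  by rewrite VE -scalemxAl mulVmx // scalemx1.
by rewrite !holonomy_cat hpT wj mulmxA.
Qed.

Definition loop_group j (M : 'M[C]_2) : Prop :=
  \det M = 1 /\ exists w c, walk T j w = j /\ M = c *: hol j w.

(** Conjugation by the holonomy of [pT j] moves the loop to the base tetrahedron without changing
    the trace. The reversed path is inverse only up to the scalar [s], hence the normalisation
    [c / s]. *)
Lemma loop_group_trace j M : loop_group j M -> \tr M \in F.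
Proof.
case=> dM [w [c [wj ME]]]; have [s s0 [lw [U [V [UV VU E]]]]] := holonomy_conj wj.
have trE : \tr (c / s *: hol (base n) (pT j ++ w ++ rev_walk T (base n) (pT j))) = \tr M.
  rewrite E mxtraceZ -mulmxA mxtrace_mulC -mulmxA VU mul_mx_scalar mxtraceZ ME mxtraceZ.
  by rewrite mulrA divfK.
rewrite -trE; apply: trF => //; rewrite detZ E !det_mulmx.
have duv : \det U * \det V = s ^+ 2 by rewrite -det_mulmx UV det_scalar.
transitivity (c ^+ 2 * \det (hol j w) * (\det U * \det V) / s ^+ 2).
  by rewrite expr_div_n; field.
by rewrite duv mulfK ?expf_neq0 // -detZ -ME.
Qed.

Lemma loop_group1 j : loop_group j 1%:M.
Proof. by split; rewrite ?det1 //; exists [::], 1; rewrite hol_nil scale1r. Qed.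

Lemma loop_groupM j M N : loop_group j M -> loop_group j N -> loop_group j (M *m N).
Proof.
move=> [dM [u [c [uj ME]]]] [dN [w [d [wj NE]]]]; split.
  by rewrite det_mulmx dM dN mulr1.
exists (u ++ w), (c * d); rewrite walk_cat uj wj holonomy_cat uj ME NE; split=> //.
by rewrite -scalemxAl -scalemxAr scalerA.
Qed.

Lemma rev_walk_cat j u w : rev_walk T j (u ++ w) = rev_walk T (walk T j u) w ++ rev_walk T j u.
Proof. by elim: u j => [|f u IH] j /=; rewrite ?cats0 // IH rcons_cat. Qed.

Hypothesis hc : one_cusped T.
Variables (dm : flag n) (dms : seq (flag n)).
Let muw := [seq fr d o2 | d <- dm :: dms].
Hypothesis muP : path.cycle (flag_step hT) (dm :: dms).
Hypothesis muC : \prod_j \prod_s shape_param z s j ^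
  Cv T q [seq cr d | d <- dm :: dms] s ord0 j = 1.
Hypothesis mu_neq0 : forall u, walk T (base n) u = ft dm ->
  alpha (u ++ muw ++ rev_walk T (base n) u) != 0.

(** Any two triangles of the link are connected, so [mu] can be reached from [(j, v)] inside the
    link. The factors of the path and of its reverse cancel, and that of [mu] is 1, so dividing by
    [c] gives a unipotent matrix. *)
Lemma parabolic j v : exists M,
  [/\ loop_group j M, \det M = 1, M *m X j v = X j v & M != 1%:M].
Proof.
have [y [vy ly]] := link_path (j, v) hc (fsrc dm).
have [k k0 [hk hk']] := fixes_path vy; rewrite ly in hk'.
have pmu : path [rel d d' : flag n | fsrc (fopp hT d) == fsrc d'] dm dms.
  have := muP; rewrite /= rcons_path => /andP[+ _].
  by apply: sub_path => d d' /andP[].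
have [fmu lmu] := fixes_flags pmu; rewrite (prod_chi hz muP muC) in fmu.
have lmu' : lwalk (fsrc dm) muw = fsrc dm.
  rewrite lmu; apply/eqP; have := muP; rewrite /= rcons_path => /andP[_ /andP[]].
  by [].
pose W := y ++ muw ++ rev_walk T j y.
have fW : fixes (j, v) W 1.
  rewrite -(mulfV k0) -[k^-1]mul1r; apply: fixes_cat => //; rewrite ly.
  by apply: fixes_cat => //; rewrite lmu'.
have lW : lwalk (j, v) W = (j, v).
  by rewrite /W !foldl_cat ly lmu' -ly; exact: (lwalk_rev hT).
have wW : walk T j W = j by rewrite -(lwalk_walk (j, v)) lW.
have [c c0 [Ec dc]] := fW; rewrite lW /= in Ec dc.
have dM : \det (c^-1 *: hol j W) = 1.
  by rewrite detZ dc mul1r exprVn mulVf // expf_neq0.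
exists (c^-1 *: hol j W); split=> //.
- by split=> //; exists W, c^-1.
- by rewrite -scalemxAl Ec scalerA mulVf // scale1r.
apply/eqP => M1; have HW : hol j W = c%:M.
  by rewrite -[LHS]scale1r -(mulfV c0) -scalerA M1 scalemx1.
have [s s0 [lp [U [V [UV VU E]]]]] := holonomy_conj wW.
have sc : is_scalar_mx (hol (base n) (pT j ++ W ++ rev_walk T (base n) (pT j))).
  rewrite E HW mul_mx_scalar -scalemxAl UV -scalemx1 scalerA scalemx1.
  exact: scalar_mx_is_scalar.
(* A scalar holonomy would make the loop trivial, although [alpha] does not vanish on this conjugate
   of [mu]. *)
have ht := faithful lp sc.
have word : pT j ++ W ++ rev_walk T (base n) (pT j) =
    (pT j ++ y) ++ muw ++ rev_walk T (base n) (pT j ++ y).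
  by rewrite rev_walk_cat hpT /W -!catA.
suff /mu_neq0 : walk T (base n) (pT j ++ y) = ft dm.
  by rewrite -word (alpha_htp halpha lp _ ht) // (alpha_nil halpha) eqxx.
by rewrite walk_cat hpT -(lwalk_walk (j, v)) ly.
Qed.

(** For the standard positions infinity, 0, 1 and [S], the cross-ratio of [cross_ratio_trace] is
    exactly [S]. *)
Lemma edge_shape_trace j : shape_param z (label q j o0 o1) j \in F.
Proof.
have [P hP] := choice (parabolic j).
have [s0 s1] := shape_nz hz (label q j o0 o1) j.
have := @cross_ratio_trace _ _ _ hF (loop_group1 j) (@loop_groupM j) (@loop_group_trace j)
  P (X j) (fun v => let: And4 h _ _ _ := hP v in h) (fun v => let: And4 _ h _ _ := hP v in h)
  (fun v => let: And4 _ _ h _ := hP v in h) (fun v => let: And4 _ _ _ h := hP v in h) (bracket_neq0 q hz j).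
rewrite !bracket_vertex /=; set u := _ / _; suff -> : u = shape_param z (label q j o0 o1) j by [].
by rewrite /u; field; rewrite ?oner_eq0.
Qed.

Lemma shape_trace j : z j \in F.
Proof.
have := edge_shape_trace j; have [s0 s1] := shape_nz hz (label q j o0 o1) j.
have [z0 z1] := hz j; have nz : 1 - z j != 0 by rewrite subr_eq0 eq_sym.
move: s0 s1; rewrite /shape_param.
case: (label q j o0 o1) => [[|[|[|m]]] hm] //= s0 s1 hS.
- have : 1 - (1 - z j)^-1^-1 \in F by apply: rpredB; [exact: rpred1|exact: rpredVr].
  by rewrite invrK opprB addrCA subrr addr0.
- have : (1 - (1 - (z j)^-1))^-1 \in F by apply/rpredVr/rpredB; [exact: rpred1|].
  by rewrite opprB addrCA subrr addr0 invrK.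
Qed.
End Parabolic.

(** * Membership in the trace field and conclusion *)

Section DivringClosed.
Variables (C : fieldType) (F : {pred C}).
Hypothesis hF : divring_closed F.
HB.instance Definition _ := GRing.isDivringClosed.Build C F hF.

Lemma one_loop_rpred n (T : gluing n) z q e f c :
  (forall j, z j \in F) -> one_loop T z q e f c \in F.
Proof.
move=> zF; have zetaF s j : zeta z s j \in F.
  rewrite /zeta; case: s => [[|[|[|m]]] hm] //=; rewrite rpredV //.
  - by rewrite rpredB ?rpred1.
  - by rewrite rpredM ?rpredB ?rpred1.
apply: rpred_div; last first.
  apply: rpredM; first exact: rpred_nat.
  by apply: rpred_prod => j _; apply: rpred_prod => s _; apply: rpredXz.
apply: rpred_sum => p _; rewrite rpredMsign; apply: rpred_prod => i _.
rewrite summxE; apply: rpred_sum => s _.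
rewrite mxE; apply: rpred_sum => l _; rewrite !mxE rpredM ?rpred_int //.
by case: (l == _); rewrite ?mulr1n ?mulr0n ?rpred0.
Qed.
End DivringClosed.

Lemma ratr_relation (K : numFieldType) (b : bool) (m p : int) (u v : rat) :
  p%:~R = (-1) ^+ b * m%:~R + (u - v) ->
  p%:~R = (-1) ^+ b * m%:~R + (ratr u - ratr v) :> K.
Proof.
by move/(congr1 (@ratr K)); rewrite rmorphD rmorphB rmorphM rmorph_sign /= !ratr_int.
Qed.

Lemma curve_sum n (T : gluing n) (hT : oriented_gluing T) alpha (halpha : pi1_epi T alpha)
    (pT : 'I_n.+1 -> seq 'I_4) (hpT : forall j, walk T (base n) (pT j) = j) d ds :
  path.cycle (flag_step hT) (d :: ds) -> forall u, walk T (base n) u = ft d ->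
  alpha (u ++ [seq fr x o2 | x <- d :: ds] ++ rev_walk T (base n) u) =
  \sum_(x <- d :: ds) acoch T alpha pT (ft x) (fr x o2).
Proof.
move=> dsP u uE.
have gen x s : path (flag_step hT) x s ->
    walk T (ft x) [seq fr y o2 | y <- x :: s] = ft (fopp hT (last x s)) /\
    asum T alpha pT (ft x) [seq fr y o2 | y <- x :: s] =
      \sum_(y <- x :: s) acoch T alpha pT (ft y) (fr y o2).
  elim: s x => [|y s IH] x /=.
    by move=> _; have [-> _ _ _ _] := fr_opp hT x; rewrite big_seq1 addr0.
  case/andP=> /andP[/eqP E _] /IH [h1 h2].
  have fy : glue_tet T (ft x) (fr x o2) = ft y.
    by have [<- _ _ _ _] := fr_opp hT x; have := congr1 fst E.
  by rewrite big_cons -h2 fy -h1.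
have [/gen [h1 h2] E] : path (flag_step hT) d ds /\ fsrc (fopp hT (last d ds)) = fsrc d.
  by move: dsP; rewrite /= rcons_path => /andP[pds /andP[/eqP E _]].
rewrite -h2; apply: (alpha_loop hT halpha hpT uE).
by rewrite h1; have := congr1 fst E.
Qed.

Theorem theorem1p7 (R : realType) (n : nat) (T : gluing n)
    (q : 'I_n.+1 -> 'I_3) (e : 'I_n.+1 -> 'I_n.+1 * 'I_4 * 'I_4)
    (z : 'I_n.+1 -> complex R) (A : 'I_n.+1 -> 'I_4 -> 'M[complex R]_2)
    (alpha : seq 'I_4 -> int) (mu lambda : seq (crossing n))
    (pT pE : 'I_n.+1 -> seq 'I_4) (f : 'I_3 -> 'cV[int]_n.+1)
    (hT : one_cusped_triangulation T)
    (he : edge_enumeration T e)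
    (hz : forall j, z j != 0 /\ z j != 1)
    (hglue : gluing_equations T z q e)
    (hcompl : completeness_equations T z q)
    (hgeom : geometric_holonomy T q z A)
    (halpha : pi1_epi T alpha)
    (hmu : peripheral_curve T mu) (hamu : curve_value T alpha mu 1)
    (hlambda : peripheral_curve T lambda) (halambda : curve_value T alpha lambda 0)
    (hlifts : lifts T e pT pE)
    (hf : flattening T q e f) :
  let tau_lambda := one_loop T z q e f lambda in
  (forall (s : bool) (r : int),
     let tau := (-1) ^+ s * tvar (complex R) ^ r
                * twisted_one_loop T z q e alpha pT pE f in
     laurent_value1 tau 0 /\
     (laurent_deriv1 tau tau_lambda \/ laurent_deriv1 tau (- tau_lambda))) /\
  trace_field T A tau_lambda.
Proof.
move=> tau_lambda.
have [hor hc ht] := hT; have [hpT hpE] := hlifts.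
have [hA hfaith _ _] := hgeom.
have [idx [k hk]] := lift_potential hor halpha hpT he hpE.
pose a (x : flag n) := acoch T alpha pT (ft x) (fr x o2).
pose K (x : flag n) := k (ft x, fr x o0, fr x o1).
have K_step x (b c : 'I_4) : b != c -> b != o2 -> c != o2 ->
    k (glue_tet T (ft x) (fr x o2), glue_perm T (ft x) (fr x o2) (fr x b),
       glue_perm T (ft x) (fr x o2) (fr x c)) = k (ft x, fr x b, fr x c) + a x.
  move=> bc b2 c2; have bc' : fr x b != fr x c by rewrite (inj_eq perm_inj).
  by have [_ _ _ h] := hk (ft x) _ _ bc'; case: (h (fr x o2)); rewrite ?(inj_eq perm_inj) // eq_sym.
have a_opp x : a (fopp hor x) = - a x.
  by rewrite /a; have [-> _ _ -> _] := fr_opp hor x; rewrite acochV.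
have K_turn x : K (fnxt (fopp hor x)) = K x + a x.
  rewrite /K; have [-> -> -> _ _] := fr_nxt (fopp hor x).
  by have [-> -> _ _ ->] := fr_opp hor x; exact: K_step.
have K_opp x : K (fopp hor x) = K (fnxt x) + a x.
  rewrite /K; have [-> -> -> _ _] := fr_nxt x.
  by have [-> -> -> _ _] := fr_opp hor x; exact: K_step.
have [mu_normal mu_simple mu_nontriv] := hmu.
have [dm [muE muP]] := curve_flags hor mu_normal.
(* The empty curve is excluded by [nontrivial_in_link]. *)
case: dm muE muP mu_nontriv hamu => [|dm dms] muE muP; rewrite muE //= => mu_nontriv hamu'.
have [la_normal la_simple la_nontriv] := hlambda.
have [dl [laE laP]] := curve_flags hor la_normal.
case: dl laE laP la_nontriv halambda => [|dl dls] laE laP; rewrite laE //= => la_nontriv halambda'.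
have words ds : face_word [seq cr d | d <- ds] = [seq fr d o2 | d <- ds :> seq (flag n)].
  by rewrite /face_word -map_comp.
have mu1 : \sum_(x <- dm :: dms) a x = 1.
  case: hamu' => u uE E; apply: (etrans (esym (curve_sum halpha hpT muP uE))).
  by rewrite -words.
have la0 : \sum_(x <- dl :: dls) a x = 0.
  case: halambda' => u uE E; apply: (etrans (esym (curve_sum halpha hpT laP uE))).
  by rewrite -words.
have la_nontriv' : ~ link_homotopic T (fsrc dl) [seq fr d o2 | d <- dl :: dls] [::].
  by rewrite -words.
rewrite laE in la_simple.
have [b [h hcross]] := lambda_class hc ht a_opp K_turn K_opp muP mu1 laP la0 la_simple la_nontriv'.
split.
  have idxP j v w i : v != w -> (exists y, around T (j, v, w) y (e i)) <-> i = idx (j, v, w).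
    by move=> vw; have [h1 _ _ _] := hk j v w vw.
  have kP j v w i m : v != w -> (exists2 y, around T (j, v, w) y (e i) &
      m + alpha (pT j ++ y ++ rev_walk T (base n) (pE i)) = 0) <-> i = idx (j, v, w) /\ m = k (j, v, w).
    by move=> vw; have [_ h2 _ _] := hk j v w vw.
  have k_sym j v w : v != w -> k (j, w, v) = k (j, v, w).
    by move=> vw; have [_ _ [] ] := hk j v w vw.
  (* The link was studied over the rationals; the relation is transported to the complex numbers
     before entering the determinant. *)
  have hcross' x : (crossing_number hor (dl :: dls) x)%:~R =
      (-1) ^+ b * (K x - K (fnxt x))%:~R
      + (ratr (h (fvert hor x)) - ratr (h (fvert hor (fnxt x)))) :> complex R.
    exact: ratr_relation (hcross x).
  have [H CvE] := @Cv_row _ _ q e _ z hor hz idx k idxP k_sym _ _ laP _ (fun v => ratr (h v)) hcross'.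
  move=> s r.
  have [tau0 tau1] := twisted_derivative hz idxP kP CvE f (erefl _) s r.
  split; first exact: tau0.
  move: tau1; rewrite -laE; case: (s (+) b); rewrite ?expr1 ?expr0 ?mulN1r ?mul1r => tau1.
    by right.
  by left.
(* The 1-loop invariant is a rational expression in the shapes, so it suffices that each shape lies
   in every subfield [F] containing the traces. *)
move=> F hF trF; apply: one_loop_rpred => //.
apply: (shape_trace hz (A := A) hA (hol := holonomy T A) _ _ hF _ hfaith halpha hpT hc muP _ _) => //.
- move=> w c lw dw; apply: trF; split=> //; by exists w, c.
- by rewrite -muE; apply: hcompl.
- by move=> u uE; rewrite (curve_sum halpha hpT muP uE) mu1.
Qed.
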